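(* Let $f$ be a continuous real-valued function on an interval $I\subset\mathbb{R}$ with nonempty interior $I^0$, and suppose $f$ is $C^2$ on $I^0$. Then $f$ is strongly operator convex on $I$ if and only if $$\begin{pmatrix} F_n''(t)(h,h)/2 & F_n'(t)\cdot h\\ F_n'(t)\cdot h & F_n(t)\end{pmatrix}\ge 0$$ (as a $2n\times 2n$ matrix) for all positive integers $n$, all self-adjoint $n\times n$ matrices $t$ with $\sigma(t)\subset I^0$, and all self-adjoint $n\times n$ matrices $h$.
   Context: Matrices are complex. $F_n$ denotes the function $t\mapsto f(t)$ (continuous functional calculus) on the set of self-adjoint $n\times n$ matrices $t$ with spectrum $\sigma(t)\subset I^0$. Its first derivative at $t$ is the linear map $h\mapsto F_n'(t)\cdot h$ on the space of self-adjoint $n\times n$ matrices, and its second derivative at $t$ is the symmetric bilinear map $(h,k)\mapsto F_n''(t)(h,k)$ on the same space, with values in self-adjoint $n\times n$ matrices. A continuous real-valued function $g$ on an interval $I$ is operator convex if $g(sh_1+(1-s)h_2)\le s g(h_1)+(1-s)g(h_2)$ for all $s\in[0,1]$ and all bounded self-adjoint operators $h_1,h_2$ on a Hilbert space $H$ with $\sigma(h_1),\sigma(h_2)\subset I$, for every Hilbert space $H$. A continuous real-valued function $f$ on an interval $I$ is strongly operator convex if either $f=0$ on $I$, or $f(x)>0$ for all $x\in I$ and $-1/f$ is operator convex on $I$. *)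

(* Defs.v *)
From HB Require Import structures.
From mathcomp Require Import all_boot all_order all_algebra.
From mathcomp Require Import sesquilinear spectral complex.
From mathcomp Require Import all_classical all_reals all_analysis.

Set Implicit Arguments.
Unset Strict Implicit.
Unset Printing Implicit Defensive.

Import Order.TTheory GRing.Theory Num.Theory.
Import numFieldNormedType.Exports.

Local Open Scope complex_scope.
Local Open Scope sesquilinear_scope.
Local Open Scope ring_scope.
Local Open Scope classical_set_scope.

(* A complex Hilbert space is a Banach space [H] over [R[i]] whose norm comes
   from a positive definite form, linear in its first argument. *)
Definition is_hilbert_dot (R : realType) (H : completeNormedModType R[i])
    (dot : {dot H for (@Num.conj R[i])}) : Prop :=
  forall u : H, `|u| ^+ 2 = dot u u.

Section Operators.
Context {R : realType} {H : completeNormedModType R[i]}.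
Variable dot : {dot H for (@Num.conj R[i])}.
Implicit Types (a b h k : {linear H -> H}).

Definition bounded_selfadjoint h : Prop :=
  continuous h /\ forall u v : H, dot (h u) v = dot u (h v).

(* Complement of the set of [z] for which [h - z] is invertible in B(H). *)
Definition op_spectrum h : set R[i] :=
  [set z | ~ exists k, [/\ continuous k,
     forall u, k (h u - z *: u) = u & forall u, h (k u) - z *: k u = u]].

Definition op_le a b : Prop := forall u : H, 0 <= dot (b u - a u) u.

Definition op_poly (p : {poly R}) h (u : H) : H :=
  \sum_(i < size p) (p`_i)%:C *: iter i h u.

(* [a] is the limit in operator norm of [p(h)] as the real polynomials [p]
   tend to [g] uniformly on the spectrum of [h]. *)
Definition is_cfc (g : R -> R) h a : Prop :=
  forall e : R, 0 < e -> exists p : {poly R},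
    (forall x : R, op_spectrum h x%:C -> `|p.[x] - g x| <= e) /\
    (forall u : H, `|op_poly p h u - a u| <= e%:C * `|u|).

(* The continuous functional calculus [g(h)]; junk unless [h] is bounded
   self-adjoint and [g] is continuous on the spectrum of [h]. *)
Definition cfc (g : R -> R) h : {linear H -> H} := get (is_cfc g h).

Definition op_conv (s : R) h k : {linear H -> H} :=
  s%:C \*: h \+ (1 - s)%:C \*: k.

End Operators.

(* Spectra are sets of complex numbers; [I] is embedded to compare them. *)
Definition real_set (R : realType) (I : set R) : set R[i] :=
  [set x%:C | x in I].

Definition operator_convex (R : realType) (I : set R) (g : R -> R) : Prop :=
  {within I, continuous g} /\
  forall (H : completeNormedModType R[i])
    (dot : {dot H for (@Num.conj R[i])}), is_hilbert_dot dot ->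
  forall h1 h2 : {linear H -> H},
    bounded_selfadjoint dot h1 -> bounded_selfadjoint dot h2 ->
    op_spectrum h1 `<=` real_set I -> op_spectrum h2 `<=` real_set I ->
  forall s : R, 0 <= s <= 1 ->
    op_le dot (cfc g (op_conv s h1 h2)) (op_conv s (cfc g h1) (cfc g h2)).

Definition strongly_operator_convex (R : realType) (I : set R) (f : R -> R) :
    Prop :=
  {within I, continuous f} /\
  ((forall x, I x -> f x = 0) \/
   ((forall x, I x -> 0 < f x) /\
    operator_convex I (fun x => - (f x)^-1))).

Definition C2_on (R : realType) (A : set R) (f : R -> R) : Prop :=
  forall x, A x -> [/\ derivable f x 1, derivable f^`() x 1
                     & {for x, continuous f^`(2)}].

(* The real normed space of self-adjoint matrices. *)
Record selfadj (R : realType) (n : nat) := SelfAdj {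
  selfadj_mx :> 'M[R[i]]_n;
  _ : selfadj_mx \is hermsymmx }.

HB.instance Definition _ (R : realType) (n : nat) :=
  [isSub for @selfadj_mx R n].
HB.instance Definition _ (R : realType) (n : nat) :=
  [Choice of selfadj R n by <:].

Section SelfAdjSpace.
Context {R : realType} {n : nat}.
Local Notation C := R[i].
Local Notation S := (selfadj R n).
Implicit Types (A B : S) (c : R).

Lemma hermsymmxP (M : 'M[C]_n) : reflect (M = M ^t*) (M \is hermsymmx).
Proof. by rewrite is_hermitianmxE expr0 scale1r; apply: eqP. Qed.

Lemma selfadjP A : A = A ^t* :> 'M[C]_n.
Proof. exact/hermsymmxP/(valP A). Qed.

Fact selfadj_zero_subproof : (0 : 'M[C]_n) \is hermsymmx.
Proof. by apply/hermsymmxP; rewrite trmx0 map_mx0. Qed.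

Fact selfadj_opp_subproof A : - (A : 'M[C]_n) \is hermsymmx.
Proof. by apply/hermsymmxP; rewrite linearN map_mxN -selfadjP. Qed.

Fact selfadj_add_subproof A B : (A : 'M[C]_n) + B \is hermsymmx.
Proof. by apply/hermsymmxP; rewrite linearD map_mxD -!selfadjP. Qed.

Fact selfadj_scale_subproof c A : c%:C *: (A : 'M[C]_n) \is hermsymmx.
Proof.
apply/hermsymmxP; rewrite linearZ map_mxZ -selfadjP.
by congr (_ *: _); apply/esym/CrealP; rewrite complex_real.
Qed.

Definition selfadj_zero : S := SelfAdj selfadj_zero_subproof.
Definition selfadj_opp A : S := SelfAdj (selfadj_opp_subproof A).
Definition selfadj_add A B : S := SelfAdj (selfadj_add_subproof A B).
Definition selfadj_scale c A : S := SelfAdj (selfadj_scale_subproof c A).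

Fact selfadj_addA : associative selfadj_add.
Proof. by move=> A B D; apply: val_inj; rewrite /= addrA. Qed.
Fact selfadj_addC : commutative selfadj_add.
Proof. by move=> A B; apply: val_inj; rewrite /= addrC. Qed.
Fact selfadj_add0 : left_id selfadj_zero selfadj_add.
Proof. by move=> A; apply: val_inj; rewrite /= add0r. Qed.
Fact selfadj_addN : left_inverse selfadj_zero selfadj_opp selfadj_add.
Proof. by move=> A; apply: val_inj; rewrite /= addNr. Qed.

HB.instance Definition _ := GRing.isZmodule.Build S
  selfadj_addA selfadj_addC selfadj_add0 selfadj_addN.

Fact selfadj_scaleA a b A :
  selfadj_scale a (selfadj_scale b A) = selfadj_scale (a * b) A.
Proof. by apply: val_inj; rewrite /= scalerA rmorphM. Qed.
Fact selfadj_scale1 : left_id 1 selfadj_scale.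
Proof. by move=> A; apply: val_inj; rewrite /= scale1r. Qed.
Fact selfadj_scaleDr : right_distributive selfadj_scale +%R.
Proof. by move=> c A B; apply: val_inj; rewrite /= scalerDr. Qed.
Fact selfadj_scaleDl A : {morph selfadj_scale^~ A : a b / a + b}.
Proof. by move=> a b; apply: val_inj; rewrite /= rmorphD scalerDl. Qed.

HB.instance Definition _ := GRing.Zmodule_isLmodule.Build R S
  selfadj_scaleA selfadj_scale1 selfadj_scaleDr selfadj_scaleDl.

(* The library norm of complex matrices (largest modulus of an entry) is a
   nonnegative real element of [R[i]]; differentiability does not depend on
   the norm chosen, the dimension being finite. *)
Definition selfadj_norm A : R := complex.Re `|A : 'M[C]_n|.

Lemma selfadj_normE A : (selfadj_norm A)%:C = `|A : 'M[C]_n|.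
Proof. by rewrite /selfadj_norm RRe_real// normr_real. Qed.

Fact selfadj_normD A B :
  selfadj_norm (A + B) <= selfadj_norm A + selfadj_norm B.
Proof. by rewrite -lecR rmorphD/= !selfadj_normE ler_normD. Qed.

Fact selfadj_normZ c A : selfadj_norm (c *: A) = `|c| * selfadj_norm A.
Proof.
apply: (@complexI R); rewrite rmorphM/= !selfadj_normE.
rewrite (_ : (c *: A : S) = c%:C *: (A : 'M[C]_n) :> 'M[C]_n)// normrZ.
by rewrite normc_def/= expr0n addr0 sqrtr_sqr.
Qed.

Fact selfadj_norm0 A : selfadj_norm A = 0 -> A = 0.
Proof.
move=> A0; apply: val_inj; apply/eqP.
by rewrite -[_ == _]normr_eq0 -selfadj_normE A0.
Qed.

HB.instance Definition _ := Lmodule_isNormed.Build R S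
  selfadj_normD selfadj_normZ selfadj_norm0.

Definition mx_spectrum (A : 'M[C]_n) : set C := [set z | eigenvalue A z].

Definition mx_calc (f : R -> R) (A : 'M[C]_n) : 'M[C]_n :=
  invmx (spectralmx A) *m
  diag_mx (map_mx (fun z => (f (complex.Re z))%:C) (spectral_diag A)) *m
  spectralmx A.

Fact mx_calc_subproof f A : mx_calc f A \is hermsymmx.
Proof.
apply/hermsymmxP; rewrite /mx_calc invmx_unitary ?spectral_unitarymx//.
rewrite !trmx_mul !map_mxM map_trmx trmxK mulmxA -map_mx_comp.
rewrite tr_diag_mx map_diag_mx (map_mx_id (@conjCK _)) -map_mx_comp.
congr (_ *m diag_mx _ *m _); apply: eq_map_mx => z /=.
by apply/esym/CrealP; rewrite complex_real.
Qed.

(* Continuous functional calculus of a self-adjoint matrix by unitary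
   diagonalisation: [A = U^-1 D U] gives [f(A) = U^-1 f(D) U]. *)
Definition Fn (f : R -> R) A : S := SelfAdj (mx_calc_subproof f A).

(* Frechet derivatives: [Fn'(t) h], and [Fn''(t)(h, k)] as the derivative at
   [t] in the direction [k] of [s |-> Fn'(s) h]. *)
Definition dFn (f : R -> R) (t h : S) : S := 'd (Fn f) t h.
Definition d2Fn (f : R -> R) (t h k : S) : S := 'd (fun s => dFn f s h) t k.

End SelfAdjSpace.

Definition psdmx (R : realType) (m : nat) (A : 'M[R[i]]_m) : Prop :=
  A \is hermsymmx /\ forall v : 'cV[R[i]]_m, 0 <= (v ^t* *m A *m v) 0 0.

(* Main.v *)
(* The matrix in the statement is half the Hessian, in the direction (h, y),
   of the map (t, x) |-> <f(t) x, x>, so its positivity for all t and h is the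
   joint convexity of that map.  When f > 0, minimizing
   s <f(t1) x1, x1> + (1 - s) <f(t2) x2, x2> under a fixed s x1 + (1 - s) x2
   shows that joint convexity is the concavity of 1/f on self-adjoint matrices,
   and evaluating joint convexity on 1 x 1 matrices shows that f has no zero
   unless it vanishes identically.  Operators on a Hilbert space reduce to
   matrices: compress them to the span of finitely many h^j u, on which
   polynomials in h act through the compression.

   No Daleckii-Krein formula is needed for a general f.  If p is the polynomial
   agreeing with f to second order at the eigenvalues of t, then f - p is
   o(|s - t|^2) on the spectrum of s, and so the derivatives of f(.) at t are
   those of p(.). *)
Require Import Defs.
From HB Require Import structures.
From mathcomp Require Import all_boot all_order all_algebra.
From mathcomp Require Import sesquilinear spectral complex.
From mathcomp Require Import all_classical all_reals all_analysis.
From mathcomp Require Import ring lra.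

Import Order.TTheory GRing.Theory Num.Theory.
Import numFieldNormedType.Exports.

Local Open Scope complex_scope.
Local Open Scope sesquilinear_scope.
Local Open Scope ring_scope.
Local Open Scope classical_set_scope.

Set Implicit Arguments.
Unset Strict Implicit.
Unset Printing Implicit Defensive.

(** * Polynomial substitution, moduli and entry norms *)

(** Two obstacles shape the work. On matrices [f] is only C^2, so the expansion of [f(.)] at each
    point has a remainder of Peano type, with no uniformity along a segment. Convexity on a segment
    is therefore derived from symmetric second differences, for which pointwise expansions suffice.
    Moreover the second derivative differentiates [Fn'(s)], which is computed from the interpolant
    at [s] and not from the one at [t]; divided differences serve to compare the two interpolants.

    For operators, [cfc] is tested on the spectrum only, whereas a compression controls no more than
    the numerical range. The two meet because the extreme values of the form are spectral values:
    one segment [[a, b]] inside [I] then carries the spectrum, the eigenvalues of the compressions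
    and the polynomial approximations.

    The Hessian condition speaks of spectra in the interior of [I]. Endpoints are recovered by
    contracting towards an interior point and passing to the limit; the contraction is affine, hence
    compatible with convex combinations. *)

Section PolyEval.
Context {R : realType}.
Local Notation C := R[i].

(* [pev e p] substitutes [e i] for the monomial ['X^i] in [p]; both [op_poly]
   and the matrix polynomials and their derivatives are of this form. *)
Definition pev (V : lmodType C) (e : nat -> V) (p : {poly R}) : V :=
  \sum_(i < size p) (p`_i)%:C *: e i.

Section Pev.
Variable V : lmodType C.
Implicit Types (e : nat -> V) (p q : {poly R}).

Lemma pev_widen e p N : (size p <= N)%N ->
  pev e p = \sum_(i < N) (p`_i)%:C *: e i.
Proof.
move=> leN; rewrite /pev (big_ord_widen N (fun i => (p`_i)%:C *: e i) leN).
rewrite big_mkcond; apply: eq_bigr => i _.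
by case: ltnP => // /(nth_default 0) ->; rewrite rmorph0 scale0r.
Qed.

Lemma pevD e p q : pev e (p + q) = pev e p + pev e q.
Proof.
pose N := maxn (size p) (size q).
rewrite (@pev_widen _ (p + q) N) ?size_polyD// (@pev_widen _ p N) ?leq_maxl//.
rewrite (@pev_widen _ q N) ?leq_maxr// -big_split.
by apply: eq_bigr => i _; rewrite coefD rmorphD/= scalerDl.
Qed.

Lemma pevZ e c p : pev e (c *: p) = c%:C *: pev e p.
Proof.
rewrite (@pev_widen _ _ (size p)) ?size_scale_leq// scaler_sumr.
by apply: eq_bigr => i _; rewrite coefZ rmorphM/= scalerA.
Qed.

Lemma pevB e p q : pev e (p - q) = pev e p - pev e q.
Proof. by rewrite -[- q]scaleN1r pevD pevZ rmorphN1 scaleN1r. Qed.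

Lemma pevC e c : pev e c%:P = c%:C *: e 0%N.
Proof.
by rewrite (@pev_widen _ _ 1) ?size_polyC ?leq_b1// big_ord1 coefC.
Qed.

Lemma pevMX e p : pev e (p * 'X) = pev (e \o succn) p.
Proof.
rewrite (@pev_widen _ _ (size p).+1); last first.
  by rewrite (leq_trans (size_polyMleq _ _))// size_polyX addnC.
rewrite big_ord_recl coefMX eqxx rmorph0 scale0r add0r.
by apply: eq_bigr => i _; rewrite coefMX.
Qed.

Lemma eq_pev e e' p : (forall i, e i = e' i) -> pev e p = pev e' p.
Proof. by move=> ee'; apply: eq_bigr => i _; rewrite ee'. Qed.

End Pev.

End PolyEval.

Section ComplexAbs.
Context {R : realType}.
Local Notation C := R[i].
Implicit Types x y z : C.

(** The norm of [R[i]] takes its values in [R[i]]; estimates are carried out in [R], where the order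
    is total and [lra] applies. *)
Definition cabs z : R := complex.Re `|z|.

Lemma cabsE z : (cabs z)%:C = `|z|.
Proof. by rewrite /cabs RRe_real// normr_real. Qed.

Lemma cabs_ge0 z : 0 <= cabs z.
Proof. by rewrite -ler0c cabsE. Qed.

Lemma cabsD x y : cabs (x + y) <= cabs x + cabs y.
Proof. by rewrite -lecR rmorphD/= !cabsE ler_normD. Qed.

Lemma cabsM x y : cabs (x * y) = cabs x * cabs y.
Proof. by apply: complexI; rewrite rmorphM/= !cabsE normrM. Qed.

Lemma cabs0 : cabs 0 = 0.
Proof. by rewrite /cabs normr0. Qed.

Lemma cabs_real (a : R) : cabs a%:C = `|a|.
Proof. by rewrite /cabs normc_def/= expr0n addr0 sqrtr_sqr. Qed.

Lemma cabsJ x : cabs (Num.conj x) = cabs x.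
Proof. by rewrite /cabs norm_conjC. Qed.

Lemma cabs_eq0 x : (cabs x == 0) = (x == 0).
Proof.
apply/eqP/eqP => [x0|->]; last exact: cabs0.
by apply/eqP; rewrite -normr_eq0 -cabsE x0.
Qed.

Lemma cabs_Re x : `|complex.Re x| <= cabs x.
Proof. by rewrite -lecR cabsE normc_ge_Re. Qed.

Lemma cabs_sum (I : finType) (P : pred I) (F : I -> C) :
  cabs (\sum_(i | P i) F i) <= \sum_(i | P i) cabs (F i).
Proof.
elim/big_ind2: _ => [|x a y b xa yb|//]; first by rewrite cabs0.
by apply: le_trans (cabsD _ _) _; apply: lerD.
Qed.

Lemma cabs_sqr x : (cabs x ^+ 2)%:C = x * Num.conj x.
Proof. by rewrite rmorphXn/= cabsE normCK. Qed.

Lemma ReD x y : complex.Re (x + y) = complex.Re x + complex.Re y.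
Proof. by case: x y => [? ?] []. Qed.
Lemma ReN x : complex.Re (- x) = - complex.Re x.
Proof. by case: x. Qed.
Lemma ReZ (a : R) x : complex.Re (a%:C * x) = a * complex.Re x.
Proof. by case: x => ? ? /=; rewrite mul0r subr0. Qed.
Lemma ReJ x : complex.Re (Num.conj x) = complex.Re x.
Proof. by case: x. Qed.
Lemma Re_sum (I : finType) (P : pred I) (F : I -> C) :
  complex.Re (\sum_(i | P i) F i) = \sum_(i | P i) complex.Re (F i).
Proof. by elim/big_ind2: _ => // x a y b <- <-; rewrite ReD. Qed.

End ComplexAbs.

Section EntryNorm.
Context {R : realType}.
Local Notation C := R[i].

(** The entrywise l1 norm is submultiplicative with constant 1, which the maximum norm carried by
    [selfadj] is not. The two are compared in [selfadj_norm_nm] and [nm_selfadj_norm]. *)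
Definition nm m n (A : 'M[C]_(m, n)) : R := \sum_i \sum_j cabs (A i j).

Section Nm.
Variables m n : nat.
Implicit Types A B : 'M[C]_(m, n).

Lemma nm_ge0 A : 0 <= nm A.
Proof. by apply: sumr_ge0 => i _; apply: sumr_ge0 => j _; exact: cabs_ge0. Qed.

Lemma nmD A B : nm (A + B) <= nm A + nm B.
Proof.
rewrite /nm -big_split ler_sum// => i _; rewrite -big_split ler_sum// => j _.
by rewrite mxE cabsD.
Qed.

Lemma nmZ a A : nm (a *: A) = cabs a * nm A.
Proof.
rewrite /nm mulr_sumr; apply: eq_bigr => i _; rewrite mulr_sumr.
by apply: eq_bigr => j _; rewrite mxE cabsM.
Qed.

Lemma nm0 : nm (0 : 'M[C]_(m, n)) = 0.
Proof. by rewrite -(scale0r 0) nmZ cabs0 mul0r. Qed.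

Lemma nm_sum (I : finType) (P : pred I) (F : I -> 'M[C]_(m, n)) :
  nm (\sum_(i | P i) F i) <= \sum_(i | P i) nm (F i).
Proof.
elim/big_ind2: _ => [|x a y b xa yb|//]; first by rewrite nm0.
by apply: le_trans (nmD _ _) _; apply: lerD.
Qed.

Lemma cabs_nm A i j : cabs (A i j) <= nm A.
Proof.
rewrite /nm (bigD1 i)//= (bigD1 j)//= -addrA lerDl addr_ge0 ?sumr_ge0//.
  by move=> k _; exact: cabs_ge0.
by move=> k _; apply: sumr_ge0 => ? _; exact: cabs_ge0.
Qed.

Lemma nm_le A c : (forall i j, cabs (A i j) <= c) -> nm A <= m%:R * n%:R * c.
Proof.
move=> Ac; apply: (@le_trans _ _ (\sum_(i < m) \sum_(j < n) c)).
  by apply: ler_sum => i _; apply: ler_sum => j _; exact: Ac.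
by rewrite !sumr_const !card_ord -mulrA !mulr_natl.
Qed.

End Nm.

Lemma nm_trC m n (A : 'M[C]_(m, n)) : nm (A ^t*) = nm A.
Proof.
rewrite /nm exchange_big; apply: eq_bigr => i _; apply: eq_bigr => j _.
by rewrite !mxE cabsJ.
Qed.

Lemma nmM m n p (A : 'M[C]_(m, n)) (B : 'M[C]_(n, p)) :
  nm (A *m B) <= nm A * nm B.
Proof.
rewrite {1}/nm; apply: (@le_trans _ _
  (\sum_i \sum_k \sum_j cabs (A i j) * cabs (B j k))).
  apply: ler_sum => i _; apply: ler_sum => k _; rewrite mxE.
  by apply: le_trans (cabs_sum _ _) _; apply: ler_sum => j _; rewrite cabsM.
rewrite /nm mulr_suml; apply: ler_sum => i _.
rewrite exchange_big mulr_suml; apply: ler_sum => j _.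
rewrite -mulr_sumr ler_wpM2l ?cabs_ge0//.
rewrite (bigD1 j)//= lerDl sumr_ge0// => k _.
by apply: sumr_ge0 => ? _; exact: cabs_ge0.
Qed.

(** Rows are unit vectors, so every entry has modulus at most 1. *)
Lemma nm_unitary n (U : 'M[C]_n) : U \is unitarymx -> nm U <= n%:R * n%:R.
Proof.
move=> /unitarymxP UU; rewrite -[leRHS]mulr1; apply: nm_le => i j.
have : \sum_k cabs (U i k) ^+ 2 = 1.
  apply: complexI; rewrite rmorph_sum rmorph1/=.
  have /matrixP/(_ i i) := UU; rewrite !mxE eqxx mulr1n => <-.
  by apply: eq_bigr => k _; rewrite cabs_sqr !mxE.
rewrite (bigD1 j)//= => Uij; rewrite -(@expr_le1 _ 2)// ?cabs_ge0// -Uij.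
by rewrite lerDl sumr_ge0// => k _; rewrite sqr_ge0.
Qed.

End EntryNorm.

(** * Spectral decomposition of self-adjoint matrices *)

Section Spectral.
Context {R : realType} {n : nat}.
Local Notation C := R[i].
Local Notation S := (selfadj R n).
Implicit Types (t s h l : S) (f g : R -> R) (p q : {poly R}).

Definition ev t (i : 'I_n) : R := complex.Re (spectral_diag (t : 'M[C]_n) 0 i).
Local Notation U t := (spectralmx (t : 'M[C]_n)).

Lemma spectral_diagE t i : spectral_diag (t : 'M[C]_n) 0 i = (ev t i)%:C.
Proof.
rewrite /ev RRe_real//.
by have /mxOverP := hermitian_spectral_diag_real (valP t); apply.
Qed.

Lemma spectralmxK t : (U t) ^t* *m U t = 1%:M.
Proof. by rewrite -invmx_unitary ?spectral_unitarymx// mulVmx ?spectral_unit. Qed.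

Lemma spectralmxKV t : U t *m (U t) ^t* = 1%:M.
Proof. exact/unitarymxP/spectral_unitarymx. Qed.

(** For fixed [t] this is a morphism from real functions on the index set to matrices. Functional
    calculus and matrix polynomials are values of it, so identities between them are checked
    eigenvalue by eigenvalue. *)
Definition undiag t (d : 'I_n -> R) : 'M[C]_n :=
  (U t) ^t* *m diag_mx (\row_i (d i)%:C) *m U t.

Lemma eq_undiag t d d' : d =1 d' -> undiag t d = undiag t d'.
Proof. by move=> /funext ->. Qed.

Lemma mx_calcE f t : mx_calc f t = undiag t (fun i => f (ev t i)).
Proof.
rewrite /mx_calc /undiag (invmx_unitary (spectral_unitarymx _)).
have -> // : map_mx (fun z => (f (complex.Re z))%:C) (spectral_diag (t : 'M[C]_n))
  = \row_i (f (ev t i))%:C.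
by apply/rowP => i; rewrite !mxE.
Qed.

Lemma undiag_ev t : undiag t (ev t) = t.
Proof.
have /hermitian_normalmx/orthomx_spectralP tE := valP t.
rewrite /undiag -(invmx_unitary (spectral_unitarymx _)).
have -> : \row_i (ev t i)%:C = spectral_diag (t : 'M[C]_n).
  by apply/rowP => i; rewrite mxE spectral_diagE.
exact: esym tE.
Qed.

Lemma conj_diagM (V W : 'M[C]_n) (d d' : 'I_n -> R) : W *m V = 1%:M ->
  (V *m diag_mx (\row_i (d i)%:C) *m W) *m (V *m diag_mx (\row_i (d' i)%:C) *m W)
  = V *m diag_mx (\row_i (d i * d' i)%:C) *m W.
Proof.
move=> WV; have -> : diag_mx (\row_i (d i * d' i)%:C) =
    diag_mx (\row_i (d i)%:C) *m diag_mx (\row_i (d' i)%:C) :> 'M[C]_n.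
  by rewrite mulmx_diag; congr diag_mx; apply/rowP => i; rewrite !mxE rmorphM.
move: (diag_mx _) (diag_mx _) => A B.
by rewrite !mulmxA -[_ *m W *m V]mulmxA WV mulmx1.
Qed.

Lemma undiagM t d d' :
  undiag t d *m undiag t d' = undiag t (fun i => d i * d' i).
Proof. exact: conj_diagM (spectralmxKV t). Qed.

Lemma conj_cancel (V W A : 'M[C]_n) : W *m V = 1%:M ->
  W *m (V *m A *m W) *m V = A.
Proof.
by move=> WV; rewrite !mulmxA WV mul1mx -mulmxA WV mulmx1.
Qed.

Lemma spectral_conj t d :
  U t *m undiag t d *m (U t) ^t* = diag_mx (\row_i (d i)%:C).
Proof. exact: conj_cancel (spectralmxKV t). Qed.

Lemma spectral_conj_self t :
  U t *m t *m (U t) ^t* = diag_mx (\row_i (ev t i)%:C).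
Proof. by have := spectral_conj t (ev t); rewrite undiag_ev. Qed.

Lemma spectral_mulmx t : U t *m t = diag_mx (\row_i (ev t i)%:C) *m U t.
Proof.
rewrite -spectral_conj_self; move: (U t) (_ ^t*) (spectralmxK t) => A B BA.
by rewrite -[_ *m B *m A]mulmxA BA mulmx1.
Qed.

Lemma row_spectral t i : row i (U t) *m t = (ev t i)%:C *: row i (U t).
Proof.
rewrite -row_mul spectral_mulmx; move: (U t) => A.
by apply/rowP => j; rewrite mxE mul_diag_mx !mxE.
Qed.

Lemma undiag1 t : undiag t (fun=> 1) = 1%:M.
Proof.
rewrite /undiag (_ : diag_mx _ = 1%:M).
  by rewrite mulmx1 spectralmxK.
by apply/matrixP => i j; rewrite !mxE.
Qed.

Lemma spectral_coords_neq0 t (v : 'rV[C]_n) : v != 0 ->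
  exists i, (v *m (U t) ^t*) 0 i != 0.
Proof.
move=> v0; apply: contrapT => /forallNP w0; case/eqP: v0.
move: (U t) (_ ^t*) (spectralmxK t) w0 => A B BA w0.
rewrite -[v]mulmx1 -BA mulmxA (_ : v *m B = 0) ?mul0mx//.
by apply/rowP => i; rewrite [RHS]mxE; apply: contrapT => /eqP; exact: w0.
Qed.

Lemma row_spectral_neq0 t i : row i (U t) != 0.
Proof.
have := spectralmxKV t; move: (U t) (_ ^t*) => A B AB.
apply/eqP => Ai0; have := row_mul i A B.
rewrite Ai0 mul0mx AB => /rowP/(_ i); rewrite !mxE eqxx.
by move/eqP; rewrite oner_eq0.
Qed.

Lemma mx_spectrumP t z : mx_spectrum t z <-> exists i, z = (ev t i)%:C.
Proof.
split=> [/eigenvalueP[v vt v0]|[i ->]]; last first.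
  apply/eigenvalueP; exists (row i (U t)); first exact: row_spectral.
  exact: row_spectral_neq0.
(* In the eigenbasis, [v t = z v] reads [w i * ev t i = z * w i], and some coordinate [w i] is
   nonzero. *)
have [i wi] := spectral_coords_neq0 t v0; exists i; apply: (mulfI wi).
have : v *m (U t) ^t* *m diag_mx (\row_i (ev t i)%:C) = z *: (v *m (U t) ^t*).
  rewrite -spectral_conj_self scalemxAl -vt.
  move: (U t) (_ ^t*) (spectralmxK t) => A B BA.
  by rewrite -!mulmxA [B *m _]mulmxA BA mul1mx.
move: (v *m (U t) ^t*) => w /rowP/(_ i); rewrite mul_mx_diag !mxE => ->.
by rewrite mulrC.
Qed.

Lemma mx_spectrum_sub t (I : set R) :
  mx_spectrum t `<=` real_set I <-> forall i, I (ev t i).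
Proof.
split=> [tI i|tI z /mx_spectrumP[i ->]]; last by exists (ev t i).
have [|x Ix [<-]//] := tI (ev t i)%:C.
by apply/mx_spectrumP; exists i.
Qed.

Definition mpow (A : 'M[C]_n) k : 'M[C]_n := iter k (mulmx^~ A) 1%:M.

Definition mpol p (A : 'M[C]_n) : 'M[C]_n := pev (mpow A) p.

Lemma mpow_undiag t k : mpow t k = undiag t (fun i => ev t i ^+ k).
Proof.
elim: k => [|k IH]; first by rewrite [RHS]undiag1.
rewrite /mpow iterS -/(mpow t k) IH -[X in _ *m X]undiag_ev undiagM.
by apply: eq_undiag => i; rewrite exprSr.
Qed.

Lemma undiag_sum t (I : finType) (P : pred I) (F : I -> 'I_n -> R) :
  undiag t (fun i => \sum_(k | P k) F k i) = \sum_(k | P k) undiag t (F k).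
Proof.
rewrite /undiag -mulmx_suml -mulmx_sumr -raddf_sum.
congr (_ *m diag_mx _ *m _); apply/rowP => i; rewrite summxE mxE rmorph_sum.
by apply: eq_bigr => k _; rewrite mxE.
Qed.

Lemma undiagD t d d' :
  undiag t (fun i => d i + d' i) = undiag t d + undiag t d'.
Proof.
rewrite /undiag -mulmxDl -mulmxDr -raddfD; congr (_ *m diag_mx _ *m _).
by apply/rowP => i; rewrite !mxE rmorphD.
Qed.

Lemma undiagZ t (c : R) d : undiag t (fun i => c * d i) = c%:C *: undiag t d.
Proof.
rewrite /undiag scalemxAl scalemxAr; congr (_ *m _ *m _).
by apply/matrixP => i j; rewrite !mxE rmorphM/= mulrnAr.
Qed.

Lemma mpolE p t : mpol p t = mx_calc (horner p) t.
Proof.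
rewrite mx_calcE /mpol /pev.
rewrite (eq_bigr (fun k : 'I_(size p) =>
  undiag t (fun i => p`_k * ev t i ^+ k))); last first.
  by move=> k _; rewrite mpow_undiag undiagZ.
by rewrite -undiag_sum; apply: eq_undiag => i; rewrite -horner_coef.
Qed.

Lemma mx_calc_interp f p t : (forall i, f (ev t i) = p.[ev t i]) ->
  mx_calc f t = mpol p t.
Proof. by move=> fp; rewrite mpolE !mx_calcE; exact: eq_undiag. Qed.

Lemma eq_mx_calc f g t : (forall i, f (ev t i) = g (ev t i)) ->
  mx_calc f t = mx_calc g t.
Proof. by move=> fg; rewrite !mx_calcE; exact: eq_undiag. Qed.

Lemma mx_calcM f g t :
  mx_calc f t *m mx_calc g t = mx_calc (fun x => f x * g x) t.
Proof. by rewrite !mx_calcE undiagM. Qed.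

Lemma mx_calc1 t : mx_calc (fun=> 1) t = 1%:M.
Proof. by rewrite mx_calcE undiag1. Qed.

(** The norm [nm] is not unitarily invariant: this is the price of multiplying by two unitaries, n^2
    for each. *)
Definition spec_norm_bound : R := (n%:R * n%:R) * (n%:R * n%:R).

Lemma nm_conj_unitary (V W A : 'M[C]_n) :
  V \is unitarymx -> W \is unitarymx ->
  nm (V *m A *m W) <= spec_norm_bound * nm A.
Proof.
move=> /nm_unitary nV /nm_unitary nW; rewrite /spec_norm_bound.
apply: le_trans (nmM _ _) _; rewrite mulrAC.
by rewrite ler_pM ?nm_ge0// (le_trans (nmM _ _))// ler_wpM2r ?nm_ge0.
Qed.

Lemma spectralC_unitarymx t : (U t) ^t* \is unitarymx.
Proof. by rewrite trmxC_unitary spectral_unitarymx. Qed.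

Lemma nm_mx_calc f t c : (forall i, `|f (ev t i)| <= c) ->
  nm (mx_calc f t) <= spec_norm_bound * (n%:R * n%:R * c).
Proof.
move=> fc; rewrite mx_calcE /undiag.
apply: le_trans (nm_conj_unitary _ (spectralC_unitarymx t)
  (spectral_unitarymx _)) _.
have sb0 : 0 <= spec_norm_bound by rewrite /spec_norm_bound !mulr_ge0.
rewrite ler_wpM2l//; apply: nm_le => i j; rewrite !mxE.
case: eqP => _; first by rewrite mulr1n cabs_real.
by rewrite mulr0n cabs0 (le_trans _ (fc i)).
Qed.

(* An eigenvector of [s], expanded in the eigenbasis of [t], is moved by
   [t - ev s j] as little as by [t - s]. *)
Lemma ev_perturb t s j : exists i,
  `|ev s j - ev t i| <= spec_norm_bound * nm ((s : 'M[C]_n) - t).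
Proof.
pose D := U t *m ((s : 'M[C]_n) - t) *m (U t) ^t*.
have nD : nm D <= spec_norm_bound * nm ((s : 'M[C]_n) - t).
  exact: nm_conj_unitary (spectral_unitarymx _) (spectralC_unitarymx t).
have [w [[i wi] wD]] : exists w : 'rV[C]_n, (exists i, w 0 i != 0) /\
    forall i, (w *m D) 0 i = (ev s j - ev t i)%:C * w 0 i.
  exists (row j (U s) *m (U t) ^t*).
  split; first exact: spectral_coords_neq0 (row_spectral_neq0 s j).
  have -> : D = U t *m s *m (U t) ^t* - diag_mx (\row_i (ev t i)%:C).
    by rewrite -spectral_conj_self /D mulmxBr mulmxBl.
  move=> i; rewrite mulmxBr.
  have -> : row j (U s) *m (U t) ^t* *m (U t *m s *m (U t) ^t*) =
      (ev s j)%:C *: (row j (U s) *m (U t) ^t*).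
    rewrite [RHS]scalemxAl -row_spectral.
    move: (U t) (_ ^t*) (spectralmxK t) => A B BA.
    by rewrite -!mulmxA [B *m _]mulmxA BA mul1mx.
  move: (row j (U s) *m _) => w; rewrite mul_mx_diag !mxE rmorphB/= mulrBl.
  by rewrite [in RHS](mulrC (ev t i)%:C).
move: D nD wD => D nD wD.
apply: contrapT => /forallNP far.
have {}far k : nm D < `|ev s j - ev t k|.
  by apply: le_lt_trans nD _; rewrite ltNge; apply/negP/far.
have : \sum_k cabs ((w *m D) 0 k) <= nm w * nm D.
  by apply: le_trans (nmM w D); rewrite /nm big_ord1.
under eq_bigr do rewrite wD cabsM cabs_real.
have nw : nm w = \sum_k cabs (w 0 k) by rewrite /nm big_ord1.
apply/negP; rewrite -ltNge nw mulr_suml.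
rewrite (bigD1 i)//= [ltRHS](bigD1 i)//= mulrC ltr_leD//.
  by rewrite ltr_pM2r// lt_def cabs_eq0 wi cabs_ge0.
by apply: ler_sum => k _; rewrite mulrC ler_wpM2r ?cabs_ge0// ltW.
Qed.

End Spectral.

(** * Derivatives of matrix polynomials *)

(** Once products are distributed, the identities to prove are linear in the noncommutative products
    and hold entry by entry. *)
Ltac zmod_ring := apply/matrixP => ? ?; rewrite !mxE; field.

Section MatrixTaylor.
Context {R : realType} {n : nat}.
Local Notation C := R[i].
Local Notation M := 'M[C]_n.
Implicit Types (A H L : M) (p q : {poly R}).

(* [dpow A H k] and [d2pow A H L k] are the first two derivatives of
   [A |-> A ^ k] in the directions [H] and [(H, L)]. *)
Fixpoint dpow A H k : M :=
  if k is k'.+1 then dpow A H k' *m A + mpow A k' *m H else 0.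
Fixpoint d2pow A H L k : M :=
  if k is k'.+1 then
    d2pow A H L k' *m A + dpow A H k' *m L + dpow A L k' *m H
  else 0.

Definition dpol p A H : M := pev (dpow A H) p.
Definition d2pol p A H L : M := pev (d2pow A H L) p.

Lemma dpow_linear A k : linear (fun H => dpow A H k).
Proof.
move=> a H L; elim: k => [|k /= ->]; first by rewrite scaler0 addr0.
rewrite mulmxDl mulmxDr -scalemxAl -scalemxAr !scalerDr.
by rewrite addrACA.
Qed.

Lemma d2pow_linear A H k : linear (fun L => d2pow A H L k).
Proof.
move=> a L K; elim: k => [|k /= ->]; first by rewrite scaler0 addr0.
rewrite dpow_linear !mulmxDl mulmxDr -!scalemxAl -scalemxAr !scalerDr.
by zmod_ring.
Qed.

Lemma d2powC A H L k : d2pow A H L k = d2pow A L H k.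
Proof. by elim: k => //= k ->; rewrite addrAC. Qed.

Lemma pev_linear (F : M -> nat -> M) p : (forall k, linear (F ^~ k)) ->
  linear (fun H => pev (F H) p).
Proof.
move=> linF a H L; rewrite /pev scaler_sumr -big_split; apply: eq_bigr => k _.
by rewrite /= linF scalerDr !scalerA mulrC.
Qed.

Lemma dpol_linear p A : linear (dpol p A).
Proof. exact: pev_linear (dpow_linear A). Qed.

Lemma d2pol_linear p A H : linear (d2pol p A H).
Proof. exact: pev_linear (d2pow_linear A H). Qed.

Lemma d2polC p A H L : d2pol p A H L = d2pol p A L H.
Proof. by apply: eq_pev => k; exact: d2powC. Qed.

Lemma dpolZ p A a H : dpol p A (a *: H) = a *: dpol p A H.
Proof.
pose L := GRing.isLinear.Build _ _ _ _ _ (dpol_linear p A).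
pose F : {linear M -> M} := HB.pack (dpol p A) L.
by rewrite -[LHS]/(F _) linearZ.
Qed.

Lemma d2polZ p A a H : d2pol p A (a *: H) (a *: H) = a ^+ 2 *: d2pol p A H H.
Proof.
have Z2 K L : d2pol p A K (a *: L) = a *: d2pol p A K L.
  pose F : {linear M -> M} := HB.pack (d2pol p A K)
    (GRing.isLinear.Build _ _ _ _ _ (d2pol_linear p A K)).
  by rewrite -[LHS]/(F _) linearZ.
by rewrite Z2 d2polC Z2 scalerA -expr2.
Qed.

Lemma pevBr (e e' : nat -> M) p :
  pev e p - pev e' p = pev (fun k => e k - e' k) p.
Proof. by rewrite -sumrB; apply: eq_bigr => k _; rewrite scalerBr. Qed.

Lemma pevZr a (e : nat -> M) p : a *: pev e p = pev (fun k => a *: e k) p.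
Proof.
by rewrite scaler_sumr; apply: eq_bigr => k _; rewrite !scalerA mulrC.
Qed.

(** Lifts an estimate on monomials, uniform in a parameter [x], to all polynomials; Taylor estimates
    then need a proof for powers only, by induction on the exponent. *)
Lemma pev_bound (T : Type) (P : T -> Prop) (e : T -> nat -> M) (g : T -> R) :
  (forall k, exists2 c, 0 <= c & forall x, P x -> nm (e x k) <= c * g x) ->
  forall p, exists2 c, 0 <= c & forall x, P x -> nm (pev (e x) p) <= c * g x.
Proof.
move=> eb p.
have /choice[c cP] k : exists c, 0 <= c /\
    forall x, P x -> nm (e x k) <= c * g x.
  by have [c c0 ec] := eb k; exists c.
exists (\sum_(k < size p) `|p`_k| * c k).
  by apply: sumr_ge0 => k _; rewrite mulr_ge0//; have [] := cP k.
move=> x Px; apply: le_trans (nm_sum _ _) _; rewrite mulr_suml.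
apply: ler_sum => k _; rewrite nmZ cabs_real -mulrA ler_wpM2l//.
by have [_] := cP k; exact.
Qed.

Lemma dpow_bound A k :
  exists2 c, 0 <= c & forall H, True -> nm (dpow A H k) <= c * nm H.
Proof.
elim: k => [|k [c c0 ck]]; first by exists 0 => // H _; rewrite nm0 mul0r.
exists (c * nm A + nm (mpow A k)) => [|H _ /=].
  by rewrite addr_ge0 ?mulr_ge0 ?nm_ge0.
apply: le_trans (nmD _ _) _; rewrite mulrDl; apply: lerD (nmM _ _).
apply: le_trans (nmM _ _) _.
by rewrite mulrAC ler_wpM2r ?nm_ge0// ck.
Qed.

Lemma d2pow_bound A k : exists2 c, 0 <= c &
  forall HL, True -> nm (d2pow A HL.1 HL.2 k) <= c * (nm HL.1 * nm HL.2).
Proof.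
elim: k => [|k [c c0 ck]]; first by exists 0 => // H _; rewrite nm0 mul0r.
have [b b0 bk] := dpow_bound A k.
exists (c * nm A + b + b) => [|[H L] _ /=].
  by rewrite !addr_ge0 ?mulr_ge0 ?nm_ge0.
have nH := nm_ge0 H; have nL := nm_ge0 L; have nA := nm_ge0 A.
have h1 : nm (d2pow A H L k *m A) <= c * nm A * (nm H * nm L).
  by rewrite mulrAC (le_trans (nmM _ _))// ler_wpM2r// (ck (H, L)).
have h2 : nm (dpow A H k *m L) <= b * (nm H * nm L).
  by rewrite mulrA (le_trans (nmM _ _))// ler_wpM2r// bk.
have h3 : nm (dpow A L k *m H) <= b * (nm H * nm L).
  by rewrite [nm H * _]mulrC mulrA (le_trans (nmM _ _))// ler_wpM2r// bk.
apply: le_trans (nmD _ _) _; apply: le_trans (lerD (nmD _ _) (lexx _)) _.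
lra.
Qed.

(** Increments of norm at most 1 keep the factor [A + H] bounded by [nm A + 1] throughout the
    inductions. *)
Definition small (H : M) : Prop := nm H <= 1.

Lemma nmD_small A H : small H -> nm (A + H) <= nm A + 1.
Proof. by move=> H1; apply: le_trans (nmD _ _) _; rewrite lerD2l. Qed.

(** The remainder satisfies a recursion: that of exponent [k + 1] is that of exponent [k] times
    [A + H], plus [dpow A H k *m H], which is of second order already. The next two lemmas follow
    the same pattern. *)
Lemma mpow_taylor1 A k : exists2 c, 0 <= c & forall H, small H ->
  nm (mpow (A + H) k - mpow A k - dpow A H k) <= c * nm H ^+ 2.
Proof.
elim: k => [|k [c c0 ck]].
  by exists 0 => // H _; rewrite /mpow/= subrr subr0 nm0 mul0r.
have [b b0 bk] := dpow_bound A k.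
exists (c * (nm A + 1) + b) => [|H H1].
  by rewrite addr_ge0// mulr_ge0// addr_ge0// nm_ge0.
have -> : mpow (A + H) k.+1 - mpow A k.+1 - dpow A H k.+1 =
    (mpow (A + H) k - mpow A k - dpow A H k) *m (A + H) + dpow A H k *m H.
  rewrite /mpow !iterS -/(mpow _ k) -/(mpow _ k) /= !mulmxBl !mulmxDr.
  by zmod_ring.
apply: le_trans (nmD _ _) _; rewrite mulrDl; apply: lerD.
  rewrite (le_trans (nmM _ _))// mulrAC ler_pM ?nm_ge0//.
    exact: ck.
  exact: nmD_small.
by rewrite (le_trans (nmM _ _))// expr2 mulrA ler_wpM2r ?nm_ge0// bk.
Qed.

Lemma mpow_taylor2 A k : exists2 c, 0 <= c & forall H, small H ->
  nm (mpow (A + H) k - mpow A k - dpow A H k - 2^-1 *: d2pow A H H k)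
    <= c * nm H ^+ 3.
Proof.
elim: k => [|k [c c0 ck]].
  by exists 0 => // H _; rewrite /mpow/= scaler0 subrr !subr0 nm0 mul0r.
have [b b0 bk] := d2pow_bound A k.
exists (c * (nm A + 1) + b) => [|H H1].
  by rewrite addr_ge0// mulr_ge0// addr_ge0// nm_ge0.
have -> : mpow (A + H) k.+1 - mpow A k.+1 - dpow A H k.+1
      - 2^-1 *: d2pow A H H k.+1 =
    (mpow (A + H) k - mpow A k - dpow A H k - 2^-1 *: d2pow A H H k) *m (A + H)
      + 2^-1 *: (d2pow A H H k *m H).
  rewrite /mpow !iterS -/(mpow _ k) -/(mpow _ k) /= !mulmxBl !mulmxDr.
  rewrite !scalerDr -!scalemxAl.
  by zmod_ring.
apply: le_trans (nmD _ _) _; rewrite mulrDl; apply: lerD.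
  rewrite (le_trans (nmM _ _))// mulrAC ler_pM ?nm_ge0//.
    exact: ck.
  exact: nmD_small.
have half1 : cabs (2^-1 : C) <= 1.
  have -> : (2^-1 : C) = (2^-1 : R)%:C by rewrite fmorphV/= rmorph_nat.
  by rewrite cabs_real ger0_norm ?invr_ge0// invf_le1// ler1n.
rewrite nmZ; apply: le_trans (ler_piMl (nm_ge0 _) half1) _.
rewrite (le_trans (nmM _ _))// exprSr mulrA ler_wpM2r ?nm_ge0//.
by rewrite expr2 (bk (H, H)).
Qed.

Lemma dpow_taylor1 A H k : exists2 c, 0 <= c & forall L, small L ->
  nm (dpow (A + L) H k - dpow A H k - d2pow A H L k) <= c * nm L ^+ 2.
Proof.
elim: k => [|k [c c0 ck]].
  by exists 0 => // L _; rewrite /= !subr0 nm0 mul0r.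
have [b b0 bk] := d2pow_bound A k.
have [a a0 ak] := mpow_taylor1 A k.
exists (c * (nm A + 1) + b * nm H + a * nm H) => [|L L1].
  by rewrite !addr_ge0// mulr_ge0// ?addr_ge0// nm_ge0.
have -> : dpow (A + L) H k.+1 - dpow A H k.+1 - d2pow A H L k.+1 =
    (dpow (A + L) H k - dpow A H k - d2pow A H L k) *m (A + L)
      + d2pow A H L k *m L + (mpow (A + L) k - mpow A k - dpow A L k) *m H.
  by rewrite /= !mulmxBl !mulmxDr; zmod_ring.
apply: le_trans (nmD _ _) _; rewrite mulrDl; apply: lerD.
  apply: le_trans (nmD _ _) _; rewrite mulrDl; apply: lerD.
    rewrite (le_trans (nmM _ _))// mulrAC ler_pM ?nm_ge0//.
      exact: ck.
    exact: nmD_small.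
  rewrite (le_trans (nmM _ _))// expr2 mulrA ler_wpM2r ?nm_ge0//.
  by rewrite -mulrA (bk (H, L)).
by rewrite (le_trans (nmM _ _))// mulrAC ler_wpM2r ?nm_ge0// ak.
Qed.

Lemma mpol_taylor2 A p : exists2 c, 0 <= c & forall H, small H ->
  nm (mpol p (A + H) - mpol p A - dpol p A H - 2^-1 *: d2pol p A H H)
    <= c * nm H ^+ 3.
Proof.
have [c c0 cp] := pev_bound (mpow_taylor2 A) p; exists c => // H /cp.
by rewrite /mpol /dpol /d2pol pevZr !pevBr.
Qed.

Lemma dpol_taylor1 A H p : exists2 c, 0 <= c & forall L, small L ->
  nm (dpol p (A + L) H - dpol p A H - d2pol p A H L) <= c * nm L ^+ 2.
Proof.
have [c c0 cp] := pev_bound (dpow_taylor1 A H) p; exists c => // L /cp.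
by rewrite /dpol /d2pol !pevBr.
Qed.

Lemma dpol_bound A p :
  exists2 c, 0 <= c & forall H, nm (dpol p A H) <= c * nm H.
Proof.
have [c c0 cp] := pev_bound (dpow_bound A) p; exists c => // H.
exact: cp.
Qed.

Lemma d2pol_bound A H p :
  exists2 c, 0 <= c & forall L, nm (d2pol p A H L) <= c * nm L.
Proof.
have [c c0 cp] := pev_bound (d2pow_bound A) p.
exists (c * nm H) => [|L]; first by rewrite mulr_ge0// nm_ge0.
by rewrite -mulrA (cp (H, L)).
Qed.

End MatrixTaylor.

(** * Divided differences and the derivative in the eigenbasis *)

Section DividedDifferences.
Context {R : realType} {n : nat}.
Local Notation C := R[i].
Local Notation S := (selfadj R n).
Implicit Types (t h : S) (p q : {poly R}) (x y : R).

(** The sum of [x ^+ a * y ^+ b] over [a + b = k - 1]: the divided difference of the k-th power, in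
    a form without division that also covers [x = y]. *)
Fixpoint ddpow x y k : R :=
  if k is k'.+1 then ddpow x y k' * y + x ^+ k' else 0.

Definition dd p x y : R := \sum_(k < size p) p`_k * ddpow x y k.

Lemma ddE p x y : (x - y) * dd p x y = p.[x] - p.[y].
Proof.
rewrite !horner_coef /dd mulr_sumr -sumrB; apply: eq_bigr => k _.
rewrite mulrCA -mulrBr; congr (_ * _); elim: (k : nat) => [|j /= IH].
  by rewrite /= mulr0 !expr0 subrr.
by rewrite mulrDr mulrA IH !exprSr; ring.
Qed.

Lemma ddB p q x y : dd (p - q) x y = dd p x y - dd q x y.
Proof.
have ddE_widen N (r : {poly R}) : (size r <= N)%N ->
    dd r x y = \sum_(k < N) r`_k * ddpow x y k.
  move=> rN; rewrite /dd (big_ord_widen N (fun k => r`_k * ddpow x y k) rN).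
  rewrite big_mkcond; apply: eq_bigr => k _.
  by case: ltnP => // /(nth_default 0) ->; rewrite mul0r.
pose N := maxn (size p) (size q).
rewrite !(ddE_widen N) ?leq_maxl ?leq_maxr//; last first.
  by rewrite (leq_trans (size_polyD _ _))// size_polyN.
rewrite -sumrB; apply: eq_bigr => k _.
by rewrite coefB mulrBl.
Qed.

Lemma dd_diag p x : dd p x x = p^`().[x].
Proof.
rewrite -[in RHS](coefK p) poly_def linear_sum horner_sum /=; apply: eq_bigr => k _.
rewrite derivZ derivXn hornerZ hornerMn hornerXn; congr (_ * _).
elim: (k : nat) => [|j /= ->] //.
by rewrite mulrnAl -exprSr; case: j => [|j]; rewrite /= ?mulr0n ?add0r// -mulrSr.
Qed.

(** The Daleckii-Krein formula for polynomials. Since [t] acts diagonally on both sides, the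
    recursion of [dpow] becomes that of [ddpow] in each entry. *)
Lemma dpol_spectral p t (H : 'M[C]_n) i j :
  (spectralmx (t : 'M[C]_n) *m dpol p t H *m (spectralmx (t : 'M[C]_n)) ^t*) i j
  = (dd p (ev t i) (ev t j))%:C *
    (spectralmx (t : 'M[C]_n) *m H *m (spectralmx (t : 'M[C]_n)) ^t*) i j.
Proof.
set U := spectralmx _; set G := U *m H *m _.
have -> : U *m dpol p t H *m U ^t* = pev (fun k => U *m dpow t H k *m U ^t*) p.
  by rewrite /dpol /pev mulmx_sumr mulmx_suml; apply: eq_bigr => k _;
    rewrite -scalemxAr -scalemxAl.
rewrite /pev summxE /dd rmorph_sum mulr_suml; apply: eq_bigr => k _.
rewrite mxE rmorphM/= -mulrA; congr (_ * _).
elim: (k : nat) => [|m IH]; first by rewrite mulmx0 mul0mx mxE mul0r.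
have UtU : U *m t = diag_mx (\row_i (ev t i)%:C) *m U.
  exact: spectral_mulmx.
have tUC : t *m U ^t* = U ^t* *m diag_mx (\row_i (ev t i)%:C).
  by rewrite -[in LHS](undiag_ev t) /undiag -!mulmxA spectralmxKV mulmx1.
have powU : U *m mpow t m = diag_mx (\row_i (ev t i ^+ m)%:C) *m U.
  by rewrite mpow_undiag /undiag !mulmxA spectralmxKV mul1mx.
rewrite /= mulmxDr mulmxDl mxE !mulmxA powU -[_ *m t *m _]mulmxA tUC.
rewrite [in X in X + _]mulmxA mul_mx_diag mxE IH -2!mulmxA mul_diag_mx mxE.
rewrite !mxE rmorphD rmorphM/= [in RHS]mulrDl [in RHS]mulrAC.
congr (_ + _ * _); have /matrixP/(_ i j) := mulmxA U H (U ^t*).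
by rewrite !mxE.
Qed.

End DividedDifferences.

(** * Hermite interpolation *)

Section Hermite.
Context {R : realType}.
Implicit Types (p q : {poly R}) (f : R -> R).

(** To add a node, correct by a multiple of the cube of the polynomial vanishing at the old nodes:
    values and derivatives up to order 2 are unchanged there. The coefficients [a], [b], [c] solve
    the resulting triangular system at the new node. *)
Lemma hermite_interp (f0 f1 f2 : R -> R) (s : seq R) : uniq s ->
  exists p, forall x, x \in s ->
    [/\ p.[x] = f0 x, p^`().[x] = f1 x & p^`()^`().[x] = f2 x].
Proof.
elim: s => [|x s IH /= /andP[xs us]]; first by exists 0.
have [p ps] := IH us.
pose w := \prod_(y <- s) ('X - y%:P).
have ws y : y \in s -> w.[y] = 0.
  by move=> ys; apply/eqP; rewrite -/(root w y) root_prod_XsubC.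
have [m mx ms] : exists2 m : {poly R}, m.[x] != 0 & forall y, y \in s ->
    [/\ m.[y] = 0, m^`().[y] = 0 & m^`()^`().[y] = 0].
  exists (w * w * w) => [|y ys].
    by rewrite !hornerM !mulf_neq0// -/(root w x) root_prod_XsubC.
  by rewrite !(derivD, derivM) !(hornerD, hornerM) !ws//; split; ring.
pose a := (f0 x - p.[x]) / m.[x].
pose b := (f1 x - p^`().[x] - m^`().[x] * a) / m.[x].
pose c := (f2 x - p^`()^`().[x] - m^`()^`().[x] * a - 2 * m^`().[x] * b)
  / (2 * m.[x]).
pose l := 'X - x%:P.
exists (p + m * (a%:P + b%:P * l + c%:P * (l * l))) => y.
rewrite inE => /orP[/eqP ->|ys]; rewrite /l.
  rewrite !(derivD, derivM, derivN, derivC, derivX) !(hornerD, hornerM, hornerN, hornerC, hornerX).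
  by split; rewrite ?/c ?/b ?/a; field.
have [pE p'E p''E] := ps _ ys; have [m0 m1 m2] := ms _ ys.
rewrite !(derivD, derivM, derivN, derivC, derivX) !(hornerD, hornerM, hornerN, hornerC, hornerX) m0 m1 m2.
by rewrite -pE -p'E -p''E; split; ring.
Qed.

(** The function [f' - p'] vanishes at [x] together with its derivative, hence is [o(|y - x|)]; the
    mean value theorem between [x] and [y] turns this into [o(|y - x|^2)] for [f - p]. *)
Lemma approx2 (D : set R) f p x : open D -> D x -> C2_on D f ->
  p.[x] = f x -> p^`().[x] = derive1 f x -> p^`()^`().[x] = derive1 (derive1 f) x ->
  forall e, 0 < e -> exists2 d, 0 < d & forall y, `|y - x| < d ->
    [/\ D y, `|derive1 f y - p^`().[y]| <= e * `|y - x|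
      & `|f y - p.[y]| <= e * `|y - x| ^+ 2].
Proof.
move=> oD Dx fC2 px p'x p''x e e0.
have [_ f'x _] := fC2 _ Dx.
pose r y := derive1 f y - p^`().[y].
have r'x : is_derive x (1 : R) r 0.
  have := is_deriveB (derivableP f'x) (is_derive_poly p^`() x).
  by rewrite p''x -derive1E subrr.
have [D1 D1_gt0 Dball] : exists2 d, 0 < d & forall y, `|y - x| < d -> D y.
  have /nbhs_ballP[d /= d0 dD] := open_nbhs_nbhs (conj oD Dx).
  by exists d => // y yd; apply: dD; rewrite /ball/= distrC.
have [D2 D2_gt0 rball] : exists2 d, 0 < d &
    forall y, `|y - x| < d -> `|r y| <= e * `|y - x|.
  have [rd rv] := r'x.
  have /derivable_nbhs := rd.
  rewrite rv => /eqaddoP/(_ e e0)/nbhs_ballP[d /= d0 dP].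
  exists d => // y yd.
  have := dP (y - x); rewrite /ball/= sub0r normrN => /(_ yd).
  rewrite !fctE/= /r scaler0 [_%:A]mulr1 subrK p'x subrr.
  by rewrite !addr0 subr0.
exists (Num.min D1 D2) => [|y]; first by rewrite lt_min D1_gt0.
rewrite lt_min => /andP[y1 y2]; split; [exact: Dball|exact: rball|].
have Dseg z : `|z - x| <= `|y - x| -> D z /\ `|r z| <= e * `|y - x|.
  move=> zy; split; first by apply: Dball; apply: le_lt_trans y1.
  apply: le_trans (rball _ _) _; first by apply: le_lt_trans y2.
  by rewrite ler_wpM2l// ltW.
have fd z : D z -> is_derive z 1 (fun u => f u - p.[u]) (r z).
  move=> Dz; have [fz _ _] := fC2 _ Dz.
  rewrite /r derive1E; exact: is_deriveB (derivableP fz) (is_derive_poly p z).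
have key a b : a <= b -> (forall z, a <= z <= b -> `|z - x| <= `|y - x|) ->
    `|(f b - p.[b]) - (f a - p.[a])| <= e * `|y - x| * (b - a).
  move=> ab abP.
  have [||c] := @MVT_segment _ (fun u => f u - p.[u]) r a b ab.
  - move=> z; rewrite in_itv/= => /andP[az zb]; apply: fd.
    by have [] := Dseg z (abP z _); rewrite ?(ltW az) ?(ltW zb).
  - apply: derivable_within_continuous => z; rewrite in_itv/= => zab.
    by have [Dz _] := Dseg z (abP z zab); have [] := fd _ Dz.
  rewrite in_itv/= => cab ->; rewrite normrM (ger0_norm (_ : 0 <= b - a)) ?subr_ge0//.
  by rewrite ler_wpM2r ?subr_ge0//; have [] := Dseg c (abP c cab).
have fx0 : f x - p.[x] = 0 by rewrite px subrr.
rewrite expr2 mulrA; case: (leP x y) => xy.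
  have := key x y xy; rewrite fx0 subr0 [`|y - x|]ger0_norm ?subr_ge0//.
  apply=> z /andP[xz zy]; rewrite !ger0_norm ?subr_ge0//; lra.
have := key y x (ltW xy); rewrite fx0 sub0r normrN.
rewrite [`|y - x|]ltr0_norm ?subr_lt0// opprB; apply.
move=> z /andP[yz zx]; rewrite distrC ger0_norm ?subr_ge0//; lra.
Qed.

End Hermite.

(** * Frechet derivatives of the matrix functional calculus *)

Section DifferentialCriterion.
Context {R : realType} {V W : normedModType R}.

(** The differential is identified by its uniqueness among continuous linear maps; the bound on [L]
    supplies the continuity. *)
Lemma diff_eq (f : V -> W) x (L : V -> W) : linear L ->
  (exists2 c, 0 <= c & forall h, `|L h| <= c * `|h|) ->
  (forall e, 0 < e -> exists2 d, 0 < d &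
     forall h, `|h| < d -> `|f (x + h) - f x - L h| <= e * `|h|) ->
  'd f x = L :> (V -> W).
Proof.
move=> linL [c c0 Lc] fL.
pose LM := GRing.isLinear.Build _ _ _ _ L linL.
pose Ll : {linear V -> W} := HB.pack L LM.
apply: (@diff_unique _ _ _ f Ll x).
  move=> v; apply/cvgrPdist_le => e e0; near=> u.
  rewrite -[L v - L u](linearB Ll); apply: le_trans (Lc _) _.
  apply: (@le_trans _ _ ((c + 1) * `|v - u|)); first by rewrite ler_wpM2r// lerDl.
  rewrite mulrC -ler_pdivlMr ?ltr_wpDl//; apply: ltW; near: u.
  by apply: cvgr_dist_lt => //; rewrite divr_gt0// ltr_wpDl.
apply/eqaddoP => e e0; have [d d0 dP] := fL e e0.
apply/nbhs_normP; exists d => //= h; rewrite /= sub0r normrN => hd.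
have := dP h hd; rewrite !fctE/= [h + x]addrC; congr (_ <= _).
by congr (`| _ |); rewrite opprD addrA.
Unshelve. all: by end_near. Qed.

End DifferentialCriterion.

Section SelfAdjNorm.
Context {R : realType} {n : nat}.
Local Notation C := R[i].
Local Notation S := (selfadj R n).

Lemma selfadj_norm_nm (A : S) : `|A| <= nm (A : 'M[C]_n).
Proof.
rewrite -[leLHS]/(selfadj_norm A) -lecR selfadj_normE.
rewrite -[leLHS]/(mx_norm (A : 'M[C]_n)).
have [->|] := eqVneq (mx_norm (A : 'M[C]_n)) 0; first by rewrite ler0c nm_ge0.
move=> /mx_norm_neq0[[i j] AE].
rewrite AE -cabsE lecR.
exact: cabs_nm.
Qed.

Lemma nm_selfadj_norm (A : S) : nm (A : 'M[C]_n) <= n%:R * n%:R * `|A|.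
Proof.
apply: nm_le => i j; rewrite -lecR cabsE -[`|A|]/(selfadj_norm A) selfadj_normE.
rewrite -[leRHS]/(mx_norm (A : 'M[C]_n)) mx_normE -[leLHS]nngE num_le.
exact: (le_bigmax _ _ (i, j)).
Qed.

End SelfAdjNorm.

Section HermitianPart.
Context {R : realType} {n : nat}.
Local Notation C := R[i].
Local Notation S := (selfadj R n).
Implicit Types A B : 'M[C]_n.

Fact herm_subproof A : 2^-1 *: (A + A ^t*) \is hermsymmx.
Proof.
apply/hermsymmxP/matrixP => i j; rewrite !mxE rmorphM rmorphD.
rewrite [X in _ = _ * (_ + X)]conjCK fmorphV rmorph_nat.
by rewrite addrC.
Qed.

(** Derivatives of matrix polynomials are bare matrices, while [dFn] and [d2Fn] take values in
    [selfadj]. The Hermitian part brings them there: it is R-linear, fixes self-adjoint matrices and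
    is bounded by [nm], so estimates pass through it. *)
Definition herm A : S := SelfAdj (herm_subproof A).

Lemma half_real : (2^-1 : C) = (2^-1 : R)%:C.
Proof. by rewrite fmorphV/= rmorph_nat. Qed.

Lemma herm_id (A : S) : herm A = A.
Proof.
apply: val_inj => /=; rewrite -selfadjP; apply/matrixP => i j.
by rewrite !mxE; field.
Qed.

Lemma hermD A B : herm (A + B) = herm A + herm B.
Proof.
by apply: val_inj => /=; apply/matrixP => i j; rewrite !mxE rmorphD; ring.
Qed.

Lemma hermZ (a : R) A : herm (a%:C *: A) = a *: herm A.
Proof.
apply: val_inj => /=; apply/matrixP => i j; rewrite !mxE rmorphM/=.
have -> : Num.conj (a%:C) = a%:C by apply/CrealP; rewrite complex_real.
by ring.
Qed.

Lemma hermB A B : herm (A - B) = herm A - herm B.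
Proof. by rewrite -scaleN1r -(rmorphN1 (real_complex R)) hermD hermZ scaleN1r. Qed.

Lemma norm_herm A : `|herm A| <= nm A.
Proof.
apply: le_trans (selfadj_norm_nm _) _; rewrite nmZ half_real cabs_real.
have := nmD A (A ^t*); rewrite nm_trC ger0_norm ?invr_ge0//.
by move=> h; rewrite -ler_pdivlMl ?invr_gt0// invrK mulr_natl mulr2n.
Qed.

End HermitianPart.

Section FunctionalCalculusDerivatives.
Context {R : realType} {n : nat} (D : set R) (f : R -> R).
Hypotheses (D_open : open D) (f_C2 : C2_on D f).
Local Notation C := R[i].
Local Notation S := (selfadj R n).
Implicit Types (t s h k : S) (p q : {poly R}).
Local Notation nml := (nm \o (@selfadj_mx R n)).
Local Notation K := (@spec_norm_bound R n).

Definition hermite_at p t := forall i, [/\ p.[ev t i] = f (ev t i),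
  p^`().[ev t i] = derive1 f (ev t i) &
  p^`()^`().[ev t i] = derive1 (derive1 f) (ev t i)].

Lemma hermite_at_exists t : exists p, hermite_at p t.
Proof.
have [p pP] := hermite_interp f (derive1 f) (derive1 (derive1 f))
  (undup_uniq [seq ev t i | i <- enum 'I_n]).
by exists p => i; apply: pP; rewrite mem_undup map_f// mem_enum.
Qed.

Lemma min_radius (P : 'I_n -> R -> Prop) :
  (forall i d d', d' <= d -> P i d -> P i d') ->
  (forall i, exists2 d, 0 < d & P i d) -> exists2 d, 0 < d & forall i, P i d.
Proof.
move=> Pmono Pex.
have /choice[d dP] i : exists d, 0 < d /\ P i d by have [d ? ?] := Pex i; exists d.
exists (\big[Num.min/1]_i d i).
  by apply: lt_bigmin => // i _; have [] := dP i.
move=> i; apply: (Pmono i (d i)); last by have [] := dP i.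
exact: bigmin_le_cond.
Qed.

Lemma spec_gap t : exists2 g, 0 < g & forall i j, ev t i != ev t j ->
  g <= `|ev t i - ev t j|.
Proof.
apply: min_radius => [i d d' d'd H j /H|i]; first exact: le_trans.
apply: (@min_radius (fun j d => ev t i != ev t j -> d <= `|ev t i - ev t j|)).
  by move=> j d d' d'd H /H; exact: le_trans.
move=> j; have [_|ij] := eqVneq (ev t i) (ev t j); first by exists 1.
by exists `|ev t i - ev t j| => //; rewrite normr_gt0 subr_eq0.
Qed.

(* If two eigenvalues of [s] are near the same eigenvalue of [t], the mean
   value theorem bounds the divided difference of [f - p]; otherwise they are
   far apart and [f - p] itself is small of second order at both. *)
Lemma dd_close p t : hermite_at p t -> (forall i, D (ev t i)) ->
  forall e, 0 < e -> exists2 d, 0 < d & forall r x y i j q,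
    r < d -> `|x - ev t i| <= r -> `|y - ev t j| <= r ->
    q.[x] = f x -> q.[y] = f y -> q^`().[x] = derive1 f x ->
    `|dd q x y - dd p x y| <= e * r.
Proof.
move=> pt tD e e0.
have [g g0 gP] := spec_gap t.
have [d d0 dP] : exists2 d, 0 < d & forall i y, `|y - ev t i| < d ->
    [/\ D y, `|derive1 f y - p^`().[y]| <= e * `|y - ev t i|
      & `|f y - p.[y]| <= e * `|y - ev t i| ^+ 2].
  apply: min_radius => [i d d' d'd H y yd|i].
    by apply: H; exact: lt_le_trans d'd.
  by have [p0 p1 p2] := pt i; exact: approx2.
(* Points within [g / 4] of two distinct eigenvalues are at distance at least [g / 2], which exceeds
   [2 * r] and so absorbs the two errors [e * r ^+ 2] after division by [x - y]. *)
exists (Num.min d (g / 4)) => [|r x y i j q]; first by rewrite lt_min d0 divr_gt0.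
rewrite lt_min => /andP[rd rg] xr yr qx qy q'x.
have [Dx f'x fx] := dP i x (le_lt_trans xr rd).
have [Dy f'y fy] := dP j y (le_lt_trans yr rd).
have r0 : 0 <= r by apply: le_trans xr.
have [xy|xy] := eqVneq x y.
  rewrite -xy !dd_diag q'x; apply: le_trans f'x _.
  by rewrite ler_wpM2l// ltW.
have ddr : `|x - y| * `|dd q x y - dd p x y| =
    `|(f x - p.[x]) - (f y - p.[y])|.
  by rewrite -normrM mulrBr !ddE qx qy; congr `| _ |; ring.
have xy0 : 0 < `|x - y| by rewrite normr_gt0 subr_eq0.
rewrite -(ler_pM2l xy0) ddr.
have [ij|ij] := eqVneq (ev t i) (ev t j); last first.
  have gij := gP _ _ ij.
  have xyg : g / 2 <= `|x - y|.
    have : `|ev t i - ev t j| <= `|x - ev t i| + `|x - y| + `|y - ev t j|.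
      have -> : ev t i - ev t j = - (x - ev t i) + (x - y) + (y - ev t j) by ring.
      apply: le_trans (ler_normD _ _) _; rewrite lerD2r.
      by apply: le_trans (ler_normD _ _) _; rewrite normrN.
    lra.
  apply: le_trans (ler_normB _ _) _.
  have h1 : `|f x - p.[x]| <= e * r ^+ 2.
    by apply: le_trans fx _; rewrite ler_wpM2l ?(ltW e0)// lerXn2r ?nnegrE.
  have h2 : `|f y - p.[y]| <= e * r ^+ 2.
    by apply: le_trans fy _; rewrite ler_wpM2l ?(ltW e0)// lerXn2r ?nnegrE.
  apply: le_trans (lerD h1 h2) _.
  have -> : e * r ^+ 2 + e * r ^+ 2 = (r *+ 2) * (e * r) by ring.
  rewrite ler_wpM2r ?mulr_ge0 ?(ltW e0)// mulr2n; lra.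
have fd z : D z -> is_derive z 1 (fun u => f u - p.[u])
    (derive1 f z - p^`().[z]).
  move=> Dz; have [fz _ _] := f_C2 Dz.
  rewrite derive1E; exact: is_deriveB (derivableP fz) (is_derive_poly p z).
have key a b : a <= b -> `|a - ev t i| <= r -> `|b - ev t i| <= r ->
    `|(f b - p.[b]) - (f a - p.[a])| <= e * r * (b - a).
  move=> ab ar br.
  have abr z : a <= z <= b -> `|z - ev t i| <= r.
    move: ar br; rewrite !ler_norml => /andP[? ?] /andP[? ?] /andP[? ?].
    by apply/andP; split; lra.
  have Dz z : a <= z <= b -> D z.
    by move=> /abr zr; have [] := dP i z (le_lt_trans zr rd).
  have [||c] := @MVT_segment _ (fun u => f u - p.[u])
      (fun z => derive1 f z - p^`().[z]) a b ab.
  - move=> z; rewrite in_itv/= => /andP[az zb]; apply: fd; apply: Dz.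
    by rewrite (ltW az) (ltW zb).
  - apply: derivable_within_continuous => z; rewrite in_itv/= => /Dz Dz1.
    by have [] := fd _ Dz1.
  rewrite in_itv/= => /abr cab ->.
  rewrite normrM (ger0_norm (_ : 0 <= b - a)) ?subr_ge0// ler_wpM2r ?subr_ge0//.
  have [_ h _] := dP i c (le_lt_trans cab rd).
  by apply: le_trans h _; rewrite ler_wpM2l// ltW.
rewrite -ij in yr; rewrite mulrC; case: (leP x y) => xley.
  have := key x y xley xr yr; rewrite distrC [`|x - y|]distrC.
  by rewrite [`|y - x|]ger0_norm ?subr_ge0.
by have := key y x (ltW xley) yr xr; rewrite [`|x - y|]gtr0_norm ?subr_gt0.
Qed.

(** By [ev_perturb] each eigenvalue of [s] is within [K * nm (s - t)] of one of [t], so scalar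
    estimates near the spectrum of [t] apply on that of [s]. The last clause is what the second
    derivative needs: the derivative at [s] is computed with an interpolant [q] taken at [s], and
    must be compared with that of [p]. *)
Lemma dpol_close p t : hermite_at p t -> (forall i, D (ev t i)) ->
  forall e, 0 < e -> exists2 d, 0 < d & forall s,
    nm ((s : 'M[C]_n) - t) < d ->
    [/\ forall i, D (ev s i),
       nm (mx_calc f s - mpol p s) <= e * nm ((s : 'M[C]_n) - t) ^+ 2 &
       forall q, hermite_at q s -> forall H,
         nm (dpol q s H - dpol p s H) <= e * nm ((s : 'M[C]_n) - t) * nm H].
Proof.
move=> pt tD e e0.
have K0 : 0 <= K by rewrite /spec_norm_bound !mulr_ge0.
(* [B] dominates the constants of both norm estimates below, so one [e'] serves for the two. *)
pose B := K * (n%:R * n%:R) * K ^+ 2 + K * K * K + 1.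
have B0 : 0 < B by rewrite ltr_wpDl// addr_ge0// !mulr_ge0// exprn_ge0.
pose e' := e / B.
have e'0 : 0 < e' by rewrite divr_gt0.
have [d1 d1_gt0 d1P] : exists2 d, 0 < d & forall i y, `|y - ev t i| < d ->
    [/\ D y, `|derive1 f y - p^`().[y]| <= e' * `|y - ev t i|
      & `|f y - p.[y]| <= e' * `|y - ev t i| ^+ 2].
  apply: min_radius => [i d d' d'd H y yd|i].
    by apply: H; exact: lt_le_trans d'd.
  by have [p0 p1 p2] := pt i; exact: approx2.
have [d2 d2_gt0 d2P] := dd_close pt tD e'0.
exists (Num.min d1 d2 / (K + 1)).
  by rewrite divr_gt0 ?lt_min ?d1_gt0// ltr_wpDl.
move=> s; set r := nm _ => sd.
have r0 : 0 <= r by exact: nm_ge0.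
have Kr : K * r < Num.min d1 d2.
  apply: le_lt_trans (_ : (K + 1) * r < _); first by rewrite ler_wpM2r// lerDl.
  by rewrite mulrC -ltr_pdivlMr// ltr_wpDl.
move: Kr; rewrite lt_min => /andP[Kr1 Kr2].
have near_t j : exists i, `|ev s j - ev t i| <= K * r by exact: ev_perturb.
have Kr0 : 0 <= K * r by rewrite mulr_ge0.
have e'B : e' * B = e by rewrite /e' divfK// gt_eqF.
split=> [j||q qs H].
- have [i ij] := near_t j.
  by have [] := d1P i (ev s j) (le_lt_trans ij Kr1).
- have -> : mx_calc f s - mpol p s = mx_calc (fun x => f x - p.[x]) s.
    rewrite mpolE !mx_calcE.
    rewrite (@eq_undiag _ _ _ (fun i => f (ev s i) - p.[ev s i])
      (fun i => f (ev s i) + (-1) * p.[ev s i])); last by move=> i; rewrite mulN1r.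
    rewrite (undiagD s) undiagZ rmorphN1 scaleN1r//.
  apply: le_trans (@nm_mx_calc _ _ _ _ (e' * (K * r) ^+ 2) _) _.
    move=> j; have [i ij] := near_t j.
    have [_ _ h] := d1P i (ev s j) (le_lt_trans ij Kr1).
    by apply: le_trans h _; rewrite ler_wpM2l ?(ltW e'0)// lerXn2r ?nnegrE.
  have -> : K * (n%:R * n%:R * (e' * (K * r) ^+ 2)) =
    e' * (K * (n%:R * n%:R) * K ^+ 2) * r ^+ 2 by ring.
  rewrite ler_wpM2r ?exprn_ge0// -e'B ler_wpM2l ?(ltW e'0)// /B -addrA lerDl.
  by rewrite addr_ge0// !mulr_ge0.
have -> : dpol q s H - dpol p s H = dpol (q - p) s H by rewrite /dpol pevB.
pose U := spectralmx (s : 'M[C]_n).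
pose X := U *m dpol (q - p) s H *m U ^t*.
have Uu : U \is unitarymx by exact: spectral_unitarymx.
have UCu : U ^t* \is unitarymx by rewrite trmxC_unitary.
have XE : dpol (q - p) s H = U ^t* *m X *m U.
  by rewrite /X !mulmxA spectralmxK mul1mx -mulmxA spectralmxK mulmx1.
rewrite XE; apply: le_trans (nm_conj_unitary _ UCu Uu) _.
have nX : nm X <= e' * (K * r) * (K * nm H).
  apply: (@le_trans _ _ (e' * (K * r) * nm (U *m H *m U ^t*))); last first.
    exact: ler_wpM2l (mulr_ge0 (ltW e'0) Kr0) _ _ (nm_conj_unitary _ Uu UCu).
  rewrite /nm mulr_sumr; apply: ler_sum => i _.
  rewrite mulr_sumr; apply: ler_sum => j _.
  rewrite /X dpol_spectral cabsM cabs_real ler_wpM2r ?cabs_ge0//.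
  have [i' i'P] := near_t i; have [j' j'P] := near_t j.
  have [qi q'i _] := qs i; have [qj _ _] := qs j.
  have -> : dd (q - p) (ev s i) (ev s j) =
      dd q (ev s i) (ev s j) - dd p (ev s i) (ev s j) by exact: ddB.
  exact: d2P Kr2 i'P j'P qi qj q'i.
apply: (@le_trans _ _ (K * (e' * (K * r) * (K * nm H)))).
  by rewrite ler_wpM2l.
have -> : K * (e' * (K * r) * (K * nm H)) = e' * (K * K * K) * r * nm H by ring.
rewrite !ler_wpM2r ?nm_ge0// -e'B ler_wpM2l ?(ltW e'0)// /B.
have : 0 <= K * (n%:R * n%:R) * K ^+ 2 by rewrite !mulr_ge0 ?exprn_ge0.
lra.
Qed.

End FunctionalCalculusDerivatives.

Lemma subr_insert2 {V : zmodType} (a b c d : V) :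
  a - c - d = (a - b) + (b - c - d).
Proof. by rewrite !addrA subrK. Qed.

Lemma subr_insert3 {V : zmodType} (a b c d e : V) :
  a - c - d - e = (a - b) + (b - c - d - e).
Proof. by rewrite !addrA subrK. Qed.

Section FrechetDerivatives.
Context {R : realType} {n : nat} (D : set R) (f : R -> R).
Hypotheses (D_open : open D) (f_C2 : C2_on D f).
Local Notation C := R[i].
Local Notation S := (selfadj R n).
Implicit Types (t s h k : S) (p q : {poly R}).

Let N : R := n%:R * n%:R.
Let N0 : 0 <= N. Proof. by rewrite mulr_ge0. Qed.

Lemma nm_lt (h : S) d : 0 < d -> `|h| < d / (N + 1) -> nm (h : 'M[C]_n) < d.
Proof.
move=> d0 hd; apply: le_lt_trans (nm_selfadj_norm h) _.
apply: le_lt_trans (_ : (N + 1) * `|h| < _); first by rewrite ler_wpM2r// lerDl.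
by rewrite mulrC -ltr_pdivlMr// ltr_wpDl.
Qed.

Lemma Fn_hermite t p : hermite_at f p t -> Fn f t = mpol p t :> 'M[C]_n.
Proof.
by move=> pt; apply: mx_calc_interp => i; have [] := pt i.
Qed.

Lemma Fn_taylor2 t p : hermite_at f p t -> (forall i, D (ev t i)) ->
  forall e, 0 < e -> exists2 d, 0 < d & forall h, `|h| < d ->
    `|Fn f (t + h) - Fn f t - herm (dpol p t h) - 2^-1 *: herm (d2pol p t h h)|
      <= e * `|h| ^+ 2.
Proof.
move=> pt tD e e0.
have N10 : 0 < N + 1 by rewrite ltr_wpDl.
pose e' := e / (2 * (N + 1) ^+ 2).
have e'0 : 0 < e' by rewrite divr_gt0// mulr_gt0// exprn_gt0.
have [d1 d1_gt0 d1P] := dpol_close D_open f_C2 pt tD e'0.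
have [c c0 cP] := mpol_taylor2 t p.
(* With [nm h] below [e' / (c + 1)], the cubic remainder of the polynomial is at most
   [e' * nm h ^+ 2]. *)
pose d2 := Num.min 1 (e' / (c + 1)).
have d2_gt0 : 0 < d2 by rewrite lt_min ltr01 divr_gt0// ltr_wpDl.
exists (Num.min d1 d2 / (N + 1)) => [|h hd].
  by rewrite divr_gt0// lt_min d1_gt0.
have := nm_lt _ hd; rewrite lt_min d1_gt0 d2_gt0 => /(_ isT).
rewrite lt_min => /andP[h1]; rewrite lt_min => /andP[h2 h3].
have th : ((t + h : S) : 'M[C]_n) - t = h by rewrite /= addrC addKr.
have th1 : nm (((t + h : S) : 'M[C]_n) - t) < d1 by rewrite th.
have [_ hr _] := d1P _ th1; rewrite th in hr.
have {cP}ht := cP h (ltW h2).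
have -> : Fn f (t + h) - Fn f t - herm (dpol p t h)
      - 2^-1 *: herm (d2pol p t h h) =
    herm ((mx_calc f (t + h) - mpol p (t + h))
      + (mpol p (t + h) - mpol p t - dpol p t h - 2^-1 *: d2pol p t h h)).
  rewrite half_real hermD !hermB hermZ.
  rewrite -(Fn_hermite pt) -[mx_calc _ _]/(Fn f (t + h) : 'M[C]_n) !herm_id.
  exact: subr_insert3.
apply: le_trans (norm_herm _) _; apply: le_trans (nmD _ _) _.
have nh0 : 0 <= nm (h : 'M[C]_n) by exact: nm_ge0.
have ht' : nm (mpol p (t + h) - mpol p t - dpol p t h - 2^-1 *: d2pol p t h h)
    <= e' * nm (h : 'M[C]_n) ^+ 2.
  apply: le_trans ht _; rewrite exprS mulrA ler_wpM2r ?exprn_ge0//.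
  apply: (@le_trans _ _ ((c + 1) * nm (h : 'M[C]_n))).
    by rewrite ler_wpM2r// lerDl.
  by rewrite mulrC -ler_pdivlMr ?ltr_wpDl// ltW.
apply: le_trans (lerD hr ht') _.
have nhN : nm (h : 'M[C]_n) ^+ 2 <= ((N + 1) * `|h|) ^+ 2.
  rewrite lerXn2r ?nnegrE// ?mulr_ge0// ?(ltW N10)//.
  by apply: le_trans (nm_selfadj_norm h) _; rewrite ler_wpM2r// lerDl.
rewrite -mulrDl -mulr2n; apply: le_trans (ler_wpM2l _ nhN) _.
  by rewrite mulrn_wge0// ltW.
rewrite exprMn mulrA ler_wpM2r ?exprn_ge0// /e' -mulr_natl le_eqVlt.
apply/orP; left; apply/eqP.
by field; rewrite gt_eqF.
Qed.

Lemma hermZ_linear (F : S -> 'M[C]_n) :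
  (forall (a : R) h k, F (a *: h + k) = a%:C *: F h + F k) ->
  linear (herm \o F : S -> S).
Proof. by move=> linF a h k /=; rewrite linF hermD hermZ. Qed.

Lemma dFnE t p : hermite_at f p t -> (forall i, D (ev t i)) ->
  forall h, dFn f t h = herm (dpol p t h).
Proof.
move=> pt tD h; rewrite /dFn.
have -> // : 'd (Fn f) t = (fun h : S => herm (dpol p t h)) :> (S -> S).
have [c c0 cP] := dpol_bound t p.
have [b b0 bP] := pev_bound (d2pow_bound t) p.
apply: diff_eq; first by apply: hermZ_linear => a k l; exact: dpol_linear.
  exists (c * N) => [|k]; first by rewrite mulr_ge0.
  apply: le_trans (norm_herm _) _; apply: le_trans (cP _) _.
  by rewrite -mulrA ler_wpM2l// nm_selfadj_norm.
(* For a first derivative any bound of order [|k| ^+ 2] will do, hence [e = 1]; [B] adds to it the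
   bound on the quadratic term. *)
move=> e e0; have [d d0 dP] := Fn_taylor2 pt tD ltr01.
pose B := 1 + b * N ^+ 2.
have B0 : 0 < B by rewrite ltr_pwDl// mulr_ge0// exprn_ge0.
exists (Num.min d (e / B)) => [|k]; first by rewrite lt_min d0 divr_gt0.
rewrite lt_min => /andP[kd ke].
have h1 := dP k kd.
have h2 : `|2^-1 *: herm (d2pol p t k k) : S| <= b * N ^+ 2 * `|k| ^+ 2.
  rewrite normrZ ger0_norm ?invr_ge0//.
  apply: (@le_trans _ _ `|herm (d2pol p t k k)|).
    by rewrite ler_piMl// invf_le1// ler1n.
  apply: le_trans (norm_herm _) _; apply: le_trans (bP (_, _) I) _ => /=.
  rewrite -mulrA ler_wpM2l// -exprMn expr2.
  by rewrite ler_pM ?nm_ge0// nm_selfadj_norm.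
rewrite -[X in `|X|](subrK (2^-1 *: herm (d2pol p t k k))).
apply: le_trans (ler_normD _ _) _; apply: le_trans (lerD h1 h2) _.
rewrite -mulrDl expr2 mulrA ler_wpM2r// mulrC -ler_pdivlMr//.
exact: ltW.
Qed.

(** At [t + l] the first derivative comes from an interpolant [q] there. Replacing [q] by [p] costs
    [o(|l|)] by [dpol_close], and what remains is Taylor's formula for [dpol p]. *)
Lemma d2FnE t p : hermite_at f p t -> (forall i, D (ev t i)) ->
  forall h k, d2Fn f t h k = herm (d2pol p t h k).
Proof.
move=> pt tD h k; rewrite /d2Fn.
have -> // : 'd (fun s => dFn f s h) t =
  (fun k : S => herm (d2pol p t h k)) :> (S -> S).
have [c c0 cP] := d2pol_bound t h p.
apply: diff_eq; first by apply: hermZ_linear => a l m; exact: d2pol_linear.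
  exists (c * N) => [|l]; first by rewrite mulr_ge0.
  apply: le_trans (norm_herm _) _; apply: le_trans (cP _) _.
  by rewrite -mulrA ler_wpM2l// nm_selfadj_norm.
move=> e e0.
have N10 : 0 < N + 1 by rewrite ltr_wpDl.
pose H := nm (h : 'M[C]_n).
have H0 : 0 <= H by exact: nm_ge0.
pose e' := e / ((H + 1) * (N + 1)).
have e'0 : 0 < e' by rewrite divr_gt0// mulr_gt0// ltr_wpDl.
have [d1 d1_gt0 d1P] := dpol_close D_open f_C2 pt tD e'0.
have [b b0 bP] := dpol_taylor1 t h p.
pose d2 := Num.min 1 (e' / (b + 1)).
have d2_gt0 : 0 < d2 by rewrite lt_min ltr01 divr_gt0// ltr_wpDl.
exists (Num.min d1 d2 / (N + 1)) => [|l ld].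
  by rewrite divr_gt0// lt_min d1_gt0.
have := nm_lt _ ld; rewrite lt_min d1_gt0 d2_gt0 => /(_ isT).
rewrite lt_min => /andP[l1]; rewrite lt_min => /andP[l2 l3].
have tl : ((t + l : S) : 'M[C]_n) - t = l by rewrite /= addrC addKr.
have tl1 : nm (((t + l : S) : 'M[C]_n) - t) < d1 by rewrite tl.
have [tlD _ hr] := d1P _ tl1; rewrite tl in hr.
have [q qtl] := hermite_at_exists f (t + l).
have {}hr := hr q qtl h.
rewrite (dFnE qtl tlD) (dFnE pt tD) -!hermB.
rewrite (_ : dpol q (t + l) h - dpol p t h - d2pol p t h l =
  (dpol q (t + l) h - dpol p (t + l) h) +
  (dpol p (t + l) h - dpol p t h - d2pol p t h l)); last first.
  exact: subr_insert2.
apply: le_trans (norm_herm _) _; apply: le_trans (nmD _ _) _.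
have ht : nm (dpol p (t + l) h - dpol p t h - d2pol p t h l) <=
    e' * nm (l : 'M[C]_n).
  apply: le_trans (bP _ (ltW l2)) _; rewrite expr2 mulrA ler_wpM2r ?nm_ge0//.
  apply: (@le_trans _ _ ((b + 1) * nm (l : 'M[C]_n))).
    by rewrite ler_wpM2r ?nm_ge0// lerDl.
  by rewrite mulrC -ler_pdivlMr ?ltr_wpDl// ltW.
apply: le_trans (lerD hr ht) _.
rewrite -/H -[e' * _ in X in _ + X]mulr1 -mulrDr.
have -> : e * `|l| = e' * ((N + 1) * `|l|) * (H + 1).
  by rewrite /e'; field; rewrite !gt_eqF// ltr_wpDl.
rewrite ler_wpM2r ?addr_ge0// ler_wpM2l ?(ltW e'0)//.
by apply: le_trans (nm_selfadj_norm l) _; rewrite ler_wpM2r// lerDl.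
Qed.

Lemma Fn_line_taylor t h : (forall i, D (ev t i)) ->
  forall e, 0 < e -> exists2 d, 0 < d & forall a : R, `|a| < d ->
    nm ((Fn f (t + a *: h) - Fn f t - a *: dFn f t h
         - (a ^+ 2) *: (2^-1 *: d2Fn f t h h) : S) : 'M[C]_n)
      <= e * a ^+ 2.
Proof.
move=> tD e e0; have [p pt] := hermite_at_exists f t.
rewrite (dFnE pt tD) (d2FnE pt tD).
have h10 : 0 < `|h| + 1 by rewrite ltr_wpDl.
pose c := (N + 1) * (`|h| + 1) ^+ 2.
have c0 : 0 < c by rewrite mulr_gt0// ?exprn_gt0// ltr_wpDl.
have ec0 : 0 < e / c by rewrite divr_gt0.
have [d d0 dP] := Fn_taylor2 pt tD ec0.
exists (d / (`|h| + 1)) => [|a ad]; first by rewrite divr_gt0.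
have ah : `|a *: h| <= `|a| * (`|h| + 1) by rewrite normrZ ler_wpM2l// lerDl.
have := dP (a *: h) (le_lt_trans ah _); rewrite -ltr_pdivlMr// => /(_ ad).
rewrite dpolZ d2polZ hermZ -rmorphXn hermZ [2^-1 *: (_ *: _)]scalerA.
rewrite [2^-1 * _]mulrC -[(_ * _) *: _]scalerA => hT.
apply: le_trans (nm_selfadj_norm _) _.
apply: le_trans (ler_wpM2l _ hT) _; first by rewrite mulr_ge0.
have a2 : `|a *: h| ^+ 2 <= a ^+ 2 * (`|h| + 1) ^+ 2.
  by rewrite -(real_normK (num_real a)) -exprMn lerXn2r ?nnegrE ?mulr_ge0 ?addr_ge0.
apply: (@le_trans _ _ ((N + 1) * (e / c * (a ^+ 2 * (`|h| + 1) ^+ 2)))).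
  rewrite ler_pM//; first by rewrite mulr_ge0 ?exprn_ge0// ltW.
    by rewrite lerDl.
  by rewrite ler_wpM2l// ltW.
rewrite le_eqVlt; apply/orP; left; apply/eqP; rewrite /c; field.
by rewrite !gt_eqF// ltr_wpDl.
Qed.

End FrechetDerivatives.

(** * Quadratic forms *)

Section QuadraticForms.
Context {R : realType} {n : nat}.
Local Notation C := R[i].
Local Notation S := (selfadj R n).
Implicit Types (M A B D F : 'M[C]_n) (x y z : 'rV[C]_n) (t : S) (a : R).

(** Only the real part is kept: for Hermitian [M] the form is real on the diagonal, its real part is
    symmetric, and all expansions below have real coefficients. *)
Definition bf M x y : R := complex.Re ((x *m M *m y ^t*) 0 0).

Lemma bfDm A B x y : bf (A + B) x y = bf A x y + bf B x y.
Proof. by rewrite /bf mulmxDr mulmxDl mxE ReD. Qed.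

Lemma bfZm a A x y : bf (a%:C *: A) x y = a * bf A x y.
Proof. by rewrite /bf -scalemxAr -scalemxAl mxE ReZ. Qed.

Lemma bfDl M x y z : bf M (x + y) z = bf M x z + bf M y z.
Proof. by rewrite /bf !mulmxDl mxE ReD. Qed.

Lemma bfZl M a x y : bf M (a%:C *: x) y = a * bf M x y.
Proof. by rewrite /bf -!scalemxAl mxE ReZ. Qed.

Lemma trC_D x y : (x + y) ^t* = x ^t* + y ^t*.
Proof. by rewrite raddfD /= map_mxD. Qed.

Lemma trC_Z a x : (a%:C *: x) ^t* = a%:C *: x ^t*.
Proof.
apply/matrixP => i j; rewrite !mxE rmorphM/=; congr (_ * _).
by apply/CrealP; rewrite complex_real.
Qed.

Lemma bfDr M x y z : bf M x (y + z) = bf M x y + bf M x z.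
Proof. by rewrite /bf trC_D mulmxDr mxE ReD. Qed.

Lemma bfZr M a x y : bf M x (a%:C *: y) = a * bf M x y.
Proof. by rewrite /bf trC_Z -scalemxAr mxE ReZ. Qed.

Lemma bfNr M x y : bf M x (- y) = - bf M x y.
Proof. by rewrite -scaleN1r -(rmorphN1 (real_complex R)) bfZr mulN1r. Qed.

Lemma bfNl M x y : bf M (- x) y = - bf M x y.
Proof. by rewrite -scaleN1r -(rmorphN1 (real_complex R)) bfZl mulN1r. Qed.

Lemma trC_mul m p q (A : 'M[C]_(m, p)) (B : 'M[C]_(p, q)) :
  (A *m B) ^t* = B ^t* *m A ^t*.
Proof. by rewrite trmx_mul map_mxM. Qed.

Lemma form_conj t x y :
  (y *m t *m x ^t*) 0 0 = Num.conj ((x *m t *m y ^t*) 0 0).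
Proof.
have -> : y *m t *m x ^t* = (x *m t *m y ^t*) ^t*.
  by rewrite !trC_mul trmxCK -selfadjP mulmxA.
by rewrite !mxE.
Qed.

Lemma bfC t x y : bf t x y = bf t y x.
Proof. by rewrite /bf form_conj ReJ. Qed.

Lemma form_real t x : (x *m t *m x ^t*) 0 0 = (bf t x x)%:C.
Proof. by rewrite /bf RRe_real//; apply/CrealP; rewrite -form_conj. Qed.

Lemma bf_line t a x y : bf t (x + a%:C *: y) (x + a%:C *: y) =
  bf t x x + 2 * a * bf t x y + a ^+ 2 * bf t y y.
Proof. by rewrite bfDl !bfDr !bfZl !bfZr (bfC t y x); ring. Qed.

Lemma bf_comb a b A B D F x y :
  bf (A + a%:C *: B + b%:C *: D + F) x y =
  bf A x y + a * bf B x y + b * bf D x y + bf F x y.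
Proof. by rewrite !bfDm !bfZm. Qed.

Lemma bf_mul t A x y : bf A (x *m t) y = bf (t *m A) x y.
Proof. by rewrite /bf !mulmxA. Qed.

Lemma bf_mulr t A x y : bf A x (y *m t) = bf (A *m t) x y.
Proof. by rewrite /bf trC_mul -selfadjP !mulmxA. Qed.

Lemma bf_bound M x y : `|bf M x y| <= nm M * nm x * nm y.
Proof.
rewrite /bf; apply: le_trans (cabs_Re _) _; apply: le_trans (cabs_nm _ _ _) _.
apply: le_trans (nmM _ _) _; rewrite nm_trC ler_wpM2r ?nm_ge0//.
by rewrite mulrC nmM.
Qed.

Lemma bf_diag (d : 'I_n -> R) x :
  bf (diag_mx (\row_i (d i)%:C)) x x = \sum_i d i * cabs (x 0 i) ^+ 2.
Proof.
rewrite /bf mul_mx_diag mxE Re_sum; apply: eq_bigr => i _.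
by rewrite !mxE mulrAC -cabs_sqr mulrC ReZ.
Qed.

(** The spectral measure of [t] at the vector [x], as masses on the indices of the eigenvalues. *)
Definition weight t x (i : 'I_n) : R :=
  cabs ((x *m (spectralmx (t : 'M[C]_n)) ^t*) 0 i) ^+ 2.

Lemma weight_ge0 t x i : 0 <= weight t x i.
Proof. by rewrite exprn_ge0// cabs_ge0. Qed.

Lemma bf_undiag t d x : bf (undiag t d) x x = \sum_i d i * weight t x i.
Proof.
rewrite /bf /undiag !mulmxA; set w := x *m _.
rewrite -(mulmxA _ _ (x ^t*)).
have -> : spectralmx (t : 'M[C]_n) *m x ^t* = w ^t* by rewrite trC_mul trmxCK.
exact: bf_diag.
Qed.

Lemma bf_calc f t x : bf (mx_calc f t) x x = \sum_i f (ev t i) * weight t x i.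
Proof. by rewrite mx_calcE bf_undiag. Qed.

Lemma bf1 t x : bf 1%:M x x = \sum_i weight t x i.
Proof.
by rewrite -(undiag1 t) bf_undiag; apply: eq_bigr => i _; rewrite mul1r.
Qed.

Lemma bf_self t x : bf t x x = \sum_i ev t i * weight t x i.
Proof. by rewrite -[X in bf X]undiag_ev bf_undiag. Qed.

Lemma bf_eigenvector t i : exists2 x, 0 < bf 1%:M x x &
  bf t x x = ev t i * bf 1%:M x x.
Proof.
exists (row i (spectralmx (t : 'M[C]_n))).
  have -> : bf 1%:M (row i (spectralmx (t : 'M[C]_n)))
      (row i (spectralmx (t : 'M[C]_n))) = 1; last exact: ltr01.
  have /matrixP/(_ i i) := spectralmxKV t; rewrite /bf mulmx1 mxE => h.
  rewrite mxE (eq_bigr (fun j => spectralmx (t : 'M[C]_n) i j *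
    ((spectralmx (t : 'M[C]_n)) ^t*) j i)) ?h ?mxE ?eqxx//.
  by move=> j _; rewrite !mxE.
have -> : bf t (row i (spectralmx (t : 'M[C]_n))) (row i (spectralmx (t : 'M[C]_n)))
  = bf ((ev t i)%:C *: 1%:M) (row i (spectralmx (t : 'M[C]_n)))
      (row i (spectralmx (t : 'M[C]_n))); last by rewrite bfZm.
rewrite /bf; congr (complex.Re ((_ *m _) 0 0)).
rewrite -scalemxAr mulmx1 -[X in _ *m X]undiag_ev /undiag !mulmxA -!row_mul.
rewrite spectralmxKV mul1mx.
by apply/rowP => k; rewrite mul_diag_mx !mxE.
Qed.

(** Bounds on eigenvalues become bounds on the form, which are visibly stable under convex
    combinations and under compression. *)
Lemma ev_rangeP t (a b : R) :
  (forall i, a <= ev t i <= b) <->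
  (forall x, a * bf 1%:M x x <= bf t x x <= b * bf 1%:M x x).
Proof.
split=> [abP x|abP i].
  rewrite (bf1 t) bf_self !mulr_sumr; apply/andP; split; apply: ler_sum => i _;
    by rewrite ler_wpM2r ?weight_ge0//; have /andP[] := abP i.
have [x x0 xE] := bf_eigenvector t i.
by have := abP x; rewrite xE !ler_pM2r.
Qed.

Definition conv (s : R) (t1 t2 : S) : S := s *: t1 + (1 - s) *: t2.

Definition mix (s : R) (x1 x2 : 'rV[C]_n) : 'rV[C]_n := s%:C *: x1 + (1 - s)%:C *: x2.

Lemma conv_mx s (t1 t2 : S) :
  conv s t1 t2 = s%:C *: (t1 : 'M[C]_n) + (1 - s)%:C *: (t2 : 'M[C]_n) :> 'M[C]_n.
Proof. by []. Qed.

Lemma ev_conv_range (a b : R) (t1 t2 : S) s : 0 <= s <= 1 ->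
  (forall i, a <= ev t1 i <= b) -> (forall i, a <= ev t2 i <= b) ->
  forall i, a <= ev (conv s t1 t2) i <= b.
Proof.
move=> /andP[s0 s1] /ev_rangeP h1 /ev_rangeP h2; apply/ev_rangeP => x.
rewrite conv_mx bfDm !bfZm.
move: (h1 x) (h2 x); move: (bf _ x x) (bf _ x x) (bf _ x x) => u v w.
move=> /andP[a1 b1] /andP[a2 b2]; apply/andP; split; nra.
Qed.

Lemma ev_hull (D : set R) t : (0 < n)%N -> (forall i, D (ev t i)) ->
  exists a b, [/\ D a, D b & forall i, a <= ev t i <= b].
Proof.
move=> n0 tD; pose i0 := Ordinal n0.
have [i _ iP] := @arg_minP _ _ _ i0 xpredT (ev t) isT.
have [j _ jP] := @arg_maxP _ _ _ i0 xpredT (ev t) isT.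
by exists (ev t i), (ev t j); split=> // k; apply/andP; split; [exact: iP|exact: jP].
Qed.

Lemma ev_conv (D : set R) (t1 t2 : S) s : is_interval D -> 0 <= s <= 1 ->
  (forall i, D (ev t1 i)) -> (forall i, D (ev t2 i)) ->
  forall i, D (ev (conv s t1 t2) i).
Proof.
move=> Ditv s01 h1 h2 i.
have n0 : (0 < n)%N by exact: leq_ltn_trans (ltn_ord i).
have [a1 [b1 [Da1 Db1 r1]]] := ev_hull n0 h1.
have [a2 [b2 [Da2 Db2 r2]]] := ev_hull n0 h2.
have Da : D (Num.min a1 a2) by case: leP.
have Db : D (Num.max b1 b2) by case: leP.
apply: (Ditv _ _ Da Db); apply: ev_conv_range => // j.
  by rewrite ge_min le_max; have /andP[-> ->] := r1 j.
by rewrite ge_min le_max; have /andP[-> ->] := r2 j; rewrite !orbT.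
Qed.

(** Test vectors are adjoints of block rows [(x, y)]; the two off-diagonal terms are conjugate to
    each other and add up to twice a real part. *)
Lemma psdmx_blockP (A B F : S) : psdmx (block_mx A B B F) <->
  forall x y, 0 <= bf A x x + 2 * bf B x y + bf F y y.
Proof.
have trC_block : (block_mx A B B F : 'M[C]_(n + n)) ^t* = block_mx A B B F.
  by rewrite tr_block_mx map_block_mx -!selfadjP.
have formE (x y : 'rV[C]_n) :
    (row_mx x y *m block_mx A B B F *m (row_mx x y) ^t*) 0 0 =
    (bf A x x + 2 * bf B x y + bf F y y)%:C.
  rewrite mul_row_block tr_row_mx map_col_mx mul_row_col !mulmxDl.
  rewrite mxE [X in X + _]mxE [X in _ + X]mxE.
  rewrite !form_real (form_conj B x y).
  have zE (z : C) : Num.conj z + z = (2 * complex.Re z)%:C.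
    by rewrite addrC rmorphM/= rmorph_nat; exact: addcJ.
  by rewrite [RHS]rmorphD [X in _ = X + _]rmorphD /= -zE; ring.
split=> [[_ psd] x y|h].
  have := psd ((row_mx x y) ^t*); rewrite trmxCK formE.
  by rewrite ler0c.
split=> [|v]; first exact/hermsymmxP/esym.
have := formE (lsubmx (v ^t*)) (rsubmx (v ^t*)).
by rewrite hsubmxK trmxCK => ->; rewrite ler0c.
Qed.

End QuadraticForms.

(** * Joint convexity and the Hessian *)

Section SymmetricSecondDifference.
Context {R : realType}.

(* Schwarz: subtract the chord and add [e * x * (x - 1)]; at an interior
   maximum the second symmetric difference would be nonpositive. *)
Lemma convex_of_second_difference (phi : R -> R) :
  (forall x, 0 <= x <= 1 -> {for x, continuous phi}) ->
  (forall x, 0 < x < 1 -> forall e, 0 < e -> exists2 d, 0 < d &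
     forall a, 0 < a < d ->
       - (e * a ^+ 2) <= phi (x + a) + phi (x - a) - 2 * phi x) ->
  forall s, 0 <= s <= 1 -> phi s <= (1 - s) * phi 0 + s * phi 1.
Proof.
move=> phi_cont phi2 s /andP[s0 s1]; rewrite leNgt; apply/negP => gap.
pose chord x := (1 - x) * phi 0 + x * phi 1.
pose e := phi s - chord s.
have e0 : 0 < e by rewrite subr_gt0.
(* As [s * (1 - s) <= 1 / 2], [g s] is at least [e / 2], while [g] vanishes at 0 and 1; its maximum
   is therefore interior. There the parabola adds [2 * e * a ^+ 2] to the second difference, twice
   the defect that the hypothesis allows. *)
pose g x := phi x - chord x + e * (x * (x - 1)).
pose q : {poly R} := e *: ('X * ('X - 1%:P)) - (1%:P - 'X) * (phi 0)%:P
  - 'X * (phi 1)%:P.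
have gq : g = (fun x => phi x + q.[x]).
  apply/funext => x; rewrite /g /chord /q.
  by rewrite !(hornerD, hornerN, hornerM, hornerZ, hornerC, hornerX); ring.
have g_cont : {within `[0, 1], continuous g}.
  apply: continuous_in_subspaceT => x; rewrite inE/= in_itv/= => x01.
  by rewrite gq; apply: cvgD; [exact: phi_cont|exact: continuous_horner].
have [c] := EVT_max ler01 g_cont; rewrite in_itv/= => /andP[c0 c1] cmax.
have gs : 0 < g s.
  rewrite /g -/e; have : s * (1 - s) <= 1 / 2.
    have : 0 <= (s - 1 / 2) ^+ 2 by rewrite sqr_ge0.
    rewrite expr2; nra.
  nra.
have gc : g s <= g c by apply: cmax; rewrite in_itv/= s0.
have g0 : g 0 = 0 by rewrite /g /chord; ring.
have g1 : g 1 = 0 by rewrite /g /chord; ring.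
have c0' : 0 < c.
  by rewrite lt_def c0 andbT; apply/eqP => cE; move: gc; rewrite cE g0; lra.
have c1' : c < 1.
  rewrite lt_def c1 andbT; apply/eqP => cE; move: gc; rewrite -cE g1; lra.
have [d d0 dP] := phi2 c (introT andP (conj c0' c1')) e e0.
pose m := Num.min d (Num.min c (1 - c)).
have m0 : 0 < m by rewrite !lt_min d0 c0' subr_gt0.
pose a := m / 2.
have a0 : 0 < a by rewrite divr_gt0.
have : a < m by rewrite /a; lra.
rewrite !lt_min => /and3P[ad ac ac1].
have := dP a (introT andP (conj a0 ad)).
have h1 : g (c + a) <= g c by apply: cmax; rewrite in_itv/=; lra.
have h2 : g (c - a) <= g c by apply: cmax; rewrite in_itv/=; lra.
have a2 : 0 < e * a ^+ 2 by rewrite mulr_gt0// exprn_gt0.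
have gE : g (c + a) + g (c - a) - 2 * g c =
    phi (c + a) + phi (c - a) - 2 * phi c + 2 * (e * a ^+ 2).
  by rewrite /g /chord; ring.
lra.
Qed.

(** Reads off continuity from an expansion of the kind satisfied by [phi_line], as a Lipschitz bound
    at the base point. *)
Lemma quartic_increment (p q u c1 c2 c3 c4 : R) : `|u| <= 1 ->
  `|p - (q + u * c1 + u ^+ 2 * c2 + u ^+ 3 * c3 + u ^+ 4 * c4)| <= u ^+ 2 ->
  `|q - p| <= `|u| * (1 + `|c1| + `|c2| + `|c3| + `|c4|).
Proof.
move=> u1 pq.
have uk k : `|u ^+ k.+1| <= `|u| by rewrite normrX exprS ler_piMr// exprn_ile1.
have uz k z : `|u ^+ k.+1 * z| <= `|u| * `|z| by rewrite normrM ler_wpM2r.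
rewrite distrC.
have -> : p - q = (p - (q + u * c1 + u ^+ 2 * c2 + u ^+ 3 * c3 + u ^+ 4 * c4))
    + u ^+ 1 * c1 + u ^+ 2 * c2 + u ^+ 3 * c3 + u ^+ 4 * c4 by ring.
rewrite !mulrDr mulr1.
do 4!(apply: le_trans (ler_normD _ _) _; apply: lerD; [|exact: uz]).
apply: le_trans pq _; rewrite -(real_normK (num_real u)) -normrX.
exact: uk.
Qed.

End SymmetricSecondDifference.

Section HessianForm.
Context {R : realType} {n : nat} (D : set R) (f : R -> R).
Hypotheses (D_open : open D) (f_C2 : C2_on D f).
Local Notation C := R[i].
Local Notation S := (selfadj R n).
Implicit Types (t h : S) (x y : 'rV[C]_n).

(* Half the second derivative at [(t, x)], in the direction [(h, y)], of
   [(t, x) |-> <f(t) x, x>]. *)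
Definition hess t h x y : R :=
  bf ((2^-1 *: d2Fn f t h h : S) : 'M[C]_n) x x + 2 * bf (dFn f t h) x y
    + bf (Fn f t) y y.

Definition phi_line t h x y (a : R) : R :=
  bf (Fn f (t + a *: h)) (x + a%:C *: y) (x + a%:C *: y).

(** The vector is affine in [a] and the matrix is known to order 2, so the exact part is quartic,
    with [hess] as coefficient of [a ^+ 2]; the remainder comes from the matrix alone. The
    existential coefficients precede [e], hence do not depend on it. *)
Lemma phi_line_taylor t h x y : (forall i, D (ev t i)) ->
  exists c1 c3 c4 : R, forall e, 0 < e -> exists2 d, 0 < d &
    forall a, `|a| < d ->
    `|phi_line t h x y a - (bf (Fn f t) x x + a * c1 + a ^+ 2 * hess t h x y
       + a ^+ 3 * c3 + a ^+ 4 * c4)| <= e * a ^+ 2.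
Proof.
move=> tD.
pose A2 : S := 2^-1 *: d2Fn f t h h.
exists (2 * bf (Fn f t) x y + bf (dFn f t h) x x).
exists (2 * bf A2 x y + bf (dFn f t h) y y), (bf A2 y y) => e e0.
pose c := (nm x + nm y + 1) ^+ 2.
have b0 : 0 < nm x + nm y + 1 by rewrite ltr_wpDl// addr_ge0// nm_ge0.
have c0 : 0 < c by rewrite exprn_gt0.
have ec0 : 0 < e / c by rewrite divr_gt0.
have [d d0 dP] := Fn_line_taylor D_open f_C2 h tD ec0.
exists (Num.min d 1) => [|a]; first by rewrite lt_min d0 ltr01.
rewrite lt_min => /andP[/dP + a1].
set E : S := (_ - _ : S); pose Em : 'M[C]_n := E; rewrite -/Em => nE.
have FE : Fn f (t + a *: h) = E + a ^+ 2 *: A2 + a *: dFn f t h + Fn f t.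
  by rewrite /E !subrK.
have -> : phi_line t h x y a - (bf (Fn f t) x x +
    a * (2 * bf (Fn f t) x y + bf (dFn f t h) x x) + a ^+ 2 * hess t h x y
    + a ^+ 3 * (2 * bf A2 x y + bf (dFn f t h) y y) + a ^+ 4 * bf A2 y y)
  = bf Em (x + a%:C *: y) (x + a%:C *: y).
  rewrite /phi_line FE.
  have ME : (E + a ^+ 2 *: A2 + a *: dFn f t h + Fn f t : S) =
      Em + (a ^+ 2)%:C *: (A2 : 'M[C]_n) + a%:C *: (dFn f t h : 'M[C]_n)
        + (Fn f t : 'M[C]_n) :> 'M[C]_n by [].
  rewrite ME bf_comb (bf_line (Fn f t)) (bf_line (dFn f t h)) (bf_line A2) /hess.
  rewrite -/A2; move: (bf Em _ _) (bf A2 _ _) (bf A2 _ _) (bf A2 _ _).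
  move: (bf (dFn f t h) _ _) (bf (dFn f t h) _ _) (bf (dFn f t h) _ _).
  move: (bf (Fn f t) _ _) (bf (Fn f t) _ _) (bf (Fn f t) _ _) => *; ring.
apply: le_trans (bf_bound _ _ _) _.
have nxy : nm (x + a%:C *: y) <= nm x + nm y + 1.
  apply: le_trans (nmD _ _) _; rewrite nmZ cabs_real -addrA lerD2l.
  have := nm_ge0 y; nra.
apply: (@le_trans _ _ (e / c * a ^+ 2 * (nm x + nm y + 1) ^+ 2)); last first.
  rewrite le_eqVlt; apply/orP; left; apply/eqP; rewrite /c; field.
  by rewrite gt_eqF.
by rewrite -mulrA -expr2 ler_pM ?nm_ge0 ?exprn_ge0 ?lerXn2r ?nnegrE ?nm_ge0// ltW.
Qed.

(** Odd powers cancel between [a] and [- a], and the quartic term is absorbed for small [a]. Each of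
    the two expansions has a remainder and a quartic term, whence [e / 4]. *)
Lemma phi_line_second_difference t h x y : (forall i, D (ev t i)) ->
  forall e, 0 < e -> exists2 d, 0 < d & forall a, `|a| < d ->
    `|phi_line t h x y a + phi_line t h x y (- a) - 2 * phi_line t h x y 0
      - 2 * a ^+ 2 * hess t h x y| <= e * a ^+ 2.
Proof.
move=> tD e e0; have [c1 [c3 [c4 T]]] := phi_line_taylor h x y tD.
have e4 : 0 < e / 4 by rewrite divr_gt0.
have [d d0 dP] := T _ e4.
pose d' := Num.min d (Num.min 1 (e / 4 / (`|c4| + 1))).
have c40 : 0 < `|c4| + 1 by rewrite ltr_wpDl.
exists d' => [|a]; first by rewrite !lt_min d0 ltr01 divr_gt0.
rewrite !lt_min => /and3P[ad a1 ac].
have h0 : phi_line t h x y 0 = bf (Fn f t) x x.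
  by rewrite /phi_line rmorph0 !scale0r !addr0.
have := dP a ad; have := dP (- a); rewrite normrN => /(_ ad).
have aN3 : (- a) ^+ 3 = - a ^+ 3 by ring.
have aN4 : (- a) ^+ 4 = a ^+ 4 by ring.
rewrite h0 sqrrN aN3 aN4.
move: (phi_line _ _ _ _ a) (phi_line _ _ _ _ (- a)) (bf _ x x) (hess _ _ _ _).
move=> p q b Hs.
have a20 : 0 <= a ^+ 2 by rewrite sqr_ge0.
have a4 : `|a ^+ 4 * c4| <= e / 4 * a ^+ 2.
  rewrite normrM normrX.
  have -> : `|a| ^+ 4 * `|c4| = (`|a| * `|c4|) * `|a| * a ^+ 2.
    by rewrite -(real_normK (num_real a)); ring.
  rewrite ler_wpM2r//.
  have : `|a| * `|c4| <= e / 4.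
    apply: (@le_trans _ _ (`|a| * (`|c4| + 1))); first by rewrite ler_wpM2l// lerDl.
    by rewrite -ler_pdivlMr// ltW.
  have : 0 <= `|a| * `|c4| by rewrite mulr_ge0.
  nra.
move: a4; rewrite !ler_norml => /andP[? ?] /andP[? ?] /andP[? ?].
by apply/andP; split; lra.
Qed.

Lemma phi_line_continuous t h x y a : (forall i, D (ev (t + a *: h) i)) ->
  {for a, continuous (phi_line t h x y)}.
Proof.
move=> tD; have [c1 [c3 [c4 T]]] := phi_line_taylor h (x + a%:C *: y) y tD.
have shiftE b : phi_line (t + a *: h) h (x + a%:C *: y) y b =
    phi_line t h x y (a + b).
  by rewrite /phi_line -!addrA -scalerDl -scalerDl rmorphD.
apply/cvgrPdist_le => e e0.
have [d d0 +] := T 1 ltr01; move: (hess _ _ _ _) => H dP.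
pose c := 1 + `|c1| + `|H| + `|c3| + `|c4|.
have c0 : 0 < c by rewrite /c -!addrA ltr_pwDl// !addr_ge0.
pose d' := Num.min d (Num.min 1 (e / c)).
have d'0 : 0 < d' by rewrite !lt_min d0 ltr01 divr_gt0.
near=> b.
have : `|b - a| < d' by rewrite distrC; near: b; exact: cvgr_dist_lt.
rewrite !lt_min => /and3P[bd b1 be].
have := dP _ bd; rewrite shiftE [a + (b - a)]addrC subrK.
have <- : phi_line t h x y a =
    bf (Fn f (t + a *: h)) (x + a%:C *: y) (x + a%:C *: y) by [].
rewrite mul1r => /(quartic_increment (ltW b1)) pq.
apply: le_trans pq _; rewrite -/c.
by rewrite -ler_pdivlMr// ltW.
Unshelve. all: by end_near. Qed.

Definition jointly_convex : Prop :=
  forall t1 t2 : S, (forall i, D (ev t1 i)) -> (forall i, D (ev t2 i)) ->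
  forall x1 x2 (s : R), 0 <= s <= 1 ->
    bf (Fn f (conv s t1 t2)) (mix s x1 x2) (mix s x1 x2) <=
    s * bf (Fn f t1) x1 x1 + (1 - s) * bf (Fn f t2) x2 x2.

(** On the line from [(t2, x2)] to [(t1, x1)], the expansion is rebased at every interior point,
    where a nonnegative [hess] gives the lower bound required by [convex_of_second_difference]. *)
Lemma jointly_convex_of_hess : is_interval D ->
  (forall t h x y, (forall i, D (ev t i)) -> 0 <= hess t h x y) ->
  jointly_convex.
Proof.
move=> D_itv H t1 t2 t1D t2D x1 x2 s s01.
pose h := t1 - t2; pose y := x1 - x2.
have lineE a : t2 + a *: h = conv a t1 t2.
  by rewrite /conv /h scalerBr scalerBl scale1r addrCA.
have lineD a : 0 <= a <= 1 -> forall i, D (ev (t2 + a *: h) i).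
  by move=> a01; rewrite lineE; exact: ev_conv.
have := @convex_of_second_difference _ (phi_line t2 h x2 y) _ _ s s01.
have -> : phi_line t2 h x2 y s =
    bf (Fn f (conv s t1 t2)) (mix s x1 x2) (mix s x1 x2).
  have -> : mix s x1 x2 = x2 + s%:C *: y.
    by rewrite /mix /y scalerBr rmorphB scalerBl scale1r addrCA.
  by rewrite /phi_line lineE.
have -> : phi_line t2 h x2 y 0 = bf (Fn f t2) x2 x2.
  by rewrite /phi_line rmorph0 !scale0r !addr0.
have -> : phi_line t2 h x2 y 1 = bf (Fn f t1) x1 x1.
  by rewrite /phi_line rmorph1 !scale1r /h /y !(addrC _ (_ - _)) !subrK.
rewrite addrC; apply.
  by move=> a a01; apply: phi_line_continuous; exact: lineD.
move=> a /andP[a0 a1] e e0.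
have aD := lineD a (introT andP (conj (ltW a0) (ltW a1))).
have [d d0 dP] := phi_line_second_difference h (x2 + a%:C *: y) y aD e0.
exists d => // b /andP[b0 bd].
have shiftE c : phi_line (t2 + a *: h) h (x2 + a%:C *: y) y c =
    phi_line t2 h x2 y (a + c).
  by rewrite /phi_line -!addrA -scalerDl -scalerDl rmorphD.
move: (H (t2 + a *: h) h (x2 + a%:C *: y) y aD) (dP b).
rewrite !shiftE addr0 gtr0_norm// => + /(_ bd).
move: (hess _ _ _ _) (phi_line _ _ _ _ (a + b)) (phi_line _ _ _ _ (a - b)).
move: (phi_line _ _ _ _ a) => r Hs p q Hs0.
have : 0 <= b ^+ 2 * Hs by rewrite mulr_ge0// sqr_ge0.
by move: (b ^+ 2) => b2 ?; rewrite ler_norml => /andP[? ?]; lra.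
Qed.

Lemma hess_of_jointly_convex : jointly_convex ->
  forall t h x y, (forall i, D (ev t i)) -> 0 <= hess t h x y.
Proof.
move=> jc t h x y tD; rewrite leNgt; apply/negP => Hneg.
(* With the error tolerance [- hess], the second difference is at most [a ^+ 2 * hess < 0], against
   convexity at the midpoint. The step [a] is also taken small enough to keep both spectra in
   [D]. *)
have e0 : 0 < - hess t h x y by rewrite oppr_gt0.
have [d1 d1_gt0 d1P] := phi_line_second_difference h x y tD e0.
have [p pt] := hermite_at_exists f t.
have [d2 d2_gt0 d2P] := dpol_close D_open f_C2 pt tD ltr01.
have nh0 : 0 < nm (h : 'M[C]_n) + 1 by rewrite ltr_wpDl// nm_ge0.
pose m := Num.min d1 (d2 / (nm (h : 'M[C]_n) + 1)).
have m0 : 0 < m by rewrite lt_min d1_gt0 divr_gt0.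
pose a := m / 2; have a0 : 0 < a by rewrite divr_gt0.
have : a < m by rewrite /a; lra.
rewrite lt_min => /andP[ad1]; rewrite ltr_pdivlMr// => ad2.
have lineD b : `|b| = a -> forall i, D (ev (t + b *: h) i).
  move=> ba; have [] // := d2P (t + b *: h).
  have -> : ((t + b *: h : S) : 'M[C]_n) - t = b%:C *: (h : 'M[C]_n).
    by rewrite /= addrC addKr.
  rewrite nmZ cabs_real ba; apply: le_lt_trans ad2.
  by rewrite ler_wpM2l ?lerDl// ltW.
have half01 : 0 <= (2^-1 : R) <= 1 by rewrite invr_ge0 ler0n invf_le1// ler1n.
have aa : `|a| = a by rewrite gtr0_norm.
have := jc (t + a *: h) (t + (- a) *: h) (lineD a aa) (lineD (- a) _)
  (x + a%:C *: y) (x + (- a)%:C *: y) 2^-1 half01.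
rewrite normrN => /(_ aa).
have half2 : 1 - 2^-1 = 2^-1 :> R by field.
have -> : conv 2^-1 (t + a *: h) (t + (- a) *: h) = t + 0 *: h.
  rewrite /conv half2 -scalerDr addrACA -scalerDl subrr scale0r !addr0.
  by rewrite -mulr2n -[t *+ 2]scaler_nat scalerA mulVf ?scale1r.
have -> : mix 2^-1 (x + a%:C *: y) (x + (- a)%:C *: y) = x + 0%:C *: y.
  rewrite /mix half2 -scalerDr addrACA -scalerDl -rmorphD subrr rmorph0 scale0r !addr0.
  by rewrite -mulr2n -[x *+ 2]scaler_nat scalerA -half_real mulVf ?scale1r.
rewrite half2 => mid.
have {mid} : phi_line t h x y 0 <=
    2^-1 * phi_line t h x y a + 2^-1 * phi_line t h x y (- a) by exact: mid.
move: (d1P a); rewrite aa => /(_ ad1).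
have a2 : 0 < a ^+ 2 by rewrite exprn_gt0.
have : a ^+ 2 * hess t h x y < 0 by rewrite pmulr_rlt0.
move: (hess _ _ _ _) (phi_line _ _ _ _ a) (phi_line _ _ _ _ (- a)).
move: (phi_line _ _ _ _ 0) (a ^+ 2) => r b Hs u v ?.
by rewrite ler_norml => /andP[? ?] ?; lra.
Qed.

End HessianForm.

(** * Joint convexity and concavity of the inverse *)

Section SpectralMapping.
Context {R : realType} {n : nat}.
Local Notation C := R[i].
Local Notation S := (selfadj R n).
Implicit Types (t : S) (f g : R -> R).

Lemma mpol_Fn p g t : mpol p (Fn g t) = undiag t (fun i => p.[g (ev t i)]).
Proof.
rewrite /mpol /pev (eq_bigr (fun k : 'I_(size p) =>
  undiag t (fun i => p`_k * g (ev t i) ^+ k))); last first.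
  move=> k _; rewrite undiagZ; congr (_ *: _).
  elim: (k : nat) => [|j IH]; first by rewrite [RHS]undiag1.
  rewrite /mpow iterS -/(mpow _ j) IH /= mx_calcE undiagM.
  by apply: eq_undiag => i; rewrite exprSr.
by rewrite -undiag_sum; apply: eq_undiag => i; rewrite -horner_coef.
Qed.

Lemma undiag_inj t d d' : undiag t d = undiag t d' -> d =1 d'.
Proof.
move=> dd' i; have := spectral_conj t d'.
rewrite -dd' (spectral_conj t d) => /matrixP/(_ i i).
by rewrite !mxE eqxx !mulr1n => /complexI.
Qed.

(** The diagonalisations of [t] and of [Fn g t] are chosen independently, so eigenvalues cannot be
    matched directly. Instead, the polynomial with roots [g (ev t j)] annihilates [Fn g t], hence
    vanishes at each of its eigenvalues. *)
Lemma ev_Fn g t i : exists j, ev (Fn g t) i = g (ev t j).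
Proof.
pose p := \prod_(x <- [seq g (ev t j) | j <- enum 'I_n]) ('X - x%:P).
have : mpol p (Fn g t) = 0.
  rewrite mpol_Fn (@eq_undiag _ _ _ _ (fun=> 0 * 1)) ?undiagZ ?rmorph0 ?scale0r//.
  move=> j; rewrite mul0r; apply/eqP; rewrite -/(root p _) root_prod_XsubC.
  by rewrite map_f// mem_enum.
have -> : 0 = undiag (Fn g t) (fun=> 0 * 1).
  by rewrite undiagZ rmorph0 scale0r.
rewrite mpolE mx_calcE => /undiag_inj/(_ i)/eqP.
by rewrite mul0r -/(root p _) root_prod_XsubC => /mapP[j _ ->]; exists j.
Qed.

(** A polynomial agreeing with [f] both at the eigenvalues of [Fn g t] and at the values of [g] on
    those of [t] can be evaluated in either eigenbasis. *)
Lemma mx_calc_comp f g t : mx_calc f (Fn g t) = mx_calc (f \o g) t.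
Proof.
have [p pP] := hermite_interp f f f (undup_uniq
  ([seq ev (Fn g t) i | i <- enum 'I_n] ++ [seq g (ev t i) | i <- enum 'I_n])).
rewrite (@mx_calc_interp _ _ f p) => [|i].
  rewrite mpol_Fn mx_calcE; apply: eq_undiag => i /=.
  by have [|->] := pP (g (ev t i)); rewrite // mem_undup mem_cat map_f ?orbT ?mem_enum.
by have [|->] := pP (ev (Fn g t) i); rewrite // mem_undup mem_cat map_f ?mem_enum.
Qed.

End SpectralMapping.

Section InverseConcavity.
Context {R : realType} {n : nat} (D : set R) (f : R -> R).
Local Notation C := R[i].
Local Notation S := (selfadj R n).
Implicit Types (t : S) (x : 'rV[C]_n).

Definition inverse_concave : Prop :=
  forall t1 t2 : S, (forall i, D (ev t1 i)) -> (forall i, D (ev t2 i)) ->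
  forall x (s : R), 0 <= s <= 1 ->
    s * bf (Fn (fun u => (f u)^-1) t1) x x
      + (1 - s) * bf (Fn (fun u => (f u)^-1) t2) x x
    <= bf (Fn (fun u => (f u)^-1) (conv s t1 t2)) x x.

Hypotheses (D_itv : is_interval D) (f_gt0 : forall u, D u -> 0 < f u).
Local Notation finv := (fun u => (f u)^-1).

Lemma FnM g1 g2 t :
  (Fn g1 t : 'M[C]_n) *m Fn g2 t = mx_calc (fun u => g1 u * g2 u) t.
Proof. exact: mx_calcM. Qed.

Lemma Fn_inverse t : (forall i, D (ev t i)) ->
  (Fn f t : 'M[C]_n) *m Fn finv t = 1%:M.
Proof.
move=> tD; rewrite FnM -(mx_calc1 t).
by apply: eq_mx_calc => i; rewrite mulfV// gt_eqF// f_gt0.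
Qed.

Lemma Fn_psd t x : (forall i, D (ev t i)) -> 0 <= bf (Fn f t) x x.
Proof.
move=> tD; rewrite bf_calc sumr_ge0// => i _.
by rewrite mulr_ge0 ?weight_ge0// ltW// f_gt0.
Qed.

Lemma one_selfadj : exists A : S, A = 1%:M :> 'M[C]_n.
Proof. by exists (Fn (fun=> 1) 0); exact: mx_calc1. Qed.

Lemma bf1C (x y : 'rV[C]_n) : bf 1%:M x y = bf 1%:M y x.
Proof. by have [A <-] := one_selfadj; exact: bfC. Qed.

(* Expand [0 <= <A (x - v B), x - v B>], where [B] is the inverse of [A];
   equality holds at [x = v B]. *)
Lemma inverse_variational (A B : S) (x v : 'rV[C]_n) : (A : 'M[C]_n) *m B = 1%:M ->
  (forall z, 0 <= bf A z z) -> 2 * bf 1%:M v x - bf B v v <= bf A x x.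
Proof.
move=> AB psd; move: (psd (x - v *m B)).
rewrite bfDl !bfDr !bfNl !bfNr (bfC A _ x) !(bf_mulr B) AB bf_mul mulmx1.
by rewrite (bf1C x v); move: (bf A x x) (bf _ v x) (bf _ v v) => *; lra.
Qed.

Lemma bf_inverse (A B : S) (v : 'rV[C]_n) : (A : 'M[C]_n) *m B = 1%:M ->
  bf A (v *m B) (v *m B) = bf B v v.
Proof. by move=> AB; rewrite bf_mulr AB bf_mul mulmx1. Qed.

(** Joint convexity is applied to the optimal vectors [v B1] and [v B2]. With [m] the mean of the
    [<Bi v, v>], the variational inequality at their mixture gives
    [2 m - <B v, v> <= <A x, x> <= m]. *)
Lemma inverse_concave_of_jointly_convex :
  jointly_convex D f (n := n) -> inverse_concave.
Proof.
move=> jc t1 t2 t1D t2D v s s01.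
have tD := ev_conv D_itv s01 t1D t2D.
move: (Fn_inverse t1D) (Fn_inverse t2D) (Fn_inverse tD) (fun z => Fn_psd z tD).
move: (jc t1 t2 t1D t2D (v *m Fn finv t1) (v *m Fn finv t2) s s01).
move: (Fn f t1) (Fn f t2) (Fn f (conv s t1 t2)) => A1 A2 A.
move: (Fn finv t1) (Fn finv t2) (Fn finv (conv s t1 t2)) => B1 B2 B.
move=> + AB1 AB2 AB psd; rewrite (bf_inverse _ AB1) (bf_inverse _ AB2).
have := inverse_variational (mix s (v *m B1) (v *m B2)) v AB psd.
have -> : bf 1%:M v (mix s (v *m B1) (v *m B2)) = s * bf B1 v v + (1 - s) * bf B2 v v.
  by rewrite /mix bfDr !bfZr (bf_mulr B1) (bf_mulr B2) !mul1mx.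
move: (bf A _ _) (bf B v v) (bf B1 v v) (bf B2 v v) => *; lra.
Qed.

(** The dual choice is [v = x A], for which [<B v, v> = <v, x> = <A x, x>]. The variational
    inequality is used at [x1] and at [x2] with this common [v], then averaged. *)
Lemma jointly_convex_of_inverse_concave :
  inverse_concave -> jointly_convex D f (n := n).
Proof.
move=> ic t1 t2 t1D t2D x1 x2 s s01.
have tD := ev_conv D_itv s01 t1D t2D.
set x := mix s x1 x2.
move: (Fn_inverse t1D) (Fn_inverse t2D) (Fn_inverse tD).
move: (fun z => Fn_psd z t1D) (fun z => Fn_psd z t2D).
move: (ic t1 t2 t1D t2D (x *m Fn f (conv s t1 t2)) s s01).
move: (Fn f t1) (Fn f t2) (Fn f (conv s t1 t2)) => A1 A2 A.
move: (Fn finv t1) (Fn finv t2) (Fn finv (conv s t1 t2)) => B1 B2 B.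
set v := x *m A.
move=> + psd1 psd2 AB1 AB2 AB.
have := inverse_variational x1 v AB1 psd1.
have := inverse_variational x2 v AB2 psd2.
have : s * bf 1%:M v x1 + (1 - s) * bf 1%:M v x2 = bf A x x.
  by rewrite -!bfZr -bfDr -/(mix s x1 x2) -/x /v bf_mul mulmx1.
have -> : bf B v v = bf A x x.
  by rewrite /v bf_mulr bf_mul mulmxA AB mul1mx.
clearbody v x; move/andP: s01 => [s0 s1].
move: (bf A x x) (bf B1 v v) (bf B2 v v) (bf A1 _ _) (bf A2 _ _).
move: (bf _ v x1) (bf _ v x2) => p1 p2 a b1 b2 a1 a2; nra.
Qed.

End InverseConcavity.

(** * From the interior to the whole interval *)

Section IntervalClosure.
Context {R : realType} (I : set R).
Hypothesis I_itv : is_interval I.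

(** The homothety of centre [x] and ratio [a] maps a ball around [c] contained in [I] onto a ball
    around the given point, and its values lie between points of [I]. *)
Lemma interval_contract (c x a : R) : I° c -> I x -> 0 < a <= 1 ->
  I° ((1 - a) * x + a * c).
Proof.
move=> /nbhs_ballP[d /= d0 dI] Ix /andP[a0 a1].
apply/nbhs_ballP; exists (a * d) => /=; first by rewrite mulr_gt0.
move=> y; rewrite /ball/= => yd.
have Iz : I (c + (y - ((1 - a) * x + a * c)) / a).
  apply: dI; rewrite /ball/= opprD addrA subrr sub0r normrN normrM normfV.
  by rewrite (gtr0_norm a0) ltr_pdivrMr// [d * a]mulrC distrC.
set z := c + _ in Iz.
have yE : y = (1 - a) * x + a * z by rewrite /z; field; rewrite gt_eqF.
have [xz|zx] := leP x z.
  by apply: (I_itv Ix Iz); rewrite yE; apply/andP; split; nra.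
by apply: (I_itv Iz Ix); rewrite yE; apply/andP; split; nra.
Qed.

Lemma interval_interior : is_interval I°.
Proof.
move=> x y Ix Iy z /andP[xz zy].
have [->//|xNz] := eqVneq z x.
have [->//|zNy] := eqVneq z y.
have xltz : x < z by rewrite lt_def xNz.
have zlty : z < y by rewrite lt_def eq_sym zNy.
pose a := (y - z) / (y - x).
have yx : 0 < y - x by lra.
have -> : z = (1 - a) * y + a * x by rewrite /a; field; rewrite gt_eqF.
apply: interval_contract => //; first exact: interior_subset.
apply/andP; split; first by rewrite divr_gt0// subr_gt0.
by rewrite ler_pdivrMr//; lra.
Qed.

Variables (f : R -> R) (f_cont : {within I, continuous f}).

Lemma contract_cvg (c x : R) : I° c -> I x ->
  f ((1 - a) * x + a * c) @[a --> 0^'+] --> f x.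
Proof.
move=> Ic Ix; have /(_ x Ix) fx := (subspace_continuousP I f).1 f_cont.
apply: cvg_trans fx => P.
rewrite !nbhs_simpl/= => -[e /= e0 eP].
pose d := Num.min 1 (e / (`|c - x| + 1)).
have cx0 : 0 < `|c - x| + 1 by rewrite ltr_wpDl.
have d0 : 0 < d by rewrite lt_min ltr01 divr_gt0.
near=> a.
have a0 : 0 < a by near: a; exact: nbhs_right_gt.
have : a < d by near: a; exact: nbhs_right_lt.
rewrite lt_min => /andP[a1 ae]; apply: eP; last first.
  by apply: interior_subset; apply: interval_contract => //; rewrite a0 ltW.
rewrite /ball/= (_ : x - _ = - (a * (c - x))); last by ring.
rewrite normrN normrM gtr0_norm//; rewrite ltr_pdivlMr// in ae.
by apply: le_lt_trans ae; rewrite ler_wpM2l ?lerDl// ltW.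
Unshelve. all: by end_near. Qed.

Lemma le_cvg_mix (g g1 g2 : R -> R) (l l1 l2 s : R) :
  g a @[a --> 0^'+] --> l -> g1 a @[a --> 0^'+] --> l1 ->
  g2 a @[a --> 0^'+] --> l2 ->
  (\forall a \near 0^'+, g a <= s * g1 a + (1 - s) * g2 a) ->
  l <= s * l1 + (1 - s) * l2.
Proof.
move=> gl g1l g2l; apply: ler_cvg_to gl _.
by apply: cvgD; apply: cvgM => //; exact: cvg_cst.
Qed.

Section Matrices.
Variables (n : nat) (c : R).
Hypothesis Ic : I° c.
Local Notation C := R[i].
Local Notation S := (selfadj R n).

(** Defined through the functional calculus so that [Fn f] of it is a calculus of [t] itself, with
    weights independent of [a]; being affine, it commutes with [conv]. *)
Definition contract (a : R) (t : S) : S := Fn (fun u => (1 - a) * u + a * c) t.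

Lemma contract_mx a t : contract a t =
  (1 - a)%:C *: (t : 'M[C]_n) + (a * c)%:C *: 1%:M :> 'M[C]_n.
Proof.
rewrite [LHS]mx_calcE undiagD; congr (_ + _).
  by rewrite undiagZ; congr (_ *: _); exact: undiag_ev.
by rewrite -(undiag1 t) -undiagZ; apply: eq_undiag => i; rewrite mulr1.
Qed.

Lemma contract_conv a s (t1 t2 : S) :
  conv s (contract a t1) (contract a t2) = contract a (conv s t1 t2).
Proof.
apply: val_inj; rewrite [LHS]conv_mx [RHS]contract_mx conv_mx !contract_mx.
move: (t1 : 'M[C]_n) (t2 : 'M[C]_n) (1%:M : 'M[C]_n) => A B D.
apply/matrixP => i j; rewrite !mxE !rmorphB !rmorphM rmorph1.
by move: (A i j) (B i j) (D i j) => *; ring.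
Qed.

Lemma ev_contract a (t : S) : 0 < a <= 1 -> (forall i, I (ev t i)) ->
  forall i, I° (ev (contract a t) i).
Proof.
move=> a01 tI i; have [j ->] := ev_Fn (fun u => (1 - a) * u + a * c) t i.
exact: interval_contract.
Qed.

Lemma bf_contract_cvg (t : S) (x : 'rV[C]_n) : (forall i, I (ev t i)) ->
  bf (Fn f (contract a t)) x x @[a --> 0^'+] --> bf (Fn f t) x x.
Proof.
have -> : bf (Fn f t) x x = \sum_i f (ev t i) * weight t x i by exact: bf_calc.
move=> tI.
have -> : (fun a => bf (Fn f (contract a t)) x x) =
    (fun a => \sum_i f ((1 - a) * ev t i + a * c) * weight t x i).
  by apply/funext => a; rewrite [X in bf X]mx_calc_comp bf_calc.
apply: cvg_big => [|i _]; first exact: add_continuous.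
 apply: cvgM; last exact: cvg_cst.
exact: contract_cvg.
Qed.

Lemma jointly_convex_closure :
  jointly_convex I° f (n := n) -> jointly_convex I f (n := n).
Proof.
move=> jc t1 t2 t1I t2I x1 x2 s s01.
have tI := ev_conv I_itv s01 t1I t2I.
apply: (le_cvg_mix (bf_contract_cvg (x := mix s x1 x2) tI)
  (bf_contract_cvg (x := x1) t1I) (bf_contract_cvg (x := x2) t2I)).
near=> a.
have a01 : 0 < a <= 1.
  by apply/andP; split; near: a; [exact: nbhs_right_gt|exact: nbhs_right_le].
rewrite -contract_conv; apply: jc => //; exact: ev_contract.
Unshelve. all: by end_near. Qed.

End Matrices.

Definition scalar_selfadj (a : R) : selfadj R 1 := herm (a%:C%:M).

Lemma scalar_selfadjE a : scalar_selfadj a = a%:C%:M :> 'M[R[i]]_1.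
Proof.
apply/matrixP => i j; rewrite !ord1 !mxE eqxx !mulr1n.
have -> : Num.conj (a%:C) = a%:C by apply/CrealP; rewrite complex_real.
by field.
Qed.

Lemma ev_scalar a i : ev (scalar_selfadj a) i = a.
Proof.
have h (x : 'rV_1) : bf (scalar_selfadj a) x x = a * bf 1%:M x x.
  by rewrite scalar_selfadjE -[a%:C%:M]scalemx1 bfZm.
have /ev_rangeP/(_ i) : forall x, a * bf 1%:M x x <= bf (scalar_selfadj a) x x
    <= a * bf 1%:M x x by move=> x; rewrite h lexx.
by move=> /le_anti.
Qed.

Lemma conv_scalar s a b : conv s (scalar_selfadj a) (scalar_selfadj b) =
  scalar_selfadj (s * a + (1 - s) * b).
Proof.
apply: val_inj; rewrite [LHS]conv_mx [RHS]scalar_selfadjE !scalar_selfadjE.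
by rewrite !scale_scalar_mx -raddfD -!rmorphM -rmorphD.
Qed.

Lemma bf_scalar g a (x : 'rV[R[i]]_1) :
  bf (Fn g (scalar_selfadj a)) x x = g a * bf 1%:M x x.
Proof.
rewrite bf_calc (bf1 (scalar_selfadj a)) mulr_sumr.
by apply: eq_bigr => i _; rewrite ev_scalar.
Qed.

Lemma le_subst (x x' y y' z z' s : R) : x = x' -> y = y' -> z = z' ->
  x <= s * y + (1 - s) * z -> x' <= s * y' + (1 - s) * z'.
Proof. by move=> -> -> ->. Qed.

(** Joint convexity with vectors 1 and 0: the mixed vector is [s], and its square gives the second
    factor [s]. *)
Lemma jointly_convex_scalar : jointly_convex I f (n := 1) ->
  forall a b s, I a -> I b -> 0 <= s <= 1 ->
    s * (s * f (s * a + (1 - s) * b)) <= s * f a.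
Proof.
move=> jc a b s Ia Ib s01; pose x : 'rV[R[i]]_1 := const_mx 1.
have := jc (scalar_selfadj a) (scalar_selfadj b)
  (fun i => eq_ind_r I Ia (ev_scalar a i)) (fun i => eq_ind_r I Ib (ev_scalar b i))
  x 0 s s01.
have -> := conv_scalar s a b.
move=> /(le_subst (bf_scalar f _ _) (bf_scalar f a x) (bf_scalar f b 0)).
rewrite /mix scaler0 addr0.
have -> : bf 1%:M x x = 1.
  by rewrite /bf mulmx1 mxE big_ord1 !mxE mul1r rmorph1.
rewrite bfZl bfZr (_ : bf 1%:M x x = 1); last first.
  by rewrite /bf mulmx1 mxE big_ord1 !mxE mul1r rmorph1.
have -> : bf 1%:M (0 : 'rV[R[i]]_1) 0 = 0 by rewrite /bf mul0mx mul0mx mxE.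
rewrite !mulr0 addr0 !mulr1; apply: le_trans.
by rewrite le_eqVlt; apply/orP; left; apply/eqP; ring.
Qed.

(** From [s f(s a + (1 - s) b) <= f a], taking [b = a] and [s = 1/2] gives [0 <= f a]; a zero at [a]
    then spreads to every point of the segment towards [b] except perhaps [b], which continuity
    reaches. *)
Lemma jointly_convex_dichotomy (c : R) : I° c ->
  jointly_convex I f (n := 1) ->
  (forall x, I x -> f x = 0) \/ (forall x, I x -> 0 < f x).
Proof.
move=> Ic /jointly_convex_scalar h.
have le_ab a b s : I a -> I b -> 0 < s <= 1 ->
    s * f (s * a + (1 - s) * b) <= f a.
  move=> Ia Ib /andP[s0 s1]; rewrite -(ler_pM2l s0).
  by apply: h => //; rewrite ltW.
have f_ge0 a : I a -> 0 <= f a.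
  move=> Ia; have half : 0 < (2^-1 : R) <= 1.
    by rewrite invr_gt0 ltr0n invf_le1// ler1n.
  have := le_ab a a 2^-1 Ia Ia half.
  by rewrite -mulrDl addrC subrK mul1r; lra.
have [pos|/existsNP[a /not_implyP[Ia /negP]]] :=
  pselect (forall x, I x -> 0 < f x); first by right.
rewrite -leNgt => fa; left => b Ib.
have {}fa : f a = 0 by apply/le_anti; rewrite fa f_ge0.
have in_I u v s : I u -> I v -> 0 < s <= 1 -> I (s * u + (1 - s) * v).
  move=> Iu Iv /andP[s0 s1]; have [uv|vu] := leP u v.
    by apply: (I_itv Iu Iv); apply/andP; split; nra.
  by apply: (I_itv Iv Iu); apply/andP; split; nra.
have seg u v s : I u -> f u = 0 -> I v -> 0 < s <= 1 ->
    f (s * u + (1 - s) * v) = 0.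
  move=> Iu fu Iv s01; apply/le_anti; rewrite f_ge0 ?andbT; last exact: in_I.
  have := le_ab u v s Iu Iv s01; rewrite fu pmulr_rle0//.
  by case/andP: s01.
have half : 0 < (2^-1 : R) <= 1 by rewrite invr_gt0 ltr0n invf_le1// ler1n.
(* The limit of [contract_cvg] is taken along segments from an interior point, so the zero is first
   moved from [a], possibly an endpoint of [I], to [c']. *)
pose c' := 2^-1 * a + (1 - 2^-1) * c.
have Ic' : I° c'.
  have -> : c' = (1 - 2^-1) * a + 2^-1 * c by rewrite /c'; field.
  exact: interval_contract.
have fc' : f c' = 0 by apply: seg => //; exact: interior_subset.
have := contract_cvg Ic' Ib => /cvg_unique; apply => //.
apply: (@cvg_trans _ ((fun=> 0 : R) @ 0^'+)); last exact: cvg_cst.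
apply: near_eq_cvg; near=> s; rewrite addrC; apply/esym/seg => //.
  exact: interior_subset.
by apply/andP; split; near: s; [exact: nbhs_right_gt|exact: nbhs_right_le].
Unshelve. all: by end_near. Qed.

End IntervalClosure.

(** * Operators on Hilbert spaces *)

Section HilbertBasics.
Context {R : realType} {H : completeNormedModType R[i]}.
Variable dot : {dot H for (@Num.conj R[i])}.
Hypothesis dot_norm : is_hilbert_dot dot.
Local Notation C := R[i].
Implicit Types (u v w : H) (a b c : R).

Definition re_dot u v : R := complex.Re (dot u v).
Definition nr u : R := complex.Re `|u|.

Lemma nrE u : (nr u)%:C = `|u|.
Proof. by rewrite /nr RRe_real// normr_real. Qed.

Lemma nr_ge0 u : 0 <= nr u.
Proof. by rewrite -ler0c nrE. Qed.

Lemma nr_eq0 u : (nr u == 0) = (u == 0).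
Proof.
apply/eqP/eqP => [u0|->]; last by rewrite /nr normr0.
by apply/eqP; rewrite -normr_eq0 -nrE u0.
Qed.

Lemma nrD u v : nr (u + v) <= nr u + nr v.
Proof. by rewrite -lecR rmorphD/= !nrE ler_normD. Qed.

Lemma nrZ (z : C) u : nr (z *: u) = cabs z * nr u.
Proof. by apply: complexI; rewrite rmorphM/= cabsE !nrE normrZ. Qed.

Lemma nrN u : nr (- u) = nr u.
Proof. by rewrite /nr normrN. Qed.

Lemma nrB u v : nr (u - v) <= nr u + nr v.
Proof. by rewrite -[nr v]nrN nrD. Qed.

Lemma nr0 : nr 0 = 0.
Proof. by apply/eqP; rewrite nr_eq0. Qed.

Lemma dotC u v : dot u v = Num.conj (dot v u).
Proof. by rewrite hermC expr0 mul1r. Qed.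

Lemma rdC u v : re_dot u v = re_dot v u.
Proof. by rewrite /re_dot dotC ReJ. Qed.

Lemma rdDl u v w : re_dot (u + v) w = re_dot u w + re_dot v w.
Proof. by rewrite /re_dot linearDl ReD. Qed.

Lemma rdDr u v w : re_dot w (u + v) = re_dot w u + re_dot w v.
Proof. by rewrite rdC rdDl !(rdC w). Qed.

Lemma rdZl a u v : re_dot (a%:C *: u) v = a * re_dot u v.
Proof. by rewrite /re_dot linearZl_LR ReZ. Qed.

Lemma rdZr a u v : re_dot u (a%:C *: v) = a * re_dot u v.
Proof. by rewrite rdC rdZl rdC. Qed.

Lemma rdNl u v : re_dot (- u) v = - re_dot u v.
Proof. by rewrite /re_dot linearNl ReN. Qed.

Lemma rdNr u v : re_dot u (- v) = - re_dot u v.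
Proof. by rewrite rdC rdNl rdC. Qed.

Lemma dot_nr u : dot u u = (nr u ^+ 2)%:C.
Proof. by rewrite -dot_norm rmorphXn/= nrE. Qed.

Lemma rd_nr u : re_dot u u = nr u ^+ 2.
Proof. by rewrite /re_dot dot_nr. Qed.

(** Cauchy-Schwarz, by expanding the square of [nr v * u - nr u * v]. *)
Lemma rd_le u v : re_dot u v <= nr u * nr v.
Proof.
have [/eqP|v0] := boolP (nr v == 0).
  move=> v0; have /eqP -> : v == 0 by rewrite -nr_eq0 v0.
  by rewrite -[X in re_dot _ X](scale0r 0) -(rmorph0 (real_complex R)) rdZr mul0r nr0 mulr0.
have [/eqP|u0] := boolP (nr u == 0).
  move=> u0; have /eqP -> : u == 0 by rewrite -nr_eq0 u0.
  by rewrite -[X in re_dot X _](scale0r 0) -(rmorph0 (real_complex R)) rdZl mul0r nr0 mul0r.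
have u1 : 0 < nr u by rewrite lt_def u0 nr_ge0.
have v1 : 0 < nr v by rewrite lt_def v0 nr_ge0.
have : 0 <= re_dot ((nr v)%:C *: u - (nr u)%:C *: v) ((nr v)%:C *: u - (nr u)%:C *: v).
  by rewrite rd_nr sqr_ge0.
rewrite rdDl !rdDr !rdNl !rdNr !rdZl !rdZr !rd_nr (rdC v u).
have -> : nr v * (nr v * nr u ^+ 2) + - (nr v * (nr u * re_dot u v)) +
  (- (nr u * (nr v * re_dot u v)) - - (nr u * (nr u * nr v ^+ 2))) =
  (2 * (nr u * nr v)) * (nr u * nr v - re_dot u v) by ring.
by rewrite pmulr_rge0 ?mulr_gt0// subr_ge0.
Qed.

Lemma rd_abs u v : `|re_dot u v| <= nr u * nr v.
Proof. by rewrite ler_norml lerNl -rdNl -{1}(nrN u) !rd_le. Qed.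

Lemma Im_dot u v : complex.Im (dot u v) = re_dot u ('i%C *: v).
Proof.
by rewrite /re_dot linearZr_LR /=; case: (dot u v) => x y /=; ring.
Qed.

Lemma Im_dot_abs u v : `|complex.Im (dot u v)| <= nr u * nr v.
Proof.
rewrite Im_dot; apply: le_trans (rd_abs _ _) _.
by rewrite nrZ /cabs normc_def /= expr0n /= expr1n add0r sqrtr1 mul1r.
Qed.

Lemma bounded_of_continuous (h : {linear H -> H}) : continuous h ->
  exists2 B, 0 < B & forall u, nr (h u) <= B * nr u.
Proof.
move=> hc; have := hc 0; move=> /cvgrPdist_lt/(_ 1 ltr01).
move=> /nbhs_normP[d /= d0 dP].
have dE : d = (complex.Re d)%:C by rewrite RRe_real// gtr0_real.
pose r := complex.Re d; have r0 : 0 < r by rewrite -(ltcR 0) -dE.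
exists (2 / r) => [|u]; first by rewrite divr_gt0.
have [/eqP|u0] := boolP (nr u == 0).
  move=> u0; have /eqP -> : u == 0 by rewrite -nr_eq0 u0.
  by rewrite linear0 nr0 mulr0.
have u1 : 0 < nr u by rewrite lt_def u0 nr_ge0.
pose c := r / 2 / nr u; have c0 : 0 < c by rewrite !divr_gt0.
have cu : nr (c%:C *: u) = r / 2.
  by rewrite nrZ cabs_real gtr0_norm// /c divfK.
have hb v : nr v < r -> nr (h v) <= 1.
  move=> vr; apply: ltW; rewrite -(ltcR _ 1) nrE; move: (dP v).
  rewrite /= linear0 !sub0r !normrN; apply.
  by rewrite -[X in X < _]nrE dE ltcR.
have h1 : c * nr (h u) <= 1.
  have <- : nr (h (c%:C *: u)) = c * nr (h u).
    by rewrite linearZ nrZ cabs_real gtr0_norm.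
  by apply: hb; rewrite cu; lra.
rewrite -(ler_pM2l c0); apply: le_trans h1 _.
by rewrite le_eqVlt; apply/orP; left; apply/eqP; rewrite /c; field; rewrite u0 gt_eqF.
Qed.

Lemma continuous_of_bounded (h : {linear H -> H}) B :
  (forall u, nr (h u) <= B * nr u) -> continuous h.
Proof.
move=> hB u; have B0 : 0 < `|B| + 1 by rewrite ltr_wpDl.
apply/cvgrPdist_lt => e e0.
have eE : e = (complex.Re e)%:C by rewrite RRe_real// gtr0_real.
have r0 : 0 < complex.Re e by rewrite -(ltcR 0) -eE.
near=> v.
rewrite -linearB -nrE eE ltcR.
have uv : nr (u - v) < complex.Re e / (`|B| + 1).
  rewrite -ltcR nrE; near: v; apply: cvgr_dist_lt => //.
  by rewrite (ltcR 0) divr_gt0.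
apply: le_lt_trans (hB _) _.
apply: (@le_lt_trans _ _ ((`|B| + 1) * nr (u - v))).
  by rewrite ler_wpM2r ?nr_ge0// (le_trans (ler_norm _))// lerDl.
by rewrite mulrC -ltr_pdivlMr.
Unshelve. all: by end_near. Qed.

End HilbertBasics.

(** * Polynomials in an operator and points of its spectrum *)

Section OperatorPolynomials.
Context {R : realType} {H : completeNormedModType R[i]}.
Variable dot : {dot H for (@Num.conj R[i])}.
Hypothesis dot_norm : is_hilbert_dot dot.
Local Notation C := R[i].
Local Notation rd := (re_dot dot).
Implicit Types (u v w : H) (a b c : R) (h : {linear H -> H}) (p q r : {poly R}).

Lemma op_polyE p h u : op_poly p h u = pev (fun i => iter i h u) p.
Proof. by []. Qed.

Lemma op_polyD p q h u : op_poly (p + q) h u = op_poly p h u + op_poly q h u.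
Proof. by rewrite !op_polyE pevD. Qed.

Lemma op_polyB p q h u : op_poly (p - q) h u = op_poly p h u - op_poly q h u.
Proof. by rewrite !op_polyE pevB. Qed.

Lemma op_polyC c h u : op_poly c%:P h u = c%:C *: u.
Proof. by rewrite op_polyE pevC. Qed.

Lemma op_polyMX p h u : op_poly (p * 'X) h u = op_poly p h (h u).
Proof.
by rewrite op_polyE pevMX; apply: eq_pev => i; exact: iterSr.
Qed.

Lemma op_poly_is_linear p h : linear (op_poly p h).
Proof.
move=> z u v; elim/poly_ind: p u v => [|p c IH] u v.
  by rewrite /op_poly size_poly0 !big_ord0 scaler0 addr0.
rewrite !op_polyD !op_polyMX !op_polyC linearP IH !scalerDr !scalerA.
by rewrite [c%:C * z]mulrC addrACA.
Qed.

Definition op_polyL p h : {linear H -> H} :=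
  HB.pack (op_poly p h) (GRing.isLinear.Build _ _ _ _ _ (op_poly_is_linear p h)).

Lemma op_polyM p q h u : op_poly (p * q) h u = op_poly p h (op_poly q h u).
Proof.
elim/poly_ind: q u => [|q c IH] u.
  rewrite mulr0 [op_poly 0 h u](_ : _ = 0) -?[op_poly p h]/(op_polyL p h : H -> H).
    by rewrite -[op_polyL p h _](_ : op_polyL p h 0 = _) ?linear0//
       /op_poly size_poly0 big_ord0.
  by rewrite /op_poly size_poly0 big_ord0.
rewrite mulrDr mulrA !op_polyD !op_polyMX IH.
rewrite -![op_poly p h (_ + _)]/(op_polyL p h (_ + _)) linearD; congr (_ + _).
rewrite op_polyC mulrC mul_polyC op_polyE pevZ -op_polyE.
by rewrite -[RHS]/(op_polyL p h (_ *: _)) linearZ.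
Qed.

Definition symmetric_op (A : H -> H) := forall u v, dot (A u) v = dot u (A v).

Lemma symmetric_rd A u v : symmetric_op A -> rd (A u) v = rd u (A v).
Proof. by move=> sA; rewrite /re_dot sA. Qed.

Lemma op_poly_symmetric p h : symmetric_op h -> symmetric_op (op_poly p h).
Proof.
move=> sh u v; elim/poly_ind: p u v => [|p c IH] u v.
  by rewrite /op_poly size_poly0 !big_ord0 linear0l linear0r.
have comm w : op_poly p h (h w) = h (op_poly p h w).
  by rewrite -op_polyMX mulrC op_polyM -[X in op_poly X]mul1r op_polyMX op_polyC
    rmorph1 scale1r.
rewrite !op_polyD !op_polyMX !op_polyC linearDl linearDr/=.
rewrite IH sh -comm linearZl_LR linearZr_LR/=; congr (_ + _ * _).
by apply/esym/CrealP; rewrite complex_real.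
Qed.

Lemma op_poly_bounded p h B : 0 <= B -> (forall u, nr (h u) <= B * nr u) ->
  exists2 c, 0 < c & forall u, nr (op_poly p h u) <= c * nr u.
Proof.
move=> B0 hB; elim/poly_ind: p => [|p c [K K0 IH]].
  by exists 1 => // u; rewrite /op_poly size_poly0 big_ord0 nr0 mul1r nr_ge0.
exists (K * B + `|c| + 1) => [|u].
  by rewrite ltr_wpDl// addr_ge0// mulr_ge0// ltW.
rewrite op_polyD op_polyMX op_polyC; apply: le_trans (nrD _ _) _.
rewrite nrZ cabs_real; have h1 := IH (h u); have h2 := hB u.
have : K * nr (h u) <= K * (B * nr u) by rewrite ler_wpM2l// ltW.
have := nr_ge0 u; nra.
Qed.

(* [0 <= <A v, v>] at [v = u - A u / B]. *)
Lemma positive_op_bound (A : {linear H -> H}) B : 0 < B -> symmetric_op A ->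
  (forall u, 0 <= rd (A u) u) -> (forall u, nr (A u) <= B * nr u) ->
  forall u, nr (A u) ^+ 2 <= B * rd (A u) u.
Proof.
move=> B0 sA posA AB u; have := posA (u - (B^-1)%:C *: A u).
rewrite linearB linearZ/= rdDl !rdDr !rdNl !rdNr !rdZl !rdZr.
rewrite (symmetric_rd (A u) u sA) (rd_nr dot_norm).
have := rd_le dot_norm (A (A u)) (A u); have := AB (A u).
set x := nr (A (A u)); set y := nr (A u); set z := rd (A (A u)) _.
set q := rd (A u) u => xy zx pos.
have y0 : 0 <= y by exact: nr_ge0.
have zy : B^-1 * (B^-1 * z) <= B^-1 * y ^+ 2.
  rewrite ler_wpM2l ?invr_ge0 ?(ltW B0)// mulrC ler_pdivrMr//; nra.
have {}pos : B^-1 * y ^+ 2 <= q by lra.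
by rewrite -ler_pdivrMl.
Qed.

(** A substitute for invertibility that is stable under composition; its failure for [h - z] puts
    [z] in the spectrum. *)
Definition bounded_below (A : H -> H) :=
  exists2 d, 0 < d & forall u, d * nr u <= nr (A u).

Lemma notin_spectrum_bounded_below h (z : C) : ~ op_spectrum h z ->
  bounded_below (fun u => h u - z *: u).
Proof.
move=> /contrapT[k [kc kl _]]; have [B B0 kB] := bounded_of_continuous kc.
exists B^-1 => [|u]; first by rewrite invr_gt0.
by rewrite ler_pdivrMl// -{1}(kl u).
Qed.

(** Since [<h u, u>] is real, [|Im <(h - z) u, u>|] equals [|Im z| |u|^2]; Cauchy-Schwarz
    concludes. *)
Lemma nonreal_bounded_below h (z : C) : symmetric_op h -> complex.Im z != 0 ->
  bounded_below (fun u => h u - z *: u).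
Proof.
move=> sh z0; exists `|complex.Im z| => [|u]; first by rewrite normr_gt0.
have [/eqP|u0] := boolP (nr u == 0); first by move=> ->; rewrite mulr0 nr_ge0.
have u1 : 0 < nr u by rewrite lt_def u0 nr_ge0.
rewrite -(ler_pM2r u1); apply: le_trans (Im_dot_abs dot_norm _ _).
have Imh : complex.Im (dot (h u) u) = 0.
  have : dot (h u) u = Num.conj (dot (h u) u) by rewrite -dotC -sh.
  by case: (dot (h u) u) => x y [] /=; lra.
have -> : dot (h u - z *: u) u = dot (h u) u - z * dot u u.
  by rewrite [LHS]linearBl linearZl_LR.
rewrite (dot_nr dot_norm).
case: (dot (h u) u) Imh => x y /= ->; case: z {z0} => zr zi /=.
by rewrite mulr0 !add0r normrN normrM [`|_ ^+ 2|]ger0_norm ?sqr_ge0// expr2 mulrA.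
Qed.

Lemma bounded_below_comp (A B : H -> H) :
  bounded_below A -> bounded_below B -> bounded_below (A \o B).
Proof.
move=> [a a0 aP] [b b0 bP]; exists (a * b) => [|u]; first by rewrite mulr_gt0.
by rewrite -mulrA (le_trans _ (aP _))// ler_wpM2l// ltW.
Qed.

(** Complex coefficients allow a real polynomial to be split into linear factors. *)
Definition cop (p : {poly C}) h u : H := \sum_(i < size p) p`_i *: iter i h u.

Lemma cop_widen (p : {poly C}) h u N : (size p <= N)%N ->
  cop p h u = \sum_(i < N) p`_i *: iter i h u.
Proof.
move=> leN; rewrite /cop (big_ord_widen N (fun i => p`_i *: iter i h u) leN).
rewrite big_mkcond; apply: eq_bigr => i _.
by case: ltnP => // /(nth_default 0) ->; rewrite scale0r.
Qed.

Lemma cop_real p h u : cop (map_poly (real_complex R) p) h u = op_poly p h u.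
Proof.
by rewrite /cop /op_poly size_map_poly; apply: eq_bigr => i _; rewrite coef_map.
Qed.

Lemma cop_factor (p : {poly C}) h (z : C) u : cop (p * ('X - z%:P)) h u = cop p h (h u - z *: u).
Proof.
have iterL i x y : iter i h (x - z *: y) = iter i h x - z *: iter i h y.
  by elim: i => //= i ->; rewrite linearB linearZ.
rewrite (@cop_widen _ _ _ (size p).+1); last first.
  by rewrite (leq_trans (size_polyMleq _ _))// size_XsubC addn2.
rewrite /cop; under [in RHS]eq_bigr do rewrite iterL scalerBr -iterSr scalerA.
rewrite sumrB.
under eq_bigr do rewrite mulrBr coefB coefMX coefMC scalerBl.
rewrite sumrB big_ord_recl eqxx scale0r add0r; congr (_ - _).
by rewrite big_ord_recr/= nth_default// mul0r scale0r addr0.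
Qed.

Lemma cop_prod_bounded_below (s : seq C) h :
  (forall z, z \in s -> bounded_below (fun u => h u - z *: u)) ->
  bounded_below (cop (\prod_(z <- s) ('X - z%:P)) h).
Proof.
elim: s => [|z s IH] hs.
  rewrite big_nil; exists 1 => // u.
  by rewrite /cop size_poly1 big_ord1 coef1/= scale1r mul1r.
have [d d0 dP] : bounded_below (cop (\prod_(z <- s) ('X - z%:P)) h
    \o (fun u => h u - z *: u)).
  apply: bounded_below_comp; last by apply: hs; rewrite mem_head.
  by apply: IH => y ys; apply: hs; rewrite inE ys orbT.
by exists d => // u; rewrite big_cons [X in cop X]mulrC cop_factor.
Qed.

(* If [q(h)] is not bounded below, neither is one of its linear factors. *)
Lemma spectral_root q h : symmetric_op h -> q != 0 ->
  (forall d, 0 < d -> exists2 u, nr u = 1 & nr (op_poly q h u) < d) ->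
  exists2 x, op_spectrum h x%:C & q.[x] = 0.
Proof.
move=> sh q0 approx; apply: contrapT => no_root.
pose Q := map_poly (real_complex R) q.
have Q0 : lead_coef Q != 0 by rewrite lead_coef_eq0 map_poly_eq0.
have [s] := closed_field_poly_normal Q; move: (lead_coef Q) Q0 => l lN0 sE.
have [d d0 dP] : bounded_below (cop (\prod_(z <- s) ('X - z%:P)) h).
  apply: cop_prod_bounded_below => z zs.
  have [z0|z0] := eqVneq (complex.Im z) 0; last exact: nonreal_bounded_below.
  apply: notin_spectrum_bounded_below => sz; apply: no_root.
  have zE : z = (complex.Re z)%:C by case: (z) z0 => x y /= ->.
  exists (complex.Re z); first by rewrite -zE.
  apply: complexI; rewrite -horner_map /= -zE -/Q sE hornerZ rmorph0.
  by have /eqP -> : root (\prod_(z <- s) ('X - z%:P)) z; rewrite ?mulr0 ?root_prod_XsubC.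
have l0 : 0 < cabs l by rewrite lt_def cabs_eq0 lN0 cabs_ge0.
have [u u1 uq] := approx (cabs l * d) (mulr_gt0 l0 d0).
move: uq; rewrite -cop_real -/Q sE.
have -> : cop (l *: \prod_(z <- s) ('X - z%:P)) h u =
    l *: cop (\prod_(z <- s) ('X - z%:P)) h u.
  rewrite (@cop_widen _ _ _ (size (\prod_(z <- s) ('X - z%:P)))) ?size_scale_leq//.
  by rewrite scaler_sumr; apply: eq_bigr => i _; rewrite coefZ scalerA.
rewrite nrZ ltr_pM2l// => lt_d; have := dP u; rewrite u1 mulr1.
by rewrite leNgt lt_d.
Qed.

End OperatorPolynomials.

(** * Weierstrass approximation *)

Section Weierstrass.
Context {R : realType}.
Implicit Types (phi psi : nat -> R) (x : R).

(* [bernstein n phi] evaluated at [x] is the expectation of [phi] under the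
   binomial law of parameters [n] and [x]. *)
Fixpoint bernstein n phi : {poly R} :=
  if n is m.+1 then
    'X * bernstein m (phi \o succn) + (1%:P - 'X) * bernstein m phi
  else (phi 0%N)%:P.

Lemma bernsteinS n phi x : (bernstein n.+1 phi).[x] =
  x * (bernstein n (phi \o succn)).[x] + (1 - x) * (bernstein n phi).[x].
Proof. by rewrite /= !(hornerD, hornerM, hornerN, hornerC, hornerX). Qed.

Lemma bernstein_le n phi psi x : 0 <= x <= 1 ->
  (forall k, (k <= n)%N -> phi k <= psi k) ->
  (bernstein n phi).[x] <= (bernstein n psi).[x].
Proof.
move=> /andP[x0 x1]; elim: n phi psi => [|n IH] phi psi le.
  by rewrite !hornerC le.
rewrite !bernsteinS lerD// ler_wpM2l ?subr_ge0// IH// => k kn; apply: le => //.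
exact: leqW.
Qed.

Lemma bernstein_affine n phi a b x :
  (bernstein n (fun k => a + b * phi k)).[x] = a + b * (bernstein n phi).[x].
Proof.
elim: n phi => [|n IH] phi; first by rewrite !hornerC.
by rewrite !bernsteinS IH -[X in bernstein n X]/(fun k => a + b * (phi \o succn) k)
  IH; ring.
Qed.

(** Variance of the binomial law plus the square of the bias. The centre [c] is arbitrary because
    the induction shifts it by one. *)
Lemma bernstein_variance n c x :
  (bernstein n (fun k => (k%:R - c) ^+ 2)).[x] =
  n%:R * (x * (1 - x)) + (n%:R * x - c) ^+ 2.
Proof.
elim: n c => [|n IH] c; first by rewrite hornerC; ring.
have IH' := IH (c - 1); rewrite bernsteinS IH.
have -> : (fun k => (k%:R - c) ^+ 2 : R) \o succn =
    (fun k => (k%:R - (c - 1)) ^+ 2).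
  by apply/funext => k /=; rewrite -natr1; ring.
by rewrite IH' -natr1; ring.
Qed.

Lemma uniform_continuity (g : R -> R) : {within `[0, 1], continuous g} ->
  forall e, 0 < e -> exists2 d, 0 < d & forall x y, 0 <= x <= 1 -> 0 <= y <= 1 ->
    `|x - y| < d -> `|g x - g y| <= e.
Proof.
move=> gc e e0.
have gx x : 0 <= x <= 1 -> exists2 d, 0 < d & forall y, 0 <= y <= 1 ->
    `|x - y| < d -> `|g x - g y| < e / 2.
  move=> x01; have /subspace_continuousP/(_ x) := gc.
  rewrite /= in_itv/= => /(_ x01)/cvgrPdist_lt/(_ (e / 2)).
  rewrite divr_gt0// => /(_ isT)/nbhs_ballP[d /= d0 dP].
  by exists d => // y y01 xy; apply: dP => //; rewrite in_itv.
pose P (d x : R) := 0 <= x <= 1 -> forall y, 0 <= y <= 1 ->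
  `|x - y| < d -> `|g x - g y| <= e.
have Kc : compact (`[(0 : R), 1]%classic : set R) by exact: segment_compact.
have : \forall d \near 0^'+, `[(0 : R), 1]%classic `<=` P d.
  apply: ((compact_near_coveringP _).1 Kc) => x; rewrite /= in_itv/= => x01.
  have [d d0 dP] := gx x x01.
  have d20 : 0 < d / 2 by rewrite divr_gt0.
  exists ([set y | `|x - y| < d / 2], [set r : R | r < d / 2]) => /=.
    by split; [apply/nbhs_ballP; exists (d / 2)|exact: nbhs_right_lt].
  move=> [y r] /= [xy rd] y01 z z01 yz.
  have xz : `|x - z| < d.
    by have := ler_distD y x z; lra.
  have := dP y y01 (lt_trans xy _); have := dP z z01 xz.
  rewrite ltr_pdivrMr ?ltr_pMr ?ltr1n// => gz /(_ isT) gy.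
  by have := ler_distD (g x) (g y) (g z); rewrite [`|g y - g x|]distrC; lra.
move=> h; near (0 : R)^'+ => d; exists d.
  by near: d; exact: nbhs_right_gt.
move=> x y x01; have : `[(0 : R), 1]%classic `<=` P d by near: d.
by move=> /(_ x); rewrite /= in_itv/= => /(_ x01 x01); exact.
Unshelve. all: by end_near. Qed.

Lemma weierstrass_unit (g : R -> R) : {within `[0, 1], continuous g} ->
  forall e, 0 < e -> exists p : {poly R},
    forall x, 0 <= x <= 1 -> `|p.[x] - g x| <= e.
Proof.
move=> gc e e0; have e2 : 0 < e / 2 by rewrite divr_gt0.
have [d d0 dP] := uniform_continuity gc e2.
have [M0 gM] : exists M, forall x, 0 <= x <= 1 -> `|g x| <= M.
  have gc' : {within `[0, 1], continuous (fun x => - g x)}.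
    by move=> x; apply: cvgN; exact: gc.
  have [u _ uP] := EVT_max ler01 gc; have [v _ vP] := EVT_max ler01 gc'.
  exists (`|g u| + `|g v|) => x x01.
  have := uP x; have := vP x; rewrite in_itv/= => /(_ x01) h1 /(_ x01) h2.
  have := ler_norm (g u); have := ler_norm (- g v); rewrite normrN.
  by rewrite ler_norml => *; apply/andP; split; have := normr_ge0 (g u);
    have := normr_ge0 (g v); lra.
pose M := M0 + 1.
have Mp : 0 < M by have := gM 0; rewrite lexx ler01 => /(_ isT) h; 
  have := normr_ge0 (g 0); rewrite /M; lra.
have {}gM x : 0 <= x <= 1 -> `|g x| <= M by move=> /gM h; rewrite /M; lra.
(* Chebyshev's argument: [c * (k / N - x) ^+ 2] exceeds [2 * M], the largest possible oscillation,
   once [k / N] is at distance [d] from [x]. Its expectation is at most [c / N], which the choice of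
   [n] makes smaller than [e / 2]. *)
pose c := 2 * M / d ^+ 2.
have c0 : 0 < c by rewrite divr_gt0 ?exprn_gt0// mulr_gt0.
have [n nc] : exists n : nat, c / (e / 2) < n.+1%:R.
  exists (Num.truncn (c / (e / 2))).
  by rewrite truncnS_gt.
exists (bernstein n.+1 (fun k => g (k%:R / n.+1%:R))) => x x01.
set N : R := n.+1%:R in nc *; have N0 : 0 < N by rewrite ltr0n.
pose up (k : nat) : R := (g x + e / 2) + c / N ^+ 2 * (k%:R - N * x) ^+ 2.
pose lo (k : nat) : R := (g x - e / 2) + (- (c / N ^+ 2)) * (k%:R - N * x) ^+ 2.
have varE : (bernstein n.+1 (fun k => (k%:R - N * x) ^+ 2)).[x] = N * (x * (1 - x)).
  by rewrite bernstein_variance subrr; ring.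
have small : c / N ^+ 2 * (N * (x * (1 - x))) <= e / 2.
  have -> : c / N ^+ 2 * (N * (x * (1 - x))) = c / N * (x * (1 - x)).
    by field; rewrite gt_eqF.
  have cN : c / N <= e / 2.
    by rewrite ler_pdivrMr// mulrC -ler_pdivrMr// ltW.
  have cN0 : 0 <= c / N by rewrite divr_ge0// ltW.
  by apply: le_trans (ler_piMr cN0 _) cN; move/andP: x01 => [x0 x1]; nra.
have close k : (k <= n.+1)%N -> lo k <= g (k%:R / N) <= up k.
  move=> kn; have k01 : 0 <= k%:R / N <= 1.
    by rewrite divr_ge0 ?ler0n ?(ltW N0)//= ler_pdivrMr// mul1r ler_nat.
  have key : `|g (k%:R / N) - g x| <= e / 2 + c / N ^+ 2 * (k%:R - N * x) ^+ 2.
    have -> : c / N ^+ 2 * (k%:R - N * x) ^+ 2 = c * (k%:R / N - x) ^+ 2.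
      by field; rewrite gt_eqF.
    have [near|far] := ltP `|k%:R / N - x| d.
      apply: le_trans (dP _ _ k01 x01 near) _; rewrite lerDl.
      by rewrite mulr_ge0 ?sqr_ge0// ltW.
    have : 2 * M <= c * (k%:R / N - x) ^+ 2.
      rewrite /c mulrAC ler_pdivlMr ?exprn_gt0// ler_wpM2l ?mulr_ge0 ?(ltW Mp)//.
      by rewrite -[X in _ <= X]real_normK ?num_real// lerXn2r ?nnegrE// ltW.
    move: (ler_normB (g (k%:R / N)) (g x)) (gM _ k01) (gM _ x01).
    move: (c * _) `|g (k%:R / N) - g x| `|g (k%:R / N)| `|g x| => u v w z.
    by move: e2 Mp; move: (e / 2) (M) => ? ? *; lra.
  move: key; rewrite ler_norml /lo /up.
  move: (g (k%:R / N)) (g x) (c / N ^+ 2) ((k%:R - N * x) ^+ 2) (e / 2).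
  by move=> u v w z r /andP[? ?]; apply/andP; split; lra.
have h1 := bernstein_le x01 (fun k kn => proj2 (andP (close k kn))).
have h2 := bernstein_le x01 (fun k kn => proj1 (andP (close k kn))).
move: h1 h2 small; rewrite /up /lo !bernstein_affine varE ler_norml.
move: (bernstein _ _).[x] (g x) (c / N ^+ 2) (N * (x * (1 - x))) => u v w z.
by move=> *; apply/andP; split; lra.
Qed.

Lemma weierstrass (g : R -> R) a b : {within `[a, b], continuous g} ->
  forall e, 0 < e -> exists p : {poly R},
    forall x, a <= x <= b -> `|p.[x] - g x| <= e.
Proof.
move=> gc e e0; have [ab|] := ltP a b; last first.
  move=> ba; exists (g a)%:P => x xab; have -> : x = a by lra.
  by rewrite hornerC subrr normr0 ltW.
pose l t := a + (b - a) * t.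
have l01 t : 0 <= t <= 1 -> a <= l t <= b.
  by move=> /andP[? ?]; apply/andP; split; rewrite /l; nra.
have gl : {within `[0, 1], continuous (g \o l)}.
  apply/subspace_continuousP => t; rewrite /= in_itv/= => t01.
  have lt : `[a, b]%classic (l t) by rewrite /= in_itv/=; exact: l01.
  have /subspace_continuousP/(_ (l t) lt) := gc.
  move=> /cvgrPdist_lt gl; apply/cvgrPdist_lt => r r0.
  have /nbhs_ballP[d /= d0 dP] := gl r r0.
  have ba1 : 0 < b - a + 1 by lra.
  apply/nbhs_ballP; exists (d / (b - a + 1)) => /=; first by rewrite divr_gt0.
  move=> u /= ut; rewrite in_itv/= => u01; apply: dP; last first.
    by rewrite /= in_itv/=; exact: l01.
  rewrite /ball/= (_ : l t - l u = (b - a) * (t - u)); last by rewrite /l; ring.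
  rewrite normrM ger0_norm ?subr_ge0 ?(ltW ab)//.
  apply: le_lt_trans (_ : (b - a + 1) * `|t - u| < d).
    by rewrite ler_wpM2r// lerDl.
  by rewrite mulrC -ltr_pdivlMr.
have [p pP] := weierstrass_unit gl e0.
exists (p \Po ((b - a)^-1 *: ('X - a%:P))) => x /andP[ax xb].
have ba0 : 0 < b - a by lra.
have := pP ((x - a) / (b - a)); rewrite divr_ge0 ?ler_pdivrMr//; try lra.
rewrite mul1r => /(_ _) h.
rewrite horner_comp hornerZ hornerD hornerN hornerX hornerC mulrC.
have lE : (g \o l) ((x - a) / (b - a)) = g x.
  by rewrite /= /l mulrC divfK ?gt_eqF// addrC subrK.
by rewrite -lE; apply: h; lra.
Qed.

End Weierstrass.

(** * Numerical range and compressions *)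

Section NumericalRange.
Context {R : realType} {H : completeNormedModType R[i]}.
Variable dot : {dot H for (@Num.conj R[i])}.
Hypothesis dot_norm : is_hilbert_dot dot.
Variable h : {linear H -> H}.
Hypotheses (h_sa : bounded_selfadjoint dot h) (H_neq0 : exists v : H, nr v != 0).
Local Notation C := R[i].
Local Notation rd := (re_dot dot).
Implicit Types (u v w : H) (a b c : R) (p q r : {poly R}).

Lemma h_sym : symmetric_op dot h. Proof. by have [] := h_sa. Qed.

Lemma op_poly_bound p : exists2 c, 0 < c & forall u, nr (op_poly p h u) <= c * nr u.
Proof.
have [hc _] := h_sa; have [B B0 hB] := bounded_of_continuous hc.
exact: op_poly_bounded (ltW B0) hB.
Qed.

Lemma form_sup p : exists s,
  (forall u, rd (op_poly p h u) u <= s * nr u ^+ 2) /\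
  forall d, 0 < d -> exists2 u, nr u = 1 & s - d < rd (op_poly p h u) u.
Proof.
have [c c0 cP] := op_poly_bound p; have [v v0] := H_neq0.
have v1 : 0 < nr v by rewrite lt_def v0 nr_ge0.
pose E := [set rd (op_poly p h u) u | u in [set u | nr u = 1]].
have unit u : nr u != 0 -> nr ((nr u)^-1%:C *: u) = 1.
  by move=> u0; rewrite nrZ cabs_real ger0_norm ?invr_ge0 ?nr_ge0// mulVf.
have E_sup : has_sup E.
  split; first by exists (rd (op_poly p h ((nr v)^-1%:C *: v)) ((nr v)^-1%:C *: v));
    exists ((nr v)^-1%:C *: v) => //=; exact: unit.
  exists c => _ [u /= u1 <-]; apply: le_trans (rd_le dot_norm _ _) _.
  by rewrite u1 mulr1 (le_trans (cP u))// u1 mulr1.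
exists (sup E); split=> [u|d d0].
  have [/eqP|u0] := boolP (nr u == 0).
    move=> u0; have /eqP -> : u == 0 by rewrite -nr_eq0 u0.
    by rewrite nr0 expr0n mulr0 /re_dot linear0r.
  have u1 : 0 < nr u by rewrite lt_def u0 nr_ge0.
  have : rd (op_poly p h ((nr u)^-1%:C *: u)) ((nr u)^-1%:C *: u) <= sup E.
    apply: sup_upper_bound => //; exists ((nr u)^-1%:C *: u) => //=.
    exact: unit.
  rewrite -[op_poly p h (_ *: _)]/(op_polyL p h (_ *: _)) linearZ rdZl rdZr /=.
  rewrite mulrA -expr2 exprVn ler_pdivrMl ?exprn_gt0//.
  by rewrite mulrC.
have [_ [u u1 <-] lt] := sup_adherent d0 E_sup.
by exists u.
Qed.

(* The supremum of the form of [p(h)] is an eigenvalue of [p(h)] in the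
   approximate sense. *)
Lemma extremal_root_nonconstant p : (1 < size p)%N -> exists2 x,
  op_spectrum h x%:C & forall u, rd (op_poly p h u) u <= p.[x] * nr u ^+ 2.
Proof.
move=> sp; have [s [s_ub s_app]] := form_sup p.
pose q := s%:P - p.
have qE u : op_poly q h u = s%:C *: u - op_poly p h u.
  by rewrite op_polyB op_polyC.
have q_rd u : rd (op_poly q h u) u = s * nr u ^+ 2 - rd (op_poly p h u) u.
  by rewrite qE rdDl rdNl rdZl (rd_nr dot_norm).
have q0 : q != 0.
  apply/eqP => /eqP; rewrite subr_eq0 => /eqP pE.
  by move: sp; rewrite -pE size_polyC; case: (s != 0).
have [B B0 qB] := op_poly_bound q.
have q_app d : 0 < d -> exists2 u, nr u = 1 & nr (op_poly q h u) < d.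
  (* For a unit vector within [d ^+ 2 / B] of the supremum, the form of the positive operator [q(h)]
     is below [d ^+ 2 / B], and [positive_op_bound] gives [nr (q(h) u) < d]. *)
  move=> d0; have [|u u1 ud] := s_app (d ^+ 2 / B).
    by rewrite divr_gt0 ?exprn_gt0.
  exists u => //; rewrite -(@ltr_pXn2r _ 2) ?nnegrE ?nr_ge0 ?(ltW d0)//.
  have pos v : 0 <= rd (op_polyL q h v) v by rewrite q_rd subr_ge0.
  have := positive_op_bound (A := op_polyL q h) dot_norm B0
    (op_poly_symmetric q h_sym) pos qB u.
  rewrite /= => /le_lt_trans; apply; rewrite q_rd u1 expr1n mulr1 mulrC -ltr_pdivlMr//; lra.
have [x sx qx] := spectral_root dot_norm h_sym q0 q_app.
exists x => // u; have -> : p.[x] = s; last exact: s_ub.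
by move: qx; rewrite /q hornerD hornerN hornerC; lra.
Qed.

(** A constant polynomial only asks for some point of the spectrum, which the case of ['X]
    provides. *)
Lemma extremal_root p : exists2 x,
  op_spectrum h x%:C & forall u, rd (op_poly p h u) u <= p.[x] * nr u ^+ 2.
Proof.
have [sp|sp] := ltnP 1 (size p); first exact: extremal_root_nonconstant.
have [|x sx _] := @extremal_root_nonconstant 'X; first by rewrite size_polyX.
exists x => // u; rewrite (size1_polyC sp) op_polyC hornerC rdZl.
by rewrite (rd_nr dot_norm).
Qed.

(** Both endpoints are spectral values: a spectrum contained in the interval [I] therefore forces
    [[a, b]] into [I]. *)
Lemma numerical_range : exists a b,
  [/\ op_spectrum h a%:C, op_spectrum h b%:C &
    forall u, a * nr u ^+ 2 <= rd (h u) u <= b * nr u ^+ 2].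
Proof.
have X1 u : op_poly 'X h u = h u.
  by rewrite -['X]mul1r op_polyMX op_polyC rmorph1 scale1r.
have [b sb bP] := extremal_root 'X; have [a sa aP] := extremal_root (- 'X).
have XN u : op_poly (- 'X) h u = - h u.
  have -> : - 'X = 0%:P - 'X :> {poly R} by rewrite polyC0 sub0r.
  by rewrite op_polyB op_polyC X1 rmorph0 scale0r sub0r.
exists (- (- 'X).[a]), b; split=> //; first by rewrite hornerN hornerX opprK.
move=> u; have := bP u; have := aP u; rewrite XN X1 rdNl hornerX.
by move: (rd _ _) (_.[a]) (nr u ^+ 2) => x y z *; apply/andP; split; lra.
Qed.

(** The square of the norm of [r(h) u] is the form of [r^2(h)] at [u], bounded through the value of
    [r^2] at one point of the spectrum. *)
Lemma op_poly_small r c : (forall x, op_spectrum h x%:C -> `|r.[x]| <= c) ->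
  forall u, nr (op_poly r h u) <= c * nr u.
Proof.
move=> rc u; have [x sx xP] := extremal_root (r * r).
have c0 : 0 <= c by apply: le_trans (rc x sx).
have nu := nr_ge0 u.
rewrite -(@ler_pXn2r _ 2) ?nnegrE ?nr_ge0 ?mulr_ge0// -(rd_nr dot_norm).
rewrite -(symmetric_rd _ _ (op_poly_symmetric r h_sym)) -op_polyM.
apply: le_trans (xP u) _; rewrite exprMn ler_wpM2r ?exprn_ge0//.
rewrite hornerM -expr2 -real_normK ?num_real// lerXn2r ?nnegrE//.
exact: rc.
Qed.

End NumericalRange.

Section Compression.
Context {R : realType} {H : completeNormedModType R[i]}.
Variable dot : {dot H for (@Num.conj R[i])}.
Hypothesis dot_norm : is_hilbert_dot dot.
Local Notation C := R[i].
Local Notation rd := (re_dot dot).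
Implicit Types (u v w : H) (h : {linear H -> H}).

Definition orthonormal_family k (e : nat -> H) :=
  forall i j, (i < k)%N -> (j < k)%N -> dot (e i) (e j) = (i == j)%:R.

Definition spanned k (e : nat -> H) v := v = \sum_(i < k) dot v (e i) *: e i.

Lemma dot_suml k (F : 'I_k -> H) v : dot (\sum_i F i) v = \sum_i dot (F i) v.
Proof.
elim/big_rec2: _ => [|i y x _ <-]; first by rewrite linear0l.
by rewrite [LHS]linearDl.
Qed.

Lemma dot_sumr k (F : 'I_k -> H) v : dot v (\sum_i F i) = \sum_i dot v (F i).
Proof.
elim/big_rec2: _ => [|i y x _ <-]; first by rewrite linear0r.
by rewrite [LHS]linearDr.
Qed.

Lemma dotZl (z : C) u v : dot (z *: u) v = z * dot u v.
Proof. by rewrite [LHS]linearZl_LR. Qed.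

Lemma dotZr (z : C) u v : dot u (z *: v) = Num.conj z * dot u v.
Proof. by rewrite [LHS]linearZr_LR. Qed.

Lemma dotDl u v w : dot (u + v) w = dot u w + dot v w.
Proof. by rewrite [LHS]linearDl. Qed.

Lemma dotDr u v w : dot w (u + v) = dot w u + dot w v.
Proof. by rewrite [LHS]linearDr. Qed.

Lemma dotBl u v w : dot (u - v) w = dot u w - dot v w.
Proof. by rewrite [LHS]linearBl. Qed.

(** The length [k] is left free, since a vector with zero residue [w] adds no new element. *)
Lemma gram_schmidt (vs : seq H) : exists k e,
  orthonormal_family k e /\ forall v, v \in vs -> spanned k e v.
Proof.
elim: vs => [|v vs [k [e [on sp]]]]; first by exists 0%N, (fun=> 0).
pose w := v - \sum_(i < k) dot v (e i) *: e i.
have we j : (j < k)%N -> dot w (e j) = 0.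
  move=> jk; rewrite dotBl dot_suml (bigD1 (Ordinal jk))//= big1.
    by rewrite dotZl on// eqxx mulr1 addr0 subrr.
  by move=> i ij; rewrite dotZl on// (negPf (_ : nat_of_ord i != j)) ?mulr0.
have [w0|w0] := eqVneq w 0.
  exists k, e; split=> // x; rewrite inE => /orP[/eqP ->|]; last exact: sp.
  by apply/eqP; rewrite -subr_eq0; apply/eqP.
have nw : nr w != 0 by rewrite nr_eq0.
pose f := ((nr w)^-1)%:C *: w.
pose e' i := if (i < k)%N then e i else f.
have e'k i : (i < k)%N -> e' i = e i by rewrite /e' => ->.
have e'f : e' k = f by rewrite /e' ltnn.
have nwC : (nr w)%:C != 0 by rewrite -(rmorph0 (real_complex R)) (inj_eq (@complexI R)).
have cr : Num.conj ((nr w)^-1)%:C = ((nr w)^-1)%:C.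
  by apply/CrealP; rewrite complex_real.
have fe j : (j < k)%N -> dot f (e j) = 0 by move=> jk; rewrite dotZl we// mulr0.
have ff : dot f f = 1.
  rewrite dotZl dotZr cr (dot_nr dot_norm) -!rmorphM /=.
  by rewrite (_ : _ * _ = 1) ?rmorph1//; field.
have wf : dot w f = (nr w)%:C.
  rewrite /f dotZr cr (dot_nr dot_norm) -rmorphM /=.
  by congr (_%:C); field.
exists k.+1, e'; split=> [i j|x].
  rewrite 2!ltnS (leq_eqVlt i) (leq_eqVlt j) => /orP[/eqP ->|ik] /orP[/eqP ->|jk].
  - by rewrite e'f ff eqxx.
  - by rewrite e'f e'k// fe// gtn_eqF.
  - by rewrite e'f e'k// dotC fe// rmorph0 ltn_eqF.
  - by rewrite !e'k// on.
rewrite inE => xv; rewrite /spanned big_ord_recr /= e'f.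
rewrite (eq_bigr (fun i : 'I_k => dot x (e i) *: e i)); last first.
  by move=> i _; rewrite e'k.
case/orP: xv => [/eqP ->|xv].
  have vE : v = w + \sum_(i < k) dot v (e i) *: e i by rewrite /w subrK.
  have -> : dot v f = (nr w)%:C.
    rewrite {1}vE dotDl wf dot_suml big1 ?addr0// => i _.
    by rewrite dotZl (dotC dot (e i)) fe// rmorph0 mulr0.
  by rewrite /f scalerA -rmorphM mulfV// rmorph1 scale1r addrC.
have -> : dot x f = 0.
  rewrite (sp x xv) dot_suml big1// => i _.
  by rewrite dotZl (dotC dot (e i)) fe// rmorph0 mulr0.
by rewrite scale0r addr0; exact: sp.
Qed.

Section Frame.
Variables (k : nat) (e : nat -> H).
Hypothesis e_on : orthonormal_family k e.

Definition frame (x : 'rV[C]_k) : H := \sum_(i < k) x 0 i *: e i.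
Definition coords v : 'rV[C]_k := \row_i dot v (e i).

Lemma frame_coords v : spanned k e v -> frame (coords v) = v.
Proof.
by move=> {2}->; apply: eq_bigr => i _; rewrite mxE.
Qed.

Lemma dot_frame (x : 'rV[C]_k) (i : 'I_k) : dot (frame x) (e i) = x 0 i.
Proof.
rewrite dot_suml (bigD1 i)//= big1 => [|j ji].
  by rewrite dotZl e_on// eqxx mulr1 addr0.
by rewrite dotZl e_on// val_eqE (negPf ji) mulr0.
Qed.

Lemma nr_frame (x : 'rV[C]_k) : nr (frame x) ^+ 2 = bf 1%:M x x.
Proof.
rewrite -(rd_nr dot_norm) /re_dot {2}/frame dot_sumr /bf mulmx1 mxE.
congr complex.Re; apply: eq_bigr => i _.
by rewrite dotZr dot_frame !mxE mulrC.
Qed.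

Variable h : {linear H -> H}.
Hypothesis h_sym : symmetric_op dot h.

Definition compression_mx : 'M[C]_k := \matrix_(i, j) dot (h (e i)) (e j).

Fact compression_herm : compression_mx \is hermsymmx.
Proof.
apply/hermsymmxP/matrixP => i j; rewrite !mxE.
by rewrite -dotC h_sym.
Qed.

Definition compression : selfadj R k := SelfAdj compression_herm.

Lemma coords_h (x : 'rV[C]_k) : coords (h (frame x)) = x *m compression.
Proof.
apply/rowP => j; rewrite !mxE /frame linear_sum dot_suml.
by apply: eq_bigr => i _; rewrite linearZ/= dotZl !mxE.
Qed.

Lemma bf_compression (x : 'rV[C]_k) :
  bf compression x x = rd (h (frame x)) (frame x).
Proof.
rewrite /re_dot {2}/frame dot_sumr /bf -coords_h mxE; congr complex.Re.
by apply: eq_bigr => i _; rewrite dotZr !mxE mulrC.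
Qed.

Lemma ev_compression a b :
  (forall u, a * nr u ^+ 2 <= rd (h u) u <= b * nr u ^+ 2) ->
  forall i, a <= ev compression i <= b.
Proof.
by move=> ab; apply/ev_rangeP => x; rewrite -nr_frame bf_compression.
Qed.

Lemma op_poly_frame (p : {poly R}) u :
  (forall i, (i < size p)%N -> spanned k e (iter i h u)) -> spanned k e u ->
  op_poly p h u = frame (coords u *m mpol p compression).
Proof.
move=> sp spu; have iterE i : (i < size p)%N ->
    iter i h u = frame (coords u *m mpow compression i).
  move=> ip; rewrite -(frame_coords (sp i ip)); congr frame.
  elim: i ip => [|i IH] ip; first by rewrite mulmx1.
  have ip' := ltnW ip.
  by rewrite /= -{1}(frame_coords (sp i ip')) coords_h IH// -mulmxA.
rewrite /op_poly (eq_bigr (fun i : 'I_(size p) =>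
  frame ((p`_i)%:C *: (coords u *m mpow compression i)))); last first.
  move=> i _; rewrite iterE// /frame scaler_sumr; apply: eq_bigr => j _.
  by rewrite scalerA [in RHS]mxE.
rewrite /mpol /pev mulmx_sumr /frame exchange_big/=; apply: eq_bigr => j _.
rewrite -scaler_suml summxE; congr (_ *: _); apply: eq_bigr => i _.
by rewrite -scalemxAr mxE.
Qed.

Lemma rd_op_poly (p : {poly R}) u :
  (forall i, (i < size p)%N -> spanned k e (iter i h u)) -> spanned k e u ->
  rd (op_poly p h u) u = bf (mpol p compression) (coords u) (coords u).
Proof.
move=> sp spu; rewrite (op_poly_frame sp spu).
rewrite -{2}(frame_coords spu) /re_dot {2}/frame dot_sumr /bf mxE.
congr complex.Re; apply: eq_bigr => i _.
by rewrite dotZr dot_frame mulrC; congr (_ * _); rewrite !mxE.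
Qed.

End Frame.

End Compression.

(** * Continuous functional calculus *)

Lemma subr_sub_cancel (V : zmodType) (x y z : V) : x - y - (x - z) = z - y.
Proof. by rewrite opprB addrC addrA subrK. Qed.

Section ContinuousCalculus.
Context {R : realType} {H : completeNormedModType R[i]}.
Variable dot : {dot H for (@Num.conj R[i])}.
Hypothesis dot_norm : is_hilbert_dot dot.
Variable h : {linear H -> H}.
Hypothesis h_sa : bounded_selfadjoint dot h.
Local Notation C := R[i].
Local Notation rd := (re_dot dot).
Implicit Types (u v w : H) (c : R) (p q r : {poly R}) (g : R -> R).

Variables a b : R.
Hypothesis h_range : forall u, a * nr u ^+ 2 <= rd (h u) u <= b * nr u ^+ 2.

(** On the span of the iterates of [u] the claim concerns a matrix with eigenvalues in [[a, b]],
    where the squared norm is an average of [r^2] against the weights. *)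
Lemma op_poly_range_bound r c : 0 <= c ->
  (forall x, a <= x <= b -> `|r.[x]| <= c) ->
  forall u, nr (op_poly r h u) <= c * nr u.
Proof.
move=> c0 rc u; have h_sym : symmetric_op dot h by have [] := h_sa.
have [k [e [on sp]]] := gram_schmidt dot_norm
  (u :: [seq iter i h u | i <- iota 0 (size r)]).
have spu : spanned dot k e u by apply: sp; rewrite mem_head.
have sph i : (i < size r)%N -> spanned dot k e (iter i h u).
  move=> ir; apply: sp; rewrite inE; apply/orP; right.
  by apply/mapP; exists i => //; rewrite mem_iota.
pose T := compression k e h_sym; pose x := coords dot k e u.
have nu : nr u ^+ 2 = bf 1%:M x x.
  by rewrite -(nr_frame dot_norm on) frame_coords.
have Trange := ev_compression dot_norm on h_sym h_range.
rewrite -(@ler_pXn2r _ 2) ?nnegrE ?nr_ge0 ?mulr_ge0 ?nr_ge0//.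
rewrite exprMn nu (op_poly_frame h_sym sph spu) (nr_frame dot_norm on).
have -> : mpol r T = Fn (horner r) T by rewrite mpolE.
rewrite bf_mul bf_mulr mulmx1 FnM bf_calc (bf1 T) mulr_sumr.
apply: ler_sum => i _; rewrite ler_wpM2r ?weight_ge0// -expr2.
rewrite -real_normK ?num_real// lerXn2r ?nnegrE//; apply: rc.
exact: Trange.
Qed.

Lemma nr_lim0 u : (forall e, 0 < e -> nr u <= e) -> u = 0.
Proof.
move=> small; apply/eqP; rewrite -nr_eq0; apply/eqP/le_anti.
rewrite nr_ge0 andbT; apply/ler_addgt0Pr => e e0.
by rewrite add0r small.
Qed.

(** Polynomials approximating [g] to [1 / (n + 1)] on [[a, b]] give a Cauchy sequence at each
    vector. The bound on the limit holds for every approximating [p], and not just for the chosen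
    sequence. *)
Lemma limit_op g : {within `[a, b], continuous g} ->
  exists A : {linear H -> H}, forall p c, 0 <= c ->
    (forall x, a <= x <= b -> `|p.[x] - g x| <= c) ->
    forall u, nr (op_poly p h u - A u) <= c * nr u.
Proof.
move=> gc; pose d (n : nat) : R := n.+1%:R^-1.
have d0 n : 0 < d n by rewrite invr_gt0.
have /choice[P PP] n := weierstrass gc (d0 n).
have d_small e : 0 < e -> exists N, forall n, (N <= n)%N -> d n <= e.
  move=> e0; exists (Num.truncn e^-1) => n Nn.
  rewrite /d -[e]invrK lef_pV2 ?posrE ?invr_gt0//.
  apply: ltW; apply: lt_le_trans (truncnS_gt _) _.
  by rewrite ler_nat.
have close p c : 0 <= c -> (forall x, a <= x <= b -> `|p.[x] - g x| <= c) ->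
    forall n u, nr (op_poly p h u - op_poly (P n) h u) <= (c + d n) * nr u.
  move=> c0 pc n u; rewrite -op_polyB; apply: op_poly_range_bound.
    by rewrite addr_ge0// ltW.
  move=> x xab; rewrite hornerD hornerN.
  have -> : p.[x] - (P n).[x] = (p.[x] - g x) - ((P n).[x] - g x) by ring.
  by apply: le_trans (ler_normB _ _) _; rewrite lerD ?pc ?PP.
have cvg_P u : cvg ((fun n => op_poly (P n) h u) @ \oo).
  apply/cauchy_cvgP/cauchy_ballP => e e0.
  have eE : e = (complex.Re e)%:C by rewrite RRe_real// gtr0_real.
  have r0 : 0 < complex.Re e by rewrite -(ltcR 0) -eE.
  have nu : 0 < 2 * (nr u + 1) by rewrite mulr_gt0// ltr_wpDl// nr_ge0.
  have [N NP] := d_small _ (divr_gt0 r0 nu).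
  pose tail := [set op_poly (P n) h u | n in [set n | (N <= n)%N]].
  exists (tail, tail) => /=.
    by split; exists N => // n /= Nn; exists n.
  move=> [_ _] /= [[n /= Nn <-] [m /= Nm <-]]; rewrite -ball_normE /ball_/= -nrE eE ltcR.
  apply: le_lt_trans (close _ _ (ltW (d0 n)) (PP n) m u) _.
  have h1 := NP n Nn; have h2 := NP m Nm.
  apply: (@le_lt_trans _ _ (2 * (complex.Re e / (2 * (nr u + 1))) * nr u)).
    by rewrite ler_wpM2r ?nr_ge0//; lra.
  have -> : 2 * (complex.Re e / (2 * (nr u + 1))) * nr u =
    complex.Re e * (nr u / (nr u + 1)).
    by field; rewrite gt_eqF// ltr_wpDl// nr_ge0.
  by rewrite gtr_pMr// ltr_pdivrMr ?mul1r ?ltrDl// ltr_wpDl// nr_ge0.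
pose L u := lim ((fun n => op_poly (P n) h u) @ \oo).
have LP n u : nr (op_poly (P n) h u - L u) <= 2 * d n * nr u.
  apply/ler_addgt0Pr => e e0.
  have /cvgrPdist_lt/(_ e%:C) := cvg_P u.
  rewrite (ltcR 0) => /(_ e0)[N _ NP].
  pose m := maxn N n.
  have := NP m (leq_maxl _ _); rewrite /= -nrE ltcR => /ltW h1.
  have h2 := close _ _ (ltW (d0 n)) (PP n) m u.
  have h3 : d m <= d n by rewrite /d lef_pV2 ?posrE// ler_nat ltnS leq_maxr.
  have -> : op_poly (P n) h u - L u = (op_poly (P n) h u - op_poly (P m) h u)
      - (L u - op_poly (P m) h u) by rewrite opprB addrA subrK.
  apply: le_trans (nrB _ _) _; apply: lerD => //.
  by apply: le_trans h2 _; rewrite ler_wpM2r ?nr_ge0//; lra.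
have linL : linear L.
  move=> z u v; apply/eqP; rewrite -subr_eq0; apply/eqP/nr_lim0 => e e0.
  pose K := 2 * (nr (z *: u + v) + cabs z * nr u + nr v) + 1.
  have K0 : 0 < K.
    by rewrite ltr_wpDl// mulr_ge0// !addr_ge0 ?mulr_ge0 ?nr_ge0 ?cabs_ge0.
  have [N /(_ N (leqnn N)) dN] := d_small _ (divr_gt0 e0 K0).
  have h1 := LP N (z *: u + v); have h2 := LP N u; have h3 := LP N v.
  have -> : L (z *: u + v) - (z *: L u + L v) =
      z *: (op_poly (P N) h u - L u) + (op_poly (P N) h v - L v)
      - (op_poly (P N) h (z *: u + v) - L (z *: u + v)).
    by rewrite op_poly_is_linear scalerBr [X in _ = X - _]addrACA -opprD
      subr_sub_cancel.
  apply: le_trans (nrB _ _) _; apply: le_trans (lerD (nrD _ _) (lexx _)) _.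
  rewrite nrZ; have h4 := ler_wpM2l (cabs_ge0 z) h2.
  apply: le_trans (lerD (lerD h4 h3) h1) _.
  apply: (@le_trans _ _ (d N * K)); last by rewrite -ler_pdivlMr.
  by have := d0 N; rewrite /K; lra.
pose A : {linear H -> H} := HB.pack L (GRing.isLinear.Build _ _ _ _ L linL).
exists A => p c c0 pc u; rewrite /A /=.
apply/ler_addgt0Pr => e e0.
have K0 : 0 < 3 * (nr u + 1) by rewrite mulr_gt0// ltr_wpDl// nr_ge0.
have [N /(_ N (leqnn N)) dN] := d_small _ (divr_gt0 e0 K0).
have -> : op_poly p h u - L u = (op_poly p h u - op_poly (P N) h u)
  + (op_poly (P N) h u - L u) by rewrite addrA subrK.
apply: le_trans (nrD _ _) _.
apply: le_trans (lerD (close p c c0 pc N u) (LP N u)) _.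
have : d N * (3 * (nr u + 1)) <= e by rewrite -ler_pdivlMr.
by have := d0 N; have := nr_ge0 u; lra.
Qed.

(** For [x] outside [[a, b]] the function [1 / (y - x)] is continuous there, and [limit_op] turns it
    into a bounded inverse of [h - x]. Approximation on [[a, b]] thus implies the approximation on
    the spectrum demanded by [is_cfc]. *)
Lemma real_spectrum_range x : op_spectrum h x%:C -> a <= x <= b.
Proof.
move=> sx; apply: contrapT => xab; apply: sx.
have xN y : a <= y <= b -> y - x != 0.
  by move=> yab; apply/eqP => /subr0_eq yx; apply: xab; rewrite -yx.
pose g y := (y - x)^-1.
have gc : {within `[a, b], continuous g}.
  apply: continuous_in_subspaceT => y; rewrite inE/= in_itv/= => yab.
  apply: cvgV; first exact: xN.
  by apply: cvgB; [exact: cvg_id|exact: cvg_cst].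
have [A AP] := limit_op gc.
have [c c0 cP] : exists2 c, 0 <= c & forall y, a <= y <= b -> `|y - x| <= c.
  exists (`|a| + `|b| + `|x|) => [|y /andP[ay yb]]; first by rewrite !addr_ge0.
  have := ler_norm (- a); have := ler_norm b; have := normr_ge0 b.
  have := normr_ge0 a; have := ler_norm x; have := ler_norm (- x).
  by rewrite !normrN ler_norml => *; apply/andP; split; lra.
have near_inverse e : 0 < e -> exists p, [/\ forall y, a <= y <= b ->
    `|p.[y] - g y| <= e &
    forall y, a <= y <= b -> `|(p * ('X - x%:P) - 1%:P).[y]| <= e * c].
  move=> e0; have [p pP] := weierstrass gc e0; exists p; split=> // y yab.
  rewrite !(hornerD, hornerM, hornerN, hornerC, hornerX).
  have -> : p.[y] * (y - x) - 1 = (p.[y] - g y) * (y - x).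
    by rewrite mulrBl /g mulVf// xN.
  by rewrite normrM ler_pM ?pP ?cP.
have opX p u : op_poly (p * ('X - x%:P)) h u = op_poly p h (h u - x%:C *: u).
  rewrite op_polyM op_polyB op_polyC; congr (op_poly p h (_ - _)).
  by rewrite -['X]mul1r op_polyMX op_polyC rmorph1 scale1r.
have op1 u : op_poly 1%:P h u = u by rewrite op_polyC rmorph1 scale1r.
have opXC p u : op_poly (p * ('X - x%:P)) h u =
    h (op_poly p h u) - x%:C *: op_poly p h u.
  rewrite mulrC op_polyM op_polyB op_polyC; congr (_ - _).
  by rewrite -['X]mul1r op_polyMX op_polyC rmorph1 scale1r.
have [hc _] := h_sa; have [B B0 hB] := bounded_of_continuous hc.
exists A; split.
- have [p pP] := weierstrass gc ltr01.
  have [K K0 pK] := op_poly_bounded p (ltW B0) hB.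
  apply: (@continuous_of_bounded _ _ _ (K + 1)) => u.
  have -> : A u = op_poly p h u - (op_poly p h u - A u) by rewrite opprB addrC subrK.
  apply: le_trans (nrB _ _) _; rewrite mulrDl lerD//.
  exact: AP.
- move=> u; apply/eqP; rewrite -subr_eq0; apply/eqP/nr_lim0 => e e0.
  set v := h u - x%:C *: u.
  pose K := c * nr u + nr v + 1.
  have K0 : 0 < K by rewrite ltr_wpDl// addr_ge0 ?mulr_ge0 ?nr_ge0.
  have eK : 0 < e / K by rewrite divr_gt0.
  have [p [p1 p2]] := near_inverse _ eK.
  have ecK : 0 <= e / K * c by rewrite mulr_ge0// ltW.
  have h1 := op_poly_range_bound ecK p2 u.
  have h2 := AP p _ (ltW eK) p1 v.
  move: h1; rewrite op_polyB op1 opX -/v => h1.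
  have -> : A v - u = (op_poly p h v - u) - (op_poly p h v - A v).
    by rewrite subr_sub_cancel.
  apply: le_trans (nrB _ _) _; apply: le_trans (lerD h1 h2) _.
  have -> : e / K * c * nr u + e / K * nr v = e * (c * nr u + nr v) / K.
    by field; rewrite gt_eqF.
  rewrite ler_pdivrMr// ler_wpM2l ?(ltW e0)//.
  by rewrite /K lerDl.
move=> u; apply/eqP; rewrite -subr_eq0; apply/eqP/nr_lim0 => e e0.
pose K := c * nr u + (B + `|x|) * nr u + 1.
have K0 : 0 < K.
  by rewrite ltr_wpDl// addr_ge0 ?mulr_ge0 ?nr_ge0// addr_ge0// ltW.
have eK : 0 < e / K by rewrite divr_gt0.
have [p [p1 p2]] := near_inverse _ eK.
have ecK : 0 <= e / K * c by rewrite mulr_ge0// ltW.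
have h1 := op_poly_range_bound ecK p2 u.
have h2 := AP p _ (ltW eK) p1 u.
move: h1; rewrite op_polyB op1 opXC => h1.
set w := op_poly p h u - A u in h2.
have -> : h (A u) - x%:C *: A u - u =
    (h (op_poly p h u) - x%:C *: op_poly p h u - u) - (h w - x%:C *: w).
  have -> : h w - x%:C *: w = (h (op_poly p h u) - x%:C *: op_poly p h u)
      - (h (A u) - x%:C *: A u).
    rewrite /w linearB scalerBr; move: (h _) (h _) (_ *: _) (_ *: _) => u1 u2 u3 u4.
    by rewrite opprD addrACA -opprD.
  by rewrite subr_sub_cancel.
apply: le_trans (nrB _ _) _.
have h3 : nr (h w - x%:C *: w) <= (B + `|x|) * (e / K * nr u).
  apply: le_trans (nrB _ _) _; rewrite nrZ cabs_real.
  apply: (@le_trans _ _ ((B + `|x|) * nr w)); first by rewrite mulrDl lerD2r hB.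
  by rewrite ler_wpM2l// addr_ge0// ltW.
apply: le_trans (lerD h1 h3) _.
have -> : e / K * c * nr u + (B + `|x|) * (e / K * nr u) =
  e * (c * nr u + (B + `|x|) * nr u) / K by field; rewrite gt_eqF.
rewrite ler_pdivrMr// ler_wpM2l ?(ltW e0)//.
by rewrite /K lerDl.
Qed.

Hypothesis H_neq0 : exists v : H, nr v != 0.

(** As [cfc] is a choice made by [get], uniqueness is required. The polynomials witnessing another
    candidate are close to [g] on the spectrum only, so they are compared through
    [op_poly_small]. *)
Lemma cfc_approx g : {within `[a, b], continuous g} -> forall p c, 0 <= c ->
  (forall x, a <= x <= b -> `|p.[x] - g x| <= c) ->
  forall u, nr (op_poly p h u - cfc g h u) <= c * nr u.
Proof.
move=> gc; have [A AP] := limit_op gc.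
have A_cfc : is_cfc g h A.
  move=> e e0; have [p pP] := weierstrass gc e0; exists p; split=> [x|u].
    by move=> /real_spectrum_range; exact: pP.
  rewrite -!nrE -rmorphM lecR; apply: AP => //; exact: ltW.
have := getPex (ex_intro _ A A_cfc); rewrite -/(cfc g h).
move: (cfc g h) => B B_cfc p c c0 pc u.
suff -> : B u = A u by exact: AP.
apply/eqP; rewrite -subr_eq0; apply/eqP/nr_lim0 => e e0.
have K0 : 0 < 4 * (nr u + 1) by rewrite mulr_gt0// ltr_wpDl// nr_ge0.
pose r := e / (4 * (nr u + 1)); have r0 : 0 < r by rewrite divr_gt0.
have [q [q1 q2]] := B_cfc r r0.
have [q' q'P] := weierstrass gc r0.
have h1 := AP q' r (ltW r0) q'P u.
have h2 : nr (op_poly q h u - B u) <= r * nr u.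
  by rewrite -lecR rmorphM/= !nrE; exact: q2.
have h3 : nr (op_poly (q' - q) h u) <= 2 * r * nr u.
  apply: (op_poly_small dot_norm h_sa H_neq0) => x sx.
  rewrite hornerD hornerN.
  have -> : q'.[x] - q.[x] = (q'.[x] - g x) - (q.[x] - g x) by ring.
  apply: le_trans (ler_normB _ _) _.
  by have := q1 x sx; have := q'P x (real_spectrum_range sx); lra.
have -> : B u - A u = (op_poly q' h u - A u) - (op_poly q h u - B u)
    - op_poly (q' - q) h u.
  by rewrite op_polyB addrAC !subr_sub_cancel.
apply: le_trans (nrB _ _) _; apply: le_trans (lerD (nrB _ _) h3) _.
have : r * (4 * (nr u + 1)) = e by rewrite /r divfK// gt_eqF.
by have := nr_ge0 u; nra.
Qed.

End ContinuousCalculus.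

Section OperatorConvexity.
Context {R : realType}.
Local Notation C := R[i].

Lemma bf_calc_approx k (T : selfadj R k) (g : R -> R) (p : {poly R}) a b c x :
  (forall i, a <= ev T i <= b) ->
  (forall y, a <= y <= b -> `|p.[y] - g y| <= c) ->
  `|bf (mpol p T) x x - bf (mx_calc g T) x x| <= c * bf 1%:M x x.
Proof.
move=> Tab pc.
have -> : bf (mpol p T) x x - bf (mx_calc g T) x x =
    \sum_i (p.[ev T i] - g (ev T i)) * weight T x i.
  under [RHS]eq_bigr do rewrite mulrBl.
  by rewrite sumrB mpolE; congr (_ - _); exact: bf_calc.
rewrite (bf1 T) mulr_sumr.
apply: le_trans (ler_norm_sum _ _ _) _; apply: ler_sum => i _.
rewrite normrM [`|weight _ _ _|]ger0_norm ?weight_ge0//.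
by rewrite ler_wpM2r ?weight_ge0// pc.
Qed.

Lemma mix_le_of_close (s d x1 x2 x3 B1 B2 B3 e : R) : 0 <= s <= 1 ->
  `|x1 + B1| <= d -> `|x2 + B2| <= d -> `|x3 + B3| <= d ->
  s * B1 + (1 - s) * B2 <= B3 -> 2 * d <= e ->
  x3 <= s * x1 + (1 - s) * x2 + e.
Proof.
rewrite !ler_norml => /andP[? ?] /andP[? ?] /andP[? ?] /andP[? ?] ? ?; nra.
Qed.

Section Fixed.
Context {H : completeNormedModType C}.
Variable dot : {dot H for (@Num.conj C)}.
Hypothesis dot_norm : is_hilbert_dot dot.
Local Notation rd := (re_dot dot).
Implicit Types (u v : H) (h : {linear H -> H}).

Lemma op_convE s h1 h2 u :
  op_conv s h1 h2 u = s%:C *: h1 u + (1 - s)%:C *: h2 u.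
Proof. by []. Qed.

Lemma op_conv_selfadjoint s h1 h2 : bounded_selfadjoint dot h1 ->
  bounded_selfadjoint dot h2 -> bounded_selfadjoint dot (op_conv s h1 h2).
Proof.
move=> [c1 s1] [c2 s2].
have [B1 B10 h1B] := bounded_of_continuous c1.
have [B2 B20 h2B] := bounded_of_continuous c2.
split=> [|u v].
  apply: (@continuous_of_bounded _ _ _ (`|s| * B1 + `|1 - s| * B2)) => u.
  rewrite op_convE; apply: le_trans (nrD _ _) _; rewrite !nrZ !cabs_real mulrDl.
  by rewrite lerD// -mulrA ler_wpM2l.
have cr (z : R) : Num.conj z%:C = z%:C by apply/CrealP; rewrite complex_real.
rewrite !op_convE dotDl dotDr !dotZl !dotZr !cr.
by rewrite s1 s2.
Qed.

Lemma rd_op_conv s h1 h2 u :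
  rd (op_conv s h1 h2 u) u = s * rd (h1 u) u + (1 - s) * rd (h2 u) u.
Proof. by rewrite op_convE rdDl !rdZl. Qed.

(** [op_le] compares complex numbers, so it includes the vanishing of an imaginary part; this passes
    from polynomials in [h] to the limit. *)
Lemma cfc_real_form h (a b : R) (g : R -> R) : bounded_selfadjoint dot h ->
  (forall u, a * nr u ^+ 2 <= rd (h u) u <= b * nr u ^+ 2) ->
  (exists v : H, nr v != 0) -> {within `[a, b], continuous g} ->
  forall u, complex.Im (dot (cfc g h u) u) = 0.
Proof.
move=> sh hab H0 gc u.
apply/eqP; rewrite -normr_eq0; apply/eqP/le_anti; rewrite normr_ge0 andbT.
apply/ler_addgt0Pr => e e0; rewrite add0r.
have K0 : 0 < nr u ^+ 2 + 1 by rewrite ltr_wpDl// sqr_ge0.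
have r0 : 0 < e / (nr u ^+ 2 + 1) by rewrite divr_gt0.
have [p pP] := weierstrass gc r0.
have h1 := cfc_approx dot_norm sh hab H0 gc (ltW r0) pP u.
have Imp : complex.Im (dot (op_poly p h u) u) = 0.
  have : dot (op_poly p h u) u = Num.conj (dot (op_poly p h u) u).
    by rewrite -dotC -(op_poly_symmetric p (proj2 sh)).
  by case: (dot _ _) => x y [] /=; lra.
have -> : complex.Im (dot (cfc g h u) u) =
    - complex.Im (dot (op_poly p h u - cfc g h u) u).
  rewrite dotBl; move: Imp.
  by case: (dot _ _) => x y /= ->; case: (dot _ _) => z w /=; ring.
rewrite normrN; apply: le_trans (Im_dot_abs dot_norm _ _) _.
apply: le_trans (ler_wpM2r (nr_ge0 _) h1) _.
rewrite -mulrA -expr2 mulrAC ler_pdivrMr// ler_wpM2l ?(ltW e0)//.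
by rewrite lerDl.
Qed.

End Fixed.

Lemma compression_conv (H : completeNormedModType C)
    (dot : {dot H for (@Num.conj C)}) k e s (h1 h2 : {linear H -> H})
    (s1 : symmetric_op dot h1) (s2 : symmetric_op dot h2)
    (s3 : symmetric_op dot (op_conv s h1 h2)) :
  compression k e s3 = conv s (compression k e s1) (compression k e s2).
Proof.
apply: val_inj; apply/matrixP => i j; rewrite !mxE op_convE.
by rewrite dotDl !dotZl.
Qed.

Lemma operator_convex_of_inverse_concave (I : set R) (f : R -> R) :
  is_interval I -> (forall x, I x -> 0 < f x) -> {within I, continuous f} ->
  (forall n, inverse_concave I f (n := n)) ->
  operator_convex I (fun x => - (f x)^-1).
Proof.
move=> I_itv f_gt0 f_cont ic; set g := fun x => - (f x)^-1.
have g_cont : {within I, continuous g}.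
  apply/subspace_continuousP => x Ix; apply: cvgN; apply: cvgV.
    by rewrite gt_eqF// f_gt0.
  by have /subspace_continuousP := f_cont; apply.
split=> // H dot dot_norm h1 h2 sa1 sa2 sp1 sp2 s s01 u.
(* On the zero space spectra are empty and yield no segment in [I], but the inequality is
   trivial. *)
have [H0|H0] := pselect (exists v : H, nr v != 0); last first.
  have -> : u = 0.
    by apply: contrapT => /eqP; rewrite -nr_eq0 => u0; apply: H0; exists u.
  by rewrite linear0r.
set h3 := op_conv s h1 h2.
have sa3 : bounded_selfadjoint dot h3 by exact: op_conv_selfadjoint.
have [a1 [b1 [sa1' sb1 r1]]] := numerical_range dot_norm sa1 H0.
have [a2 [b2 [sa2' sb2 r2]]] := numerical_range dot_norm sa2 H0.
have inI (J : set R) (x : R) : real_set J x%:C -> J x.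
  by move=> [y Jy [<-]].
have Ia1 := inI _ _ (sp1 _ sa1'); have Ib1 := inI _ _ (sp1 _ sb1).
have Ia2 := inI _ _ (sp2 _ sa2'); have Ib2 := inI _ _ (sp2 _ sb2).
pose a := Num.min a1 a2; pose b := Num.max b1 b2.
have Ia : I a by rewrite /a; case: leP.
have Ib : I b by rewrite /b; case: leP.
have range1 v : a * nr v ^+ 2 <= re_dot dot (h1 v) v <= b * nr v ^+ 2.
  have /andP[l r] := r1 v; have n2 := sqr_ge0 (nr v).
  apply/andP; split; first by apply: le_trans l; rewrite ler_wpM2r// ge_min lexx.
  by apply: le_trans r _; rewrite ler_wpM2r// le_max lexx.
have range2 v : a * nr v ^+ 2 <= re_dot dot (h2 v) v <= b * nr v ^+ 2.
  have /andP[l r] := r2 v; have n2 := sqr_ge0 (nr v).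
  apply/andP; split.
    by apply: le_trans l; rewrite ler_wpM2r// ge_min lexx orbT.
  by apply: le_trans r _; rewrite ler_wpM2r// le_max lexx orbT.
have /andP[s0 s1] := s01.
have range3 v : a * nr v ^+ 2 <= re_dot dot (h3 v) v <= b * nr v ^+ 2.
  rewrite /h3 rd_op_conv; have /andP[] := range1 v; have /andP[] := range2 v.
  move: (a * _) (b * _) (re_dot _ _ _) (re_dot _ _ _) => x y z w *.
  by apply/andP; split; nra.
have gab : {within `[a, b], continuous g}.
  apply: continuous_subspaceW g_cont => x; rewrite /= in_itv/= => xab.
  exact: I_itv Ia Ib _ xab.
have Im1 := cfc_real_form dot_norm sa1 range1 H0 gab u.
have Im2 := cfc_real_form dot_norm sa2 range2 H0 gab u.
have Im3 := cfc_real_form dot_norm sa3 range3 H0 gab u.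
rewrite lecE; apply/andP; split.
  rewrite dotBl op_convE dotDl !dotZl.
  move: Im1 Im2 Im3; case: (dot _ _) => x1 y1; case: (dot _ _) => x2 y2.
  case: (dot _ _) => x3 y3 /= -> -> ->.
  by apply/eqP; ring.
rewrite [X in _ <= X](_ : _ = s * re_dot dot (cfc g h1 u) u
  + (1 - s) * re_dot dot (cfc g h2 u) u - re_dot dot (cfc g h3 u) u); last first.
  by rewrite -rd_op_conv -rdNl -rdDl.
rewrite subr_ge0; apply/ler_addgt0Pr => e e0.
(* Each form costs [2 * c * nr u ^+ 2], once for the operator and once for its compression. The
   outer factor 2 counts the left side of the inequality and the convex combination on the right. *)
have [c c0 cE] : exists2 c : R, 0 < c & 2 * (2 * c * nr u ^+ 2) <= e.
  have K0 : 0 < 4 * (nr u ^+ 2 + 1) by rewrite mulr_gt0// ltr_wpDl// sqr_ge0.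
  exists (e / (4 * (nr u ^+ 2 + 1))); first by rewrite divr_gt0.
  have -> : 2 * (2 * (e / (4 * (nr u ^+ 2 + 1))) * nr u ^+ 2) =
      e * (nr u ^+ 2 / (nr u ^+ 2 + 1)).
    by field; rewrite gt_eqF// ltr_wpDl// sqr_ge0.
  rewrite ger_pMr// ler_pdivrMr ?ltr_wpDl ?sqr_ge0// mul1r lerDl//.
have [p pP] := weierstrass gab c0.
(* A common frame for the three operators: compression to a fixed frame is linear in the operator,
   so [h3] compresses to the [conv] of the other two compressions. *)
have [k [fr [on sp]]] := gram_schmidt dot_norm
  (u :: [seq iter i h1 u | i <- iota 0 (size p)]
   ++ [seq iter i h2 u | i <- iota 0 (size p)]
   ++ [seq iter i h3 u | i <- iota 0 (size p)]).
have spu : spanned dot k fr u by apply: sp; rewrite mem_head.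
have spi h (hin : [\/ h = h1, h = h2 | h = h3]) i : (i < size p)%N ->
    spanned dot k fr (iter i h u).
  move=> ip; have mi : i \in iota 0 (size p) by rewrite mem_iota.
  apply: sp; rewrite inE !mem_cat; apply/orP; right.
  case: hin => ->; apply/or3P; [apply: Or31|apply: Or32|apply: Or33];
    exact: map_f mi.
have key h (sah : bounded_selfadjoint dot h) (hin : [\/ h = h1, h = h2 | h = h3])
    (hr : forall v, a * nr v ^+ 2 <= re_dot dot (h v) v <= b * nr v ^+ 2) :
    `|re_dot dot (cfc g h u) u + bf (Fn (fun x => (f x)^-1)
        (compression k fr (proj2 sah))) (coords dot k fr u) (coords dot k fr u)|
      <= 2 * c * nr u ^+ 2.
  have sh := proj2 sah.
  have h1' := cfc_approx dot_norm sah hr H0 gab (ltW c0) pP u.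
  have h2' := bf_calc_approx (coords dot k fr u)
    (ev_compression dot_norm on (proj2 sah) hr) pP.
  rewrite -(rd_op_poly on (proj2 sah) (spi h hin) spu) in h2'.
  rewrite -(nr_frame dot_norm on) (frame_coords spu) in h2'.
  have -> : bf (Fn (fun x => (f x)^-1) (compression k fr (proj2 sah)))
      (coords dot k fr u) (coords dot k fr u) =
    - bf (mx_calc g (compression k fr (proj2 sah)))
      (coords dot k fr u) (coords dot k fr u).
    rewrite [LHS]bf_calc [X in _ = - X]bf_calc -sumrN.
    by apply: eq_bigr => i _; rewrite /g mulNr opprK.
  have h3' : `|re_dot dot (op_poly p h u) u - re_dot dot (cfc g h u) u| <= c * nr u ^+ 2.
    rewrite -rdNl -rdDl; apply: le_trans (rd_abs dot_norm _ _) _.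
    by rewrite expr2 mulrA ler_wpM2r ?nr_ge0.
  move: h2' h3'; move: (re_dot _ _ _) (re_dot _ _ _) (bf _ _ _) (nr u ^+ 2) => x y z w.
  by rewrite !ler_norml => /andP[? ?] /andP[? ?]; apply/andP; split; lra.
have k1 := key h1 sa1 (Or31 _ _ erefl) range1.
have k2 := key h2 sa2 (Or32 _ _ erefl) range2.
have k3 := key h3 sa3 (Or33 _ _ erefl) range3.
have inIab n (T : selfadj R n) : (forall i, a <= ev T i <= b) -> forall i, I (ev T i).
  by move=> Tab i; exact: I_itv Ia Ib _ (Tab i).
have := ic k _ _ (inIab _ _ (ev_compression dot_norm on (proj2 sa1) range1))
  (inIab _ _ (ev_compression dot_norm on (proj2 sa2) range2))
  (coords dot k fr u) s s01.
rewrite -(compression_conv k fr (proj2 sa1) (proj2 sa2) (proj2 sa3)) => icu.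
exact: (mix_le_of_close s01 k1 k2 k3 icu cE).
Qed.

End OperatorConvexity.

(** * Euclidean spaces as Hilbert spaces *)

Section RealEstimates.
Context {R : realType}.

Lemma close_of_close (x y z d e : R) : `|x - y| <= d -> `|x - z| <= d ->
  2 * d <= e -> `|z - y| <= e.
Proof.
rewrite !ler_norml => /andP[? ?] /andP[? ?] ?; apply/andP; split; lra.
Qed.

Lemma mix_opp (s x1 x2 x3 y1 y2 y3 : R) : x1 = - y1 -> x2 = - y2 -> x3 = - y3 ->
  0 <= s * x1 + (1 - s) * x2 + - x3 -> s * y1 + (1 - s) * y2 <= y3.
Proof. by move=> -> -> ->; lra. Qed.

End RealEstimates.

(** An alias of row vectors, which already carry the maximum norm, so that it can receive the norm
    of the inner product. *)
Definition euclid (R : realType) (n : nat) := 'rV[R[i]]_n.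

Section EuclideanSpace.
Context {R : realType} {n : nat}.
Local Notation C := R[i].
Local Notation V := (euclid R n).

HB.instance Definition _ := GRing.Lmodule.copy V 'rV[C]_n.

Definition euclid_norm (u : V) : C := sqrtC (dotmx (u : 'rV[C]_n) u).

Fact euclid_normD (u v : V) : euclid_norm (u + v) <= euclid_norm u + euclid_norm v.
Proof.
by have [le _] := triangle_lerif (@dotmx C n) (u : 'rV[C]_n) (v : 'rV[C]_n).
Qed.

Fact euclid_normZ (z : C) (u : V) : euclid_norm (z *: u) = `|z| * euclid_norm u.
Proof.
rewrite /euclid_norm [dotmx _ _](dnormZ (@dotmx C n) z u).
by rewrite sqrtCM ?nnegrE ?exprn_ge0// sqrCK.
Qed.

Fact euclid_norm0 (u : V) : euclid_norm u = 0 -> u = 0.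
Proof. by move=> /eqP; rewrite sqrt_dnorm_eq0 => /eqP. Qed.

HB.instance Definition _ :=
  Lmodule_isNormed.Build C V euclid_normD euclid_normZ euclid_norm0.

Lemma euclid_sqr_norm (u : V) : `|u| ^+ 2 = dotmx (u : 'rV[C]_n) u.
Proof. exact: sqrtCK. Qed.

Let en (u : V) : R := complex.Re `|u|.

Let enE u : (en u)%:C = `|u|.
Proof. by rewrite /en RRe_real// normr_real. Qed.

Lemma euclid_norm_sqr_sum (u : V) :
  complex.Re `|u| ^+ 2 = \sum_i cabs ((u : 'rV[C]_n) 0 i) ^+ 2.
Proof.
apply: complexI; rewrite -/(en u) rmorphXn/= enE.
rewrite euclid_sqr_norm dotmxE mxE rmorph_sum; apply: eq_bigr => i _.
by rewrite /= cabs_sqr !mxE.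
Qed.

Let en_ge0 u : 0 <= en u. Proof. by rewrite -ler0c enE. Qed.

Lemma euclid_coord_le (u : V) i : cabs ((u : 'rV[C]_n) 0 i) <= complex.Re `|u|.
Proof.
rewrite -(@ler_pXn2r _ 2) ?nnegrE ?cabs_ge0 ?en_ge0// euclid_norm_sqr_sum.
by rewrite (bigD1 i)//= lerDl sumr_ge0// => j _; rewrite sqr_ge0.
Qed.

Lemma euclid_norm_le_nm (u : V) : complex.Re `|u| <= nm (u : 'rV[C]_n).
Proof.
rewrite -(@ler_pXn2r _ 2) ?nnegrE ?nm_ge0 ?en_ge0// euclid_norm_sqr_sum.
rewrite /nm big_ord1 expr2 mulr_suml; apply: ler_sum => i _.
rewrite expr2 ler_wpM2l ?cabs_ge0// (bigD1 i)//= lerDl sumr_ge0// => j _.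
exact: cabs_ge0.
Qed.

Let cabs_le (z : C) : cabs z <= `|complex.Re z| + `|complex.Im z|.
Proof.
rewrite {1}[z]complexE; apply: le_trans (cabsD _ _) _.
rewrite cabsM !cabs_real (_ : cabs 'i%C = 1) ?mul1r//.
by rewrite /cabs normc_def /= expr0n /= expr1n add0r sqrtr1.
Qed.

Let cabs_Im (z : C) : `|complex.Im z| <= cabs z.
Proof.
have := cabs_Re ('i%C * z); rewrite cabsM (_ : cabs 'i%C = 1); last first.
  by rewrite /cabs normc_def /= expr0n /= expr1n add0r sqrtr1.
by case: z => x y /=; rewrite mul1r mul0r sub0r mul1r normrN.
Qed.

Let Re_sub (u v : V) j : complex.Re (((u - v : V) : 'rV[C]_n) 0 j) =
  complex.Re ((u : 'rV[C]_n) 0 j) - complex.Re ((v : 'rV[C]_n) 0 j).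
Proof. by rewrite !mxE ReD ReN. Qed.

Let Im_sub (u v : V) j : complex.Im (((u - v : V) : 'rV[C]_n) 0 j) =
  complex.Im ((u : 'rV[C]_n) 0 j) - complex.Im ((v : 'rV[C]_n) 0 j).
Proof. by rewrite !mxE; case: (u 0 j) => ? ?; case: (v 0 j) => ? ?. Qed.

Lemma euclid_complete (F : set_system V) : ProperFilter F -> cauchy F -> cvg F.
Proof.
move=> FF /cauchy_ballP Fc.
have coord_cvg (phi : V -> R) : (forall u v, `|phi u - phi v| <= en (u - v)) ->
    cvg (phi @ F).
  move=> philip; apply/cauchy_cvgP/cauchy_ballP => e e0.
  have [|[P Q] /= [FP FQ] PQ] := Fc e%:C; first by rewrite (ltcR 0).
  exists (phi @` P, phi @` Q) => /=.
    by split; [apply: filterS FP|apply: filterS FQ] => u Pu; exists u.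
  move=> [_ _] /= [[u Pu <-] [v Qv <-]]; rewrite /ball/=.
  apply: le_lt_trans (philip _ _) _.
  have := PQ (u, v) (conj Pu Qv); rewrite -ball_normE /ball_/=.
  by rewrite -enE ltcR.
have re_cvg i : cvg ((fun u : V => complex.Re ((u : 'rV[C]_n) 0 i)) @ F).
  apply: coord_cvg => u v; apply: le_trans (euclid_coord_le (u - v) i).
  rewrite -Re_sub; exact: cabs_Re.
have im_cvg i : cvg ((fun u : V => complex.Im ((u : 'rV[C]_n) 0 i)) @ F).
  apply: coord_cvg => u v; apply: le_trans (euclid_coord_le (u - v) i).
  rewrite -Im_sub; exact: cabs_Im.
pose l : 'rV[C]_n := \row_i
  Complex (lim ((fun u : V => complex.Re ((u : 'rV[C]_n) 0 i)) @ F))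
          (lim ((fun u : V => complex.Im ((u : 'rV[C]_n) 0 i)) @ F)).
apply/cvg_ex; exists (l : V); apply/cvgrPdist_lt => e e0.
have eE : e = (complex.Re e)%:C by rewrite RRe_real// gtr0_real.
have r0 : 0 < complex.Re e by rewrite -(ltcR 0) -eE.
(* The [n] real and [n] imaginary parts contribute at most [2 * n * r] in all; the added 1 makes
   this less than [Re e], also for [n = 0]. *)
pose r := complex.Re e / (2 * n%:R + 1).
have n1 : 0 < 2 * n%:R + 1 :> R by rewrite ltr_wpDl// mulr_ge0.
have rp : 0 < r by rewrite divr_gt0.
have near_re : \forall u \near F, forall i,
    `|complex.Re (l 0 i) - complex.Re ((u : 'rV[C]_n) 0 i)| < r.
  apply: filter_forall => i; rewrite mxE /=.
  by have /cvgrPdist_lt := re_cvg i; apply.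
have near_im : \forall u \near F, forall i,
    `|complex.Im (l 0 i) - complex.Im ((u : 'rV[C]_n) 0 i)| < r.
  apply: filter_forall => i; rewrite mxE /=.
  by have /cvgrPdist_lt := im_cvg i; apply.
near=> u.
have h1 : forall i, `|complex.Re (l 0 i) - complex.Re ((u : 'rV[C]_n) 0 i)| < r.
  by near: u.
have h2 : forall i, `|complex.Im (l 0 i) - complex.Im ((u : 'rV[C]_n) 0 i)| < r.
  by near: u.
rewrite eE -enE ltcR; apply: le_lt_trans (euclid_norm_le_nm _) _.
apply: (@le_lt_trans _ _ (1%:R * n%:R * (2 * r))).
  apply: nm_le => i j; rewrite ord1; apply: le_trans (cabs_le _) _.
  rewrite (Re_sub (l : V) u) (Im_sub (l : V) u).
  by have := h1 j; have := h2 j; lra.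
have : r * (2 * n%:R + 1) = complex.Re e by rewrite /r divfK// gt_eqF.
by lra.
Unshelve. all: by end_near. Qed.

HB.instance Definition _ := Uniform_isComplete.Build V euclid_complete.

Definition euclid_dot : {dot V for (@Num.conj C)} := @dotmx C n.

Lemma euclid_hilbert : is_hilbert_dot euclid_dot.
Proof. exact: euclid_sqr_norm. Qed.

Definition mx_op_fun (A : 'M[C]_n) (u : V) : V := (u : 'rV[C]_n) *m A.

Lemma mx_op_linear A : linear (mx_op_fun A).
Proof. by move=> z u v; rewrite /mx_op_fun mulmxDl -scalemxAl. Qed.

Definition mx_op A : {linear V -> V} :=
  HB.pack (mx_op_fun A) (GRing.isLinear.Build _ _ _ _ _ (mx_op_linear A)).

Lemma mx_op_continuous A : continuous (mx_op A).
Proof.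
apply: (@continuous_of_bounded _ _ _ (n%:R * nm A)) => u.
apply: le_trans (euclid_norm_le_nm _) _; apply: le_trans (nmM _ _) _.
rewrite mulrAC ler_wpM2r ?nm_ge0// mulrC.
have := @nm_le _ _ _ (u : 'rV[C]_n) (nr u).
rewrite mul1r mulrC; apply => i j; rewrite ord1; exact: euclid_coord_le.
Qed.

Lemma euclid_dotE (u v : V) : euclid_dot u v =
  ((u : 'rV[C]_n) *m (v : 'rV[C]_n) ^t*) 0 0.
Proof. exact: dotmxE. Qed.

Lemma mx_op_selfadjoint (t : selfadj R n) : bounded_selfadjoint euclid_dot (mx_op t).
Proof.
split=> [|u v]; first exact: mx_op_continuous.
by rewrite !euclid_dotE /= /mx_op_fun trC_mul -selfadjP mulmxA.
Qed.

Lemma mx_op_spectrum (t : selfadj R n) : op_spectrum (mx_op t) `<=` mx_spectrum t.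
Proof.
move=> z sz; apply: contrapT => ez; apply: sz.
have tz_unit : (t : 'M[C]_n) - z%:M \in unitmx.
  rewrite -row_free_unit -kermx_eq0; apply: contrapT => k0; apply: ez.
  exact/negP.
exists (mx_op (invmx ((t : 'M[C]_n) - z%:M))); split=> [|u|u].
- exact: mx_op_continuous.
- have -> : mx_op t u - z *: u = (u : 'rV[C]_n) *m ((t : 'M[C]_n) - z%:M).
    by rewrite mulmxBr mul_mx_scalar.
  by rewrite /= /mx_op_fun mulmxK.
- have -> : mx_op t (mx_op (invmx ((t : 'M[C]_n) - z%:M)) u)
      - z *: mx_op (invmx ((t : 'M[C]_n) - z%:M)) u =
    ((u : 'rV[C]_n) *m invmx ((t : 'M[C]_n) - z%:M)) *m ((t : 'M[C]_n) - z%:M).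
    by rewrite mulmxBr mul_mx_scalar.
  by rewrite mulmxKV.
Qed.

Section MatrixCalculus.
Variables (t : selfadj R n) (h : {linear V -> V}).
Hypothesis ht : forall u : V, h u = (u : 'rV[C]_n) *m t.

Lemma mx_op_rd (u : V) : re_dot euclid_dot (h u) u = bf t (u : 'rV[C]_n) u.
Proof. by rewrite /re_dot euclid_dotE ht. Qed.

Lemma mx_op_sa : bounded_selfadjoint euclid_dot h.
Proof.
have [tc ts] := mx_op_selfadjoint t; split=> [|u v].
  by have -> : (h : V -> V) = mx_op t by apply/funext.
by rewrite !ht; exact: ts.
Qed.

Lemma nr_bf1 (u : V) : nr u ^+ 2 = bf 1%:M (u : 'rV[C]_n) u.
Proof.
by rewrite -(rd_nr euclid_hilbert) /re_dot euclid_dotE /bf mulmx1.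
Qed.

Lemma op_poly_mx p (u : V) : op_poly p h u = (u : 'rV[C]_n) *m mpol p t.
Proof.
rewrite /op_poly /mpol /pev mulmx_sumr; apply: eq_bigr => i _.
rewrite -scalemxAr; congr (_ *: _).
elim: (i : nat) => [|k IH]; first by rewrite mulmx1.
by rewrite iterS IH ht /mpow iterS mulmxA.
Qed.

(** Both sides are close to the form of one polynomial. The operator [h] is any one acting as [t],
    so that the lemma also applies to the [op_conv] of two matrix operators. *)
Lemma rd_cfc_mx (a b : R) (g : R -> R) : (0 < n)%N ->
  (forall i, a <= ev t i <= b) -> {within `[a, b], continuous g} ->
  forall u : V, re_dot euclid_dot (cfc g h u) u = bf (mx_calc g t) (u : 'rV[C]_n) u.
Proof.
move=> n0 tab gc u.
have H0 : exists v : V, nr v != 0.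
  exists (const_mx 1 : 'rV[C]_n); rewrite nr_eq0; apply/eqP.
  move=> /rowP/(_ (Ordinal n0)); rewrite !mxE => /eqP.
  by rewrite oner_eq0.
have hr v : a * nr v ^+ 2 <= re_dot euclid_dot (h v) v <= b * nr v ^+ 2.
  by rewrite nr_bf1 mx_op_rd; move: v; apply/ev_rangeP.
apply/eqP; rewrite -subr_eq0 -normr_eq0; apply/eqP/le_anti.
rewrite normr_ge0 andbT; apply/ler_addgt0Pr => e e0; rewrite add0r.
have [c c0 cE] : exists2 c : R, 0 < c & 2 * (c * nr u ^+ 2) <= e.
  have K0 : 0 < 2 * (nr u ^+ 2 + 1) by rewrite mulr_gt0// ltr_wpDl// sqr_ge0.
  exists (e / (2 * (nr u ^+ 2 + 1))); first by rewrite divr_gt0.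
  have -> : 2 * (e / (2 * (nr u ^+ 2 + 1)) * nr u ^+ 2) =
      e * (nr u ^+ 2 / (nr u ^+ 2 + 1)).
    by field; rewrite gt_eqF// ltr_wpDl// sqr_ge0.
  by rewrite ger_pMr// ler_pdivrMr ?ltr_wpDl ?sqr_ge0// mul1r lerDl.
have [p pP] := weierstrass gc c0.
have h1 := cfc_approx euclid_hilbert mx_op_sa hr H0 gc (ltW c0) pP u.
have h2 := bf_calc_approx (u : 'rV[C]_n) tab pP.
have h3 : `|re_dot euclid_dot (op_poly p h u) u - re_dot euclid_dot (cfc g h u) u|
    <= c * nr u ^+ 2.
  rewrite -rdNl -rdDl; apply: le_trans (rd_abs euclid_hilbert _ _) _.
  by rewrite expr2 mulrA ler_wpM2r ?nr_ge0.
have pE : re_dot euclid_dot (op_poly p h u) u = bf (mpol p t) (u : 'rV[C]_n) u.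
  by rewrite op_poly_mx /re_dot euclid_dotE.
rewrite pE in h3; rewrite -nr_bf1 in h2.
exact: (close_of_close h2 h3 cE).
Qed.

End MatrixCalculus.

Lemma inverse_concave_of_operator_convex (I : set R) (f : R -> R) :
  is_interval I -> (forall x, I x -> 0 < f x) -> {within I, continuous f} ->
  operator_convex I (fun x => - (f x)^-1) -> inverse_concave I f (n := n).
Proof.
move=> I_itv f_gt0 f_cont [g_cont oc] t1 t2 t1I t2I x s s01.
set g := fun x => - (f x)^-1 in g_cont oc.
(* For [n = 0] there are no eigenvalues from which to take endpoints, and all forms vanish. *)
have [n0|] := ltnP 0 n; last first.
  rewrite leqn0 => /eqP n0; have bf0 (A : 'M[C]_n) : bf A x x = 0.
    by rewrite /bf mxE big1// => i; have := ltn_ord i; rewrite [X in (_ < X)%N]n0.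
  by rewrite 3!bf0 !mulr0 addr0.
have tI := ev_conv I_itv s01 t1I t2I.
have [a1 [b1 [Ia1 Ib1 r1]]] := ev_hull n0 t1I.
have [a2 [b2 [Ia2 Ib2 r2]]] := ev_hull n0 t2I.
have spec (t : selfadj R n) : (forall i, I (ev t i)) ->
    op_spectrum (mx_op t) `<=` real_set I.
  by move=> tI' z /mx_op_spectrum; apply: (proj2 (mx_spectrum_sub t I) tI').
have := oc V euclid_dot euclid_hilbert (mx_op t1) (mx_op t2)
  (mx_op_selfadjoint t1) (mx_op_selfadjoint t2) (spec t1 t1I) (spec t2 t2I)
  s s01 (x : V).
rewrite lecE => /andP[_ pos].
set h3 := op_conv s (mx_op t1) (mx_op t2).
have cfcE (t : selfadj R n) (h : {linear V -> V}) : (forall u : V, h u = (u : 'rV[C]_n) *m t) ->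
    (forall i, I (ev t i)) ->
    re_dot euclid_dot (cfc g h x) x = - bf (Fn (fun u => (f u)^-1) t) x x.
  move=> ht tI'; have [a [b [Ia Ib tab]]] := ev_hull n0 tI'.
  have gab : {within `[a, b], continuous g}.
    apply: continuous_subspaceW g_cont => y; rewrite /= in_itv/= => yab.
    exact: I_itv Ia Ib _ yab.
  rewrite (rd_cfc_mx ht n0 tab gab) [LHS]bf_calc [X in _ = - X]bf_calc -sumrN.
  by apply: eq_bigr => i _; rewrite /g mulNr.
have c1 := cfcE t1 (mx_op t1) (fun=> erefl) t1I.
have c2 := cfcE t2 (mx_op t2) (fun=> erefl) t2I.
have h3E (u : V) : h3 u = (u : 'rV[C]_n) *m conv s t1 t2.
  by rewrite /h3 op_convE conv_mx mulmxDr -!scalemxAr.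
have c3 := cfcE (conv s t1 t2) h3 h3E tI.
have : 0 <= re_dot euclid_dot (op_conv s (cfc g (mx_op t1)) (cfc g (mx_op t2)) x
    - cfc g h3 x) x by exact: pos.
rewrite rdDl rdNl rd_op_conv; exact: mix_opp c1 c2 c3.
Qed.

End EuclideanSpace.

(** * The characterization *)

Section JointConvexity.
Context {R : realType} (I : set R) (f : R -> R).
Hypotheses (I_itv : is_interval I) (f_cont : {within I, continuous f}).

Lemma jointly_convexS (D E : set R) n : D `<=` E ->
  jointly_convex E f (n := n) -> jointly_convex D f (n := n).
Proof.
move=> DE jc t1 t2 t1D t2D; apply: jc => i; apply: DE; [exact: t1D|exact: t2D].
Qed.

Lemma jointly_convex0 n : (forall x, I x -> f x = 0) ->
  jointly_convex I f (n := n).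
Proof.
move=> f0; have bf0 (t : selfadj R n) x : (forall i, I (ev t i)) ->
    bf (Fn f t) x x = 0.
  by move=> tI; rewrite [LHS]bf_calc big1// => i _; rewrite f0// mul0r.
move=> t1 t2 t1I t2I x1 x2 s s01.
apply: (le_subst (esym (bf0 _ _ (ev_conv I_itv s01 t1I t2I)))
  (esym (bf0 _ x1 t1I)) (esym (bf0 _ x2 t2I))).
by rewrite !mulr0 addr0.
Qed.

(** Joint convexity is extended from the interior to [I] before the dichotomy is applied, because
    positivity of [f] and operator convexity are claimed up to the endpoints. *)
Lemma strongly_operator_convexP : I° !=set0 ->
  strongly_operator_convex I f <->
  forall n, jointly_convex I° f (n := n).
Proof.
move=> [c Ic]; split=> [[_ [f0 n|[f_gt0 oc] n]]|jc].
- by apply: jointly_convexS (jointly_convex0 f0); exact: interior_subset.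
- apply: jointly_convexS (@interior_subset _ I) _.
  apply: jointly_convex_of_inverse_concave => //.
  exact: inverse_concave_of_operator_convex.
have {}jc n : jointly_convex I f (n := n) by exact: jointly_convex_closure Ic _.
split=> //; have [f0|f_gt0] := jointly_convex_dichotomy I_itv f_cont Ic (jc 1%N).
  by left.
right; split=> //; apply: operator_convex_of_inverse_concave => // n.
exact: inverse_concave_of_jointly_convex.
Qed.

End JointConvexity.

Theorem theorem5p1 (R : realType) (I : set R) (f : R -> R)
    (I_itv : is_interval I) (I_int : I° !=set0)
    (f_cont : {within I, continuous f}) (f_C2 : C2_on I° f) :
  strongly_operator_convex I f <->
  forall (n : nat), (0 < n)%N -> forall t h : selfadj R n,
    mx_spectrum t `<=` real_set I° ->
    psdmx (block_mx (2^-1 *: d2Fn f t h h : selfadj R n) (dFn f t h)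
                    (dFn f t h) (Fn f t)).
Proof.
apply: (iff_trans (strongly_operator_convexP I_itv f_cont I_int)).
have oI : open I° by exact: open_interior.
split=> [jc n _ t h /mx_spectrum_sub tI|psd n].
  apply/psdmx_blockP => x y.
  exact: hess_of_jointly_convex oI f_C2 (jc n) t h x y tI.
apply: (jointly_convex_of_hess oI f_C2); first exact: interval_interior.
(* Joint convexity is asked for all sizes, the matrix condition for positive ones; in size 0 the
   forms are empty sums. *)
case: n => [|n] t h x y tI.
  by rewrite /hess /bf !mxE !big_ord0 /= mulr0 !addr0.
by have /psdmx_blockP := psd n.+1 isT t h (proj2 (mx_spectrum_sub t I°) tI); apply.
Qed.
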